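(* For each of the following pairs consisting of a closed subgroup $\Gamma\le\mathbf{O}(2)$ and a homomorphism $\eta:\Gamma\to\{\pm1\}$, written $\Gamma[\ker\eta]$ if $\eta$ is nontrivial and $\Gamma$ if $\eta$ is trivial, a quadratic differential form $\omega=a\,dy^2+2b\,dx\,dy+c\,dx^2$ with polynomial coefficients $a,b,c$ on $\mathbb{R}^2$ is $\Gamma_\eta$-equivariant if and only if there exist $\Gamma$-invariant polynomials $p,p_1,p_2,\dots\in\mathcal{P}(\Gamma)$ such that $(a,b,c)$ has the form listed. Moreover, for the associated homomorphism $\lambda:\Gamma\to\{\pm1\}$ (which records whether an element of $\Gamma$ preserves or interchanges the two foliations of the binary differential equation $\omega=0$), $\ker\lambda$ is the group listed. Here $z=x+iy$. 1. $\mathbf{SO}(2)$: $\ker\lambda=\mathbf{SO}(2)$; $a=p_1+(y^2-x^2)p_2+2xyp_3$, $b=2xyp_2+(x^2-y^2)p_3$, $c=p_1+(x^2-y^2)p_2-2xyp_3$. 2. $\mathbf{O}(2)$: $\ker\lambda=\mathbf{SO}(2)$; $a=p_1+(y^2-x^2)p_2$, $b=2xyp_2$, $c=p_1+(x^2-y^2)p_2$. 3. $\mathbf{O}(2)[\mathbf{SO}(2)]$: $\ker\lambda=\mathbf{O}(2)$; $a=2xyp$, $b=(x^2-y^2)p$, $c=-2xyp$. 4. $\mathbf{Z}_n$, $n\ge3$: $\ker\lambda=\mathbf{Z}_n$; $a=p_1+(y^2-x^2)p_2+2xyp_3-A_1p_4-A_2p_5$, $b=2xyp_2+(x^2-y^2)p_3+A_1p_5-A_2p_4$,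 $c=p_1+(x^2-y^2)p_2-2xyp_3+A_1p_4+A_2p_5$. 5. $\mathbf{Z}_n[\mathbf{Z}_{n/2}]$, $n\ge4$ even: $\ker\lambda=\mathbf{Z}_{n/2}$; $a=-A_3p_1-A_4p_2+A_5p_3-A_7p_4+A_8p_5+A_6p_6$, $b=-A_4p_1+A_3p_2+A_8p_4+A_7p_5$, $c=A_3p_1+A_4p_2+A_5p_3+A_7p_4-A_8p_5+A_6p_6$. 6. $\mathbf{D}_n$, $n\ge3$: $\ker\lambda=\mathbf{Z}_n$; $a=p_1+(y^2-x^2)p_2-A_1p_3$, $b=2xyp_2-A_2p_3$, $c=p_1+(x^2-y^2)p_2+A_1p_3$. 7. $\mathbf{D}_n[\mathbf{Z}_n]$, $n\ge3$: $\ker\lambda=\mathbf{D}_n$; $a=2xyp_1-A_2p_2+A_9p_3$, $b=(x^2-y^2)p_1+A_1p_2$, $c=-2xyp_1+A_2p_2+A_9p_3$. 8. $\mathbf{D}_n[\mathbf{D}_{n/2}(\kappa_x)]$, $n\ge4$ even: $\ker\lambda=\mathbf{D}_{n/2}(\kappa_y)$; $a=-A_3p_1+A_5p_2-A_7p_3$, $b=-A_4p_1+A_8p_3$, $c=A_3p_1+A_5p_2+A_7p_3$. 9. $\mathbf{Z}_2$: $\ker\lambda=\mathbf{1}$; $a=p_1$, $b=yp_2$, $c=p_3$. 10. $\mathbf{Z}_2[\mathbf{1}]$: $\ker\lambda=\mathbf{Z}_2$; $a=yp_1$, $b=p_2$, $c=yp_3$. 11. $\mathbf{Z}_2\times\mathbf{Z}_2$: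 $\ker\lambda=\mathbf{Z}_2(-I)$; $a=p_1$, $b=xyp_2$, $c=p_3$. 12. $\mathbf{Z}_2\times\mathbf{Z}_2[\mathbf{Z}_2(-I)]$: $\ker\lambda=\mathbf{Z}_2\times\mathbf{Z}_2$; $a=xyp_1$, $b=p_2$, $c=xyp_3$. 13. $\mathbf{Z}_2\times\mathbf{Z}_2[\mathbf{Z}_2(\kappa_x)]$: $\ker\lambda=\mathbf{Z}_2(\kappa_y)$; $a=xp_1$, $b=yp_2$, $c=xp_3$. In this list $A_1=\mathrm{Re}(z^{n-2})$, $A_2=\mathrm{Im}(z^{n-2})$, $A_3=\mathrm{Re}(z^{n/2-2})$, $A_4=\mathrm{Im}(z^{n/2-2})$, $A_5=\mathrm{Re}(z^{n/2})$, $A_6=\mathrm{Im}(z^{n/2})$, $A_7=\mathrm{Re}(z^{n/2+2})$, $A_8=\mathrm{Im}(z^{n/2+2})$, $A_9=\mathrm{Im}(z^n)$.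
   Context: All groups act on $\mathbb{R}^2\simeq\mathbb{C}$ in the standard way. $\mathcal{P}(\Gamma)$ is the ring of real polynomial functions $f$ on $\mathbb{R}^2$ with $f(\gamma u)=f(u)$ for all $\gamma\in\Gamma$, $u\in\mathbb{R}^2$. A form $\omega=a\,dy^2+2b\,dx\,dy+c\,dx^2$ is regarded as the function $\omega(u,v)=a(u)\,dy^2+2b(u)\,dx\,dy+c(u)\,dx^2$ of a point $u=(x,y)$ and a tangent vector $v=(dx,dy)$; it is $\Gamma_\eta$-equivariant if $\omega(\gamma u,\gamma v)=\eta(\gamma)\omega(u,v)$ for all $\gamma\in\Gamma$ and all $u,v$. Equivalently, the matrix-valued mapping $B=\begin{pmatrix}c&b\\ b&a\end{pmatrix}$ satisfies $B(\gamma u)=\eta(\gamma)\,\gamma B(u)\gamma^t$ for all $\gamma\in\Gamma$, $u\in\mathbb{R}^2$. The homomorphism $\lambda$: let $\delta=b^2-ac$ and $\Omega=\{u\in\mathbb{R}^2:\delta(u)>0\}$, which is $\Gamma$-invariant. On $\Omega$ the solution curves of the binary differential equation $\omega=0$ form a pair of transverse foliations $\mathscr{F}_1,\mathscr{F}_2$, associated with the vector fields $X_i=(a,\,-b+(-1)^i\sqrt{\delta})$, $i=1,2$. For equations with $\Omega$ non-empty, $\lambda:\Gamma\to\{\pm1\}$ is defined by $\lambda(\gamma)=1$ if $\gamma(\mathscr{F}_i)=\mathscr{F}_i$ and $\lambda(\gamma)=-1$ if $\gamma(\mathscr{F}_i)=\mathscr{F}_j$ with $j\ne i$, $i,j\in\{1,2\}$.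 Thus $\ker\lambda$ is the group of symmetries of each foliation $\mathscr{F}_i$. Groups: $\kappa_x$ is the reflection across the $x$-axis, $\kappa_x(x,y)=(x,-y)$ (i.e. $z\mapsto\bar z$), and $\kappa_y$ the reflection across the $y$-axis, $\kappa_y(x,y)=(-x,y)$. In items 4–8, $\mathbf{Z}_m$ denotes the cyclic group generated by the rotation of angle $2\pi/m$. $\mathbf{D}_n$ is the dihedral group generated by the rotation of angle $2\pi/n$ and $\kappa_x$; $\mathbf{D}_{n/2}(\kappa_x)$ and $\mathbf{D}_{n/2}(\kappa_y)$ are the groups generated by the rotation of angle $4\pi/n$ together with $\kappa_x$, respectively $\kappa_y$. In items 9 and 10, $\mathbf{Z}_2$ is the group generated by $\kappa_x$, and $\mathbf{1}$ is the trivial group. In items 11–13, $\mathbf{Z}_2\times\mathbf{Z}_2$ is the group generated by $\kappa_x$ and $\kappa_y$; $\mathbf{Z}_2(-I)$, $\mathbf{Z}_2(\kappa_x)$ and $\mathbf{Z}_2(\kappa_y)$ are its subgroups generated by $-I$, $\kappa_x$ and $\kappa_y$ respectively. Since $\eta$ takes values in $\{\pm1\}$, it is determined by its kernel.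
   Formalization: In item 8 with n divisible by 4 the listed kernel is false (n=4, dx²-dy²=0: κ_x lies in D_2(κ_y) but swaps the foliations); there ker λ is instead the group generated by the rotation of angle 4π/n and the rotation of angle 2π/n composed with κ_x. *)

(* Defs.v *)
From HB Require Import structures.
From mathcomp Require Import all_boot all_order all_algebra polyXY.
From mathcomp Require Import complex.
From mathcomp Require Import all_classical all_reals all_analysis.

Set Implicit Arguments.
Unset Strict Implicit.
Unset Printing Implicit Defensive.

Import Order.TTheory GRing.Theory Num.Theory.
Import numFieldNormedType.Exports.

Local Open Scope classical_set_scope.
Local Open Scope ring_scope.

(* The plane is 'cV[R]_2, so that a matrix g acts on a point u by g *m u. *)

Definition xcoord (R : realType) (u : 'cV[R]_2) : R := u 0 0.
Definition ycoord (R : realType) (u : 'cV[R]_2) : R := u 1 0.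

Definition mx2 (R : realType) (p q r s : R) : 'M[R]_2 :=
  \matrix_(i, j) (if i == 0 then if j == 0 then p else q
                  else if j == 0 then r else s).

Definition rotation (R : realType) (t : R) : 'M[R]_2 :=
  mx2 (cos t) (- sin t) (sin t) (cos t).
Definition kappa_x (R : realType) : 'M[R]_2 := mx2 1 0 0 (-1).
Definition kappa_y (R : realType) : 'M[R]_2 := mx2 (-1) 0 0 1.

Definition O2 (R : realType) : set 'M[R]_2 := [set g | g *m g^T = 1%:M].
Definition SO2 (R : realType) : set 'M[R]_2 := [set g | O2 g /\ \det g = 1].

Definition is_group (R : realType) (G : set 'M[R]_2) : Prop :=
  [/\ G 1%:M, forall g h, G g -> G h -> G (g *m h)
    & forall g, G g -> G (invmx g)].

Definition generated (R : realType) (S : set 'M[R]_2) : set 'M[R]_2 :=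
  smallest (@is_group R) S.

Definition Zrot (R : realType) (m : nat) : set 'M[R]_2 :=
  generated [set rotation (2 * pi / m%:R)].

(* The dihedral group of order 2m generated by the rotation of angle 2pi/m
   and the reflection k. *)
Definition Dih (R : realType) (m : nat) (k : 'M[R]_2) : set 'M[R]_2 :=
  generated [set rotation (2 * pi / m%:R); k].

Definition sign_hom (R : realType) (G : set 'M[R]_2) (h : 'M[R]_2 -> R) :
    Prop :=
  (forall g, G g -> h g = 1 \/ h g = -1) /\
  (forall g g', G g -> G g' -> h (g *m g') = h g * h g').

Definition kernel (R : realType) (G : set 'M[R]_2) (h : 'M[R]_2 -> R) :
    set 'M[R]_2 :=
  [set g | G g /\ h g = 1].

Definition polyfun (R : realType) (f : 'cV[R]_2 -> R) : Prop :=
  exists p : {poly {poly R}}, forall u, f u = p.[xcoord u, ycoord u].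

(* The ring P(G) of G-invariant polynomial functions. *)
Definition invpoly (R : realType) (G : set 'M[R]_2) (f : 'cV[R]_2 -> R) :
    Prop :=
  polyfun f /\ forall g u, G g -> f (g *m u) = f u.

(* The quadratic differential form a dy^2 + 2 b dx dy + c dx^2. *)
Record qdform (R : realType) := QDForm {
  qa : 'cV[R]_2 -> R;
  qb : 'cV[R]_2 -> R;
  qc : 'cV[R]_2 -> R }.

Definition qdeval (R : realType) (w : qdform R) (u v : 'cV[R]_2) : R :=
  let dx := xcoord v in let dy := ycoord v in
  qa w u * dy ^+ 2 + 2 * qb w u * dx * dy + qc w u * dx ^+ 2.

Definition polyform (R : realType) (w : qdform R) : Prop :=
  [/\ polyfun (qa w), polyfun (qb w) & polyfun (qc w)].

Definition equivariant (R : realType) (G : set 'M[R]_2) (eta : 'M[R]_2 -> R)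
    (w : qdform R) : Prop :=
  forall g u v, G g -> qdeval w (g *m u) (g *m v) = eta g * qdeval w u v.

Definition delta (R : realType) (w : qdform R) (u : 'cV[R]_2) : R :=
  qb w u ^+ 2 - qa w u * qc w u.

Definition Omega (R : realType) (w : qdform R) : set 'cV[R]_2 :=
  [set u | 0 < delta w u].

(* The line at u of the foliation F_i.  The first equation says that v is
   parallel to X_i = (a, -b + (-1)^i sqrt delta).  Wherever X_i is nonzero, the
   second one, parallelism to Y_i = (b + (-1)^i sqrt delta, -c), follows from
   it, because b^2 - delta = a c.  But X_i vanishes where a = 0 and
   b = (-1)^i |b|; there Y_i = (2 b, -c) is nonzero and spans the continuous
   extension of the line field spanned by X_i.  On Omega the two equations
   therefore always define a line, contained in the zeros of the form. *)
Definition tangent (R : realType) (w : qdform R) (i : nat)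
    (u v : 'cV[R]_2) : Prop :=
  let s := (-1) ^+ i * Num.sqrt (delta w u) in
  qa w u * ycoord v = (- qb w u + s) * xcoord v /\
  (qb w u + s) * ycoord v = - qc w u * xcoord v.

(* Regular C^1 solution curves of w = 0 in Omega, of the family i (i = 1, 2).
   A curve is a pair of an open interval and a function whose values matter
   only on this interval. *)
Definition solution_curve (R : realType) (w : qdform R) (i : nat)
    (C : set R * (R -> 'cV[R]_2)) : Prop :=
  [/\ open C.1, is_interval C.1, C.1 !=set0 &
   forall t, C.1 t ->
     [/\ Omega w (C.2 t), derivable C.2 t 1, {for t, continuous (C.2^`())%classic},
         (C.2^`())%classic t != 0 & tangent w i (C.2 t) ((C.2^`())%classic t)]].

(* F_i, given by all its solution curves (leaves and arcs of leaves, with all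
   their regular parametrizations). *)
Definition foliation (R : realType) (w : qdform R) (i : nat) :
    set (set R * (R -> 'cV[R]_2)) :=
  [set C | solution_curve w i C].

Definition move_foliation (R : realType) (g : 'M[R]_2)
    (F : set (set R * (R -> 'cV[R]_2))) : set (set R * (R -> 'cV[R]_2)) :=
  [set (C.1, fun t => g *m C.2 t) | C in F].

(* lam is the homomorphism lambda of the equation w = 0.  It is uniquely
   determined on G as soon as F_1 <> F_2. *)
Definition is_lambda (R : realType) (G : set 'M[R]_2) (w : qdform R)
    (lam : 'M[R]_2 -> R) : Prop :=
  sign_hom G lam /\
  forall g, G g ->
    (lam g = 1 <->
       move_foliation g (foliation w 1) = foliation w 1 /\
       move_foliation g (foliation w 2) = foliation w 2) /\
    (lam g = -1 <->
       move_foliation g (foliation w 1) = foliation w 2 /\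
       move_foliation g (foliation w 2) = foliation w 1).

(* For the pair (G, eta) with ker eta = Keta: the equivariant polynomial forms
   are those with the shape [form], where p 1, p 2, ... are G-invariant
   polynomials, and ker lambda = Klam whenever Omega is not empty.  The first
   clause says that Keta is indeed the kernel of a homomorphism. *)
Definition equivariant_forms (R : realType) (G Keta Klam : set 'M[R]_2)
    (form : (nat -> 'cV[R]_2 -> R) -> qdform R -> 'cV[R]_2 -> Prop) : Prop :=
  (exists eta, sign_hom G eta /\ kernel G eta = Keta) /\
  forall eta, sign_hom G eta -> kernel G eta = Keta ->
  forall w, polyform w ->
    (equivariant G eta w <->
       exists p : nat -> 'cV[R]_2 -> R,
         (forall i, invpoly G (p i)) /\ (forall u, form p w u)) /\
    (equivariant G eta w -> Omega w !=set0 ->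
       exists lam, is_lambda G w lam /\ kernel G lam = Klam).

(* Real and imaginary parts of z^m, where z = x + i y. *)
Definition reZ (R : realType) (m : nat) (u : 'cV[R]_2) : R :=
  complex.Re ((Complex (xcoord u) (ycoord u)) ^+ m).
Definition imZ (R : realType) (m : nat) (u : 'cV[R]_2) : R :=
  complex.Im ((Complex (xcoord u) (ycoord u)) ^+ m).

(* Main.v *)
Require Import Defs.
From HB Require Import structures.
From mathcomp Require Import all_boot all_order all_algebra polyXY.
From mathcomp Require Import complex ring lra zify.
From mathcomp Require Import all_classical all_reals all_analysis.

Set Implicit Arguments.
Unset Strict Implicit.
Unset Printing Implicit Defensive.

Import Order.TTheory GRing.Theory Num.Theory.
Import numFieldNormedType.Exports.

Local Open Scope classical_set_scope.
Local Open Scope ring_scope.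

(** Let z be the complex coordinate of u and v^2 the square of the complex
    number dx + i dy.  With the real half-trace T = (a + c) / 2 and the complex
    deviator Q = (c - a) / 2 + i b, the form is

      omega(u, v) = T(u) |v|^2 + Re (conj (Q(u)) v^2),

    and T and Q are determined by omega.  Hence omega is equivariant exactly
    when T(gu) = eta(g) T(u) for all g, Q(gu) = eta(g) a^2 Q(u) for the rotation
    g by a unit complex number a, and Q(gu) = eta(g) conj (Q(u)) for the
    reflection z -> conj z ([equivariantP]).  In all the lists for n >= 3 one
    has eta(g) = a^e on rotations, for e = 0 or e = n / 2, so that both T and Q
    are polynomials F with F(au) = a^e' F(u).

    Expand such an F in the monomials z^j conj(z)^k.  Averaging over the
    rotations of order n kills every monomial whose exponents do not satisfy
    j = e' + k modulo n ([zsum_isotypic]), and the others are invariant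
    multiples of z^e' or of conj(z)^(n - e') ([cyclic_module]; for the full
    circle only z^e' remains, [circle_module]).  A reflection makes the
    coefficients of F real; then X = z^n satisfies X^2 - 2 Re(X) X + |X|^2 = 0
    with invariant coefficients, which allows the multipliers to be taken real
    and invariant under the reflection as well ([dihedral_module]).  The groups
    of order 2 and 4 are a matter of parity in x and y ([polyfun_parity]).

    As for lambda, let B(u) be the symmetric matrix of omega and J a rotation by
    a right angle.  The direction of the i-th foliation at u is the eigenline of
    J B(u) for the eigenvalue (-1)^i sqrt(delta(u)).  An element g multiplies B
    by eta(g) and J by det(g) under conjugation, so it exchanges the two
    eigenlines exactly when eta(g) det(g) = -1, and lambda = eta det
    ([lambda_equivariant]).  For lambda to be well defined the two foliations
    must differ, that is, the differential equation must have a solution curve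
    somewhere in Omega ([solution_curve_exists]); it is obtained by Picard
    iteration ([picard_local]).

    All the groups of the list have the form [dih n c], consisting of the
    rotations by a with a^n = 1 and of the reflections z -> b conj(z) with
    b^n = c, so that the kernels of eta and lambda are computed in three cases
    only: eta trivial, eta = det, and eta(g) = a^(n/2). *)

(** * Existence of solutions of scalar differential equations *)

Section Picard.
Variable R : realType.

Lemma lipschitz1_continuous (f : R -> R) K :
  (forall s t, `|f s - f t| <= K * `|s - t|) -> continuous f.
Proof.
move=> fK x; apply/cvgrPdist_le => e e0; near=> t.
apply: (le_trans (fK x t)); rewrite (le_trans (ler_wpM2r _ (ler_norm K)))//.
rewrite (le_trans (ler_wpM2r (normr_ge0 _) (_ : `|K| <= `|K| + 1)))//.
  by rewrite lerDl.
rewrite mulrC -ler_pdivlMr; last by rewrite ltr_wpDl.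
near: t; apply: cvgr_dist_le; first exact: cvg_id.
by rewrite divr_gt0// ltr_wpDl.
Unshelve. all: by end_near. Qed.

Lemma derive_bound (F g : R -> R) (a b M : R) :
  (forall x, a <= x <= b -> is_derive x 1 F (g x)) ->
  (forall x, a <= x <= b -> `|g x| <= M) ->
  forall s t, a <= s <= b -> a <= t <= b -> `|F s - F t| <= M * `|s - t|.
Proof.
move=> dF gM s t.
wlog st : s t / s <= t => [hw|] /andP[sa sb] /andP[ta tb].
  case: (leP s t) => [st|/ltW ts]; first by apply: hw => //; apply/andP.
  by rewrite distrC [`|s - t|]distrC; apply: hw => //; apply/andP.
have sub x : s <= x <= t -> a <= x <= b.
  by move=> /andP[sx xt]; rewrite (le_trans sa sx) (le_trans xt tb).
have [||r rst] := @MVT_segment R F g s t st.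
- by move=> x /itvP xst; apply/dF/sub; rewrite !xst.
- apply: derivable_within_continuous => x /itvP xst.
  by have [] : is_derive x 1 F (g x) by apply/dF/sub; rewrite !xst.
rewrite distrC [`|s - t|]distrC => ->; rewrite normrM ler_wpM2r//.
by apply/gM/sub; rewrite in_itv in rst.
Qed.

(** The integral starts before [x0], so that it is differentiable from both
    sides at [x0] itself. *)
Definition primitive x0 (g : R -> R) (x : R) : R :=
  \int[lebesgue_measure]_(t in `[x0 - 1, x]) g t.

Lemma is_derive_primitive x0 g (x : R) :
  continuous g -> x0 <= x -> is_derive x 1 (primitive x0 g) (g x).
Proof.
move=> cg x0x.
have xx1 : x < x + 1 by rewrite ltrDl.
have x01x : x0 - 1 < x by rewrite ltrBlDr (le_lt_trans x0x).
have gi : lebesgue_measure.-integrable `[x0 - 1, x + 1] (EFin \o g).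
  apply: continuous_compact_integrable; first exact: segment_compact.
  exact: continuous_subspaceT.
have [dg Dg] := continuous_FTC1_closed xx1 gi x01x (cg x).
by apply: DeriveDef; [exact: dg | rewrite -derive1E; exact: Dg].
Qed.

Lemma ler_addpow2 (a b c : R) : (forall n, a <= b + c / 2 ^+ n) -> a <= b.
Proof.
move=> abc; apply/ler_addgt0Pr => e e0.
have [n cn] : exists n, c / 2 ^+ n <= e.
  have [n cn] : exists n : nat, c / e < n%:R.
    by exists (Num.truncn (c / e)).+1; rewrite truncnS_gt.
  exists n; rewrite ler_pdivrMr ?exprn_gt0// mulrC -ler_pdivrMr//.
  rewrite (le_trans (ltW cn))// -natrX ler_nat.
  by rewrite ltnW// ltn_expl.
by rewrite (le_trans (abc n))// lerD2l.
Qed.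

(** The sequence u_n - 2B / 2^n is nondecreasing and bounded, so its pointwise
    supremum is within 2B / 2^n of u_n. *)
Lemma geometric_limit (T : Type) (u : nat -> T -> R) (B : R) :
  (forall n t, `|u n.+1 t - u n t| <= B / 2 ^+ n) ->
  exists y : T -> R, forall n t, `|u n t - y t| <= 2 * B / 2 ^+ n.
Proof.
move=> uB.
pose e n := 2 * B / 2 ^+ n : R.
have eS n : e n = e n.+1 + B / 2 ^+ n.
  rewrite /e exprS; field; by rewrite expf_neq0.
pose v n t := u n t - e n; pose w n t := u n t + e n.
have vS n t : v n t <= v n.+1 t.
  have := uB n t; rewrite /v eS ler_norml => /andP[]; lra.
have wS n t : w n.+1 t <= w n t.
  have := uB n t; rewrite /w [e n]eS ler_norml => /andP[]; lra.
have e0 (t : T) n : 0 <= e n.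
  by rewrite /e -mulrA mulr_ge0// (le_trans (normr_ge0 _) (uB n t)).
have vw m n t : v m t <= w n t.
  have vm k : v m t <= v (m + k)%N t.
    by elim: k => [|k IH]; rewrite ?addn0// addnS (le_trans IH).
  have wn k : w (n + k)%N t <= w n t.
    by elim: k => [|k IH]; rewrite ?addn0// addnS (le_trans _ IH).
  rewrite (le_trans (vm n))// (le_trans _ (wn m))// addnC /v /w.
  by have := e0 t (n + m)%N; lra.
exists (fun t => sup (range (v^~ t))) => n t.
have hs : has_sup (range (v^~ t)).
  by split; [exists (v 0 t), 0%N | exists (w 0 t) => _ [m _ <-]].
have lo : v n t <= sup (range (v^~ t)) by apply: sup_upper_bound => //; exists n.
have hi : sup (range (v^~ t)) <= w n t.
  by apply: ge_sup; [case: hs | move=> _ [m _ <-]].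
by move: lo hi; rewrite /v /w /e ler_norml => lo hi; apply/andP; split; lra.
Qed.

(** Composing a vector field with this retraction of the line onto [a, b] turns
    a field defined on a box into a globally Lipschitz and bounded one. *)
Definition clamp (a b t : R) : R := Num.max a (Num.min t b).

Lemma clampP a b t : a <= b -> a <= clamp a b t <= b.
Proof. by move=> ab; rewrite /clamp le_max lexx/= ge_max ge_min lexx orbT ab. Qed.

Lemma clamp_id a b t : a <= t <= b -> clamp a b t = t.
Proof. by move=> /andP[at_ tb]; rewrite /clamp min_l// max_r. Qed.

Lemma clamp_lipschitz a b s t : a <= b -> `|clamp a b s - clamp a b t| <= `|s - t|.
Proof.
move=> ab; wlog st : s t / s <= t => [hw|].
  case: (leP s t) => [|/ltW]; first exact: hw.
  by move=> ts; rewrite distrC [leRHS]distrC; exact: hw.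
rewrite [leRHS]distrC (@ger0_norm _ (t - s)) ?subr_ge0// ler_norml /clamp.
move: ab; case: (leP s b); case: (leP t b) => ? ? ?;
  do 2? case: (leP a _) => ?; apply/andP; split; lra.
Qed.

Section PicardGlobal.
Variables (phi : R -> R -> R) (K M x0 y0 h : R).
Hypothesis phiK : forall x y x' y',
  `|phi x y - phi x' y'| <= K * (`|x - x'| + `|y - y'|).
Hypothesis phiM : forall x y, `|phi x y| <= M.
Hypotheses (h0 : 0 <= h) (Kh : K * h <= 2^-1).

Let K0 : 0 <= K.
Proof.
have := le_trans (normr_ge0 _) (phiK 1 0 0 0).
by rewrite !subrr normr0 addr0 subr0 normr1 mulr1.
Qed.

Let M0 : 0 <= M.
Proof. exact: le_trans (normr_ge0 _) (phiM 0 0). Qed.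

Let x0h : x0 <= x0 + h.
Proof. by rewrite lerDl. Qed.

(** Clamping the time makes every iterate a function on the whole line. *)
Let picard_map y t : R :=
  y0 + (primitive x0 (fun s => phi s (y s)) (clamp x0 (x0 + h) t)
        - primitive x0 (fun s => phi s (y s)) x0).

Let lipM (y : R -> R) := forall s t, `|y s - y t| <= M * `|s - t|.

Let field_continuous y : lipM y -> continuous (fun s => phi s (y s)).
Proof.
move=> yM; apply: (@lipschitz1_continuous _ (K * (1 + M))) => s t.
rewrite (le_trans (phiK _ _ _ _))// -mulrA ler_wpM2l//.
by rewrite mulrDl mul1r lerD2l.
Qed.

Let field_primitive y t : lipM y -> x0 <= t <= x0 + h ->
  is_derive t (1 : R) (primitive x0 (fun s => phi s (y s))) (phi t (y t)).
Proof.
by move=> /field_continuous yc /andP[x0t _]; exact: (is_derive_primitive yc x0t).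
Qed.

Let x0P : x0 <= x0 <= x0 + h.
Proof. by rewrite lexx lerDl. Qed.

Let picard_lip y : lipM y -> lipM (picard_map y).
Proof.
move=> yM s t; rewrite /picard_map.
rewrite [X in `|X|](_ : _ = primitive x0 (fun s => phi s (y s)) (clamp x0 (x0 + h) s) -
  primitive x0 (fun s => phi s (y s)) (clamp x0 (x0 + h) t)); last by ring.
have dF x := @field_primitive y x yM.
rewrite (le_trans (derive_bound dF (fun x _ => phiM x _) (clampP s x0h) (clampP t x0h)))//.
by rewrite ler_wpM2l// clamp_lipschitz.
Qed.

Let clamp_x0 t : `|clamp x0 (x0 + h) t - x0| <= h.
Proof. by have /andP[? ?] := clampP t x0h; rewrite ger0_norm; lra. Qed.

Let picard_range y t : lipM y -> `|picard_map y t - y0| <= M * h.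
Proof.
move=> yM; rewrite /picard_map addrAC subrr add0r.
have dF x := @field_primitive y x yM.
rewrite (le_trans (derive_bound dF (fun x _ => phiM x _) (clampP t x0h) x0P))//.
by rewrite ler_wpM2l// clamp_x0.
Qed.

(** The derivative of the difference of the two primitives is at most K e, over
    an interval of length h with K h <= 1/2. *)
Let picard_contraction y z e : lipM y -> lipM z ->
  (forall t, `|y t - z t| <= e) ->
  forall t, `|picard_map y t - picard_map z t| <= e / 2.
Proof.
move=> yM zM yz t; rewrite /picard_map.
pose F := primitive x0 (fun s => phi s (y s)) - primitive x0 (fun s => phi s (z s)).
rewrite [X in `|X|](_ : _ = F (clamp x0 (x0 + h) t) - F x0); last first.
  by rewrite /F !fctE; ring.
have dF x : x0 <= x <= x0 + h -> is_derive x (1 : R) F (phi x (y x) - phi x (z x)).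
  by move=> xh; apply: is_deriveB; exact: field_primitive.
have bF x : x0 <= x <= x0 + h -> `|phi x (y x) - phi x (z x)| <= K * e.
  move=> _; rewrite (le_trans (phiK _ _ _ _))// ler_wpM2l//.
  by rewrite subrr normr0 add0r.
rewrite (le_trans (derive_bound dF bF (clampP t x0h) x0P))//.
have e0 : 0 <= e := le_trans (normr_ge0 _) (yz 0).
rewrite (@le_trans _ _ (K * e * h))//.
  by rewrite ler_wpM2l ?mulr_ge0// clamp_x0.
by rewrite mulrAC [e / 2]mulrC ler_wpM2r.
Qed.

(** The iterates form a geometric sequence by the contraction property; their
    limit inherits the Lipschitz constant M and is the fixed point. *)
Lemma picard_global : exists y : R -> R,
  continuous (fun s => phi s (y s)) /\
  forall x, x0 < x < x0 + h ->
    is_derive x (1 : R) y (phi x (y x)) /\ `|y x - y0| <= M * h.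
Proof.
pose u n := iter n picard_map (fun=> y0).
have uM n : lipM (u n).
  elim: n => [s t|n IH] /=; last exact: picard_lip.
  by rewrite subrr normr0 mulr_ge0.
have uB n t : `|u n.+1 t - u n t| <= M * h / 2 ^+ n.
  elim: n t => [|n IH] t.
    by rewrite expr0 divr1 (picard_range t (uM 0)).
  rewrite exprSr invfM mulrA.
  exact: (picard_contraction (uM n.+1) (uM n) IH).
have [y uy] := geometric_limit uB.
have yM : lipM y.
  move=> s t; apply: (@ler_addpow2 _ _ (4 * (M * h))) => n.
  have := uM n s t; have := uy n s; have := uy n t.
  set E := _ / 2 ^+ n; set E' := _ / 2 ^+ n.
  have -> : E' = 2 * E by rewrite /E' /E; field; rewrite expf_neq0.
  move: (M * `|s - t|) => D; rewrite !ler_norml.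
  by move=> /andP[? ?] /andP[? ?] /andP[? ?]; apply/andP; split; lra.
have fixy t : picard_map y t = y t.
  apply/eqP; rewrite -subr_eq0 -normr_le0.
  apply: (@ler_addpow2 _ _ (2 * (M * h))) => n.
  have := picard_contraction (uM n) yM (uy n) t; have := uy n.+1 t.
  rewrite -[u n.+1 t]/(picard_map (u n) t) add0r exprS.
  set E := _ / 2 ^+ n; set E' := _ / (2 * _).
  have -> : E' = E / 2 by rewrite /E' /E; field; rewrite expf_neq0.
  rewrite !ler_norml => /andP[? ?] /andP[? ?]; apply/andP; split; lra.
exists y; split; first exact: field_continuous.
move=> x /andP[x0x xh]; split; last first.
  by rewrite -fixy; exact: picard_range.
have xP : x0 <= x <= x0 + h by rewrite !ltW.
have dP := field_primitive yM xP.
have : is_derive x (1 : R) (fun t => y0 + (primitive x0 (fun s => phi s (y s)) t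
    - primitive x0 (fun s => phi s (y s)) x0)) (phi x (y x)).
  have := is_deriveD (is_derive_cst y0 x 1) (is_deriveB dP
    (is_derive_cst (primitive x0 (fun s => phi s (y s)) x0) x 1)).
  by rewrite add0r subr0.
apply: near_eq_is_derive.
near=> t; rewrite -fixy /picard_map.
rewrite clamp_id//; apply/andP; split; apply/ltW; near: t.
  exact: lt_nbhsr.
exact: lt_nbhsl.
Unshelve. all: by end_near. Qed.
End PicardGlobal.

(** The function [g] is the slope along the solution, computed with the field
    clamped to the box: it is continuous on the whole line, which gives the
    continuity of the derivative of the solution. *)
Lemma picard_local (phi : R -> R -> R) (K x0 y0 r : R) : 0 < r -> 0 <= K ->
  (forall x y x' y', `|x - x0| <= r -> `|y - y0| <= r ->
     `|x' - x0| <= r -> `|y' - y0| <= r ->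
     `|phi x y - phi x' y'| <= K * (`|x - x'| + `|y - y'|)) ->
  exists h (y g : R -> R), [/\ 0 < h, continuous g &
    forall x, x0 < x < x0 + h ->
      [/\ `|x - x0| <= r, `|y x - y0| <= r, is_derive x (1 : R) y (g x)
        & g x = phi x (y x)]].
Proof.
move=> r0 K0 phiK.
have box a : a - r <= a + r by lra.
have boxP a t : `|clamp (a - r) (a + r) t - a| <= r.
  by have /andP[? ?] := clampP t (box a); rewrite ler_norml; apply/andP; split; lra.
have boxid a t : `|t - a| <= r -> clamp (a - r) (a + r) t = t.
  by rewrite ler_norml => /andP[? ?]; apply: clamp_id; apply/andP; split; lra.
pose psi x y := phi (clamp (x0 - r) (x0 + r) x) (clamp (y0 - r) (y0 + r) y).
pose M := `|phi x0 y0| + K * (r + r).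
have psiK x y x' y' : `|psi x y - psi x' y'| <= K * (`|x - x'| + `|y - y'|).
  rewrite (le_trans (phiK _ _ _ _ _ _ _ _))//.
  by rewrite ler_wpM2l// lerD// clamp_lipschitz.
have psiM x y : `|psi x y| <= M.
  rewrite -[psi x y](subrK (phi x0 y0)) (le_trans (ler_normD _ _))//.
  rewrite addrC /M lerD2l (le_trans (phiK _ _ _ _ _ _ _ _))//.
  - by rewrite subrr normr0 ltW.
  - by rewrite subrr normr0 ltW.
  - by rewrite ler_wpM2l// lerD.
have M0 : 0 <= M := le_trans (normr_ge0 _) (psiM 0 0).
pose h := Num.min r (Num.min (2^-1 / (K + 1)) (r / (M + 1))).
have h0 : 0 < h by rewrite !lt_min r0 !divr_gt0 ?ltr_wpDl.
have hr : h <= r by rewrite ge_min lexx.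
have Kh : K * h <= 2^-1.
  rewrite (@le_trans _ _ ((K + 1) * h))//.
    by apply: ler_wpM2r; [exact: ltW | lra].
  by rewrite mulrC -ler_pdivlMr ?ltr_wpDl// /h !ge_min lexx !orbT.
have Mh : M * h <= r.
  rewrite (@le_trans _ _ ((M + 1) * h))//.
    by apply: ler_wpM2r; [exact: ltW | lra].
  by rewrite mulrC -ler_pdivlMr ?ltr_wpDl// /h !ge_min lexx !orbT.
have [y [cy dy]] := picard_global x0 y0 psiK psiM (ltW h0) Kh.
exists h, y, (fun s => psi s (y s)); split=> // x xh; have [dyx yr] := dy x xh.
have xr : `|x - x0| <= r.
  by case/andP: xh => ? ?; rewrite ler_norml; apply/andP; split; lra.
have yxr : `|y x - y0| <= r := le_trans yr Mh.
by split=> //; rewrite /psi !boxid.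
Qed.

End Picard.

(** * Matrix-valued curves *)

Section MatrixCurves.
Variables (R : realType) (V : normedModType R) (m n : nat).
Implicit Types (M : V -> 'M[R]_(m, n)) (t v : V).

Lemma is_derive_mxP M t v (D : 'M[R]_(m, n)) :
  is_derive t v M D <-> forall i j, is_derive t v (fun s => M s i j) (D i j).
Proof.
split=> [dM i j|dM].
  have dMt : derivable M t v by [].
  apply: DeriveDef; first by move/derivable_mxP: dMt.
  by rewrite -(@derive_val _ _ _ _ _ _ _ dM) derive_mx// mxE.
have dMt : derivable M t v by apply/derivable_mxP => i j; have [] := dM i j.
apply: DeriveDef => //; rewrite derive_mx//; apply/matrixP => i j.
by rewrite mxE; have := dM i j => d; rewrite derive_val.
Qed.

Lemma continuous_mx M t :
  (forall i j, {for t, continuous (fun s => M s i j)}) -> {for t, continuous M}.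
Proof.
move=> cM; apply/cvgrPdist_le => e e0; near=> s.
rewrite /Num.Def.normr/= mx_normrE (bigmax_le _ (ltW e0))//= => i _.
rewrite !mxE; move: i; near: s; apply: filter_forall => /= i.
by have /cvgrPdist_le := cM i.1 i.2; exact.
Unshelve. all: by end_near. Qed.
End MatrixCurves.

(** * Polynomial functions on the plane *)

Section PolynomialFunctions.
Variable R : realType.
Implicit Types (f g : 'cV[R]_2 -> R) (u v : 'cV[R]_2).

Lemma polyfun_ind (P : ('cV[R]_2 -> R) -> Prop) :
  (forall c, P (fun=> c)) -> P (@xcoord R) -> P (@ycoord R) ->
  (forall f g, P f -> P g -> P (fun u => f u + g u)) ->
  (forall f g, P f -> P g -> P (fun u => f u * g u)) ->
  forall f, polyfun f -> P f.
Proof.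
move=> Pc Px Py PD PM f [p fp].
have -> : f = fun u => p.[xcoord u, ycoord u] by apply/funext.
elim/poly_ind: p {f fp} => [|p q IHp].
  by under eq_fun do rewrite !horner0; exact: Pc.
under eq_fun do rewrite !hornerE/=.
apply: (PD); first exact: PM.
elim/poly_ind: q => [|q c IHq]; first by under eq_fun do rewrite horner0; exact: Pc.
under eq_fun do rewrite !hornerE/=.
by apply: PD; [exact: PM | exact: Pc].
Qed.

Lemma polyfun_cst c : polyfun (fun _ : 'cV[R]_2 => c).
Proof. by exists c%:P%:P => u; rewrite !hornerE. Qed.

Lemma polyfun_x : polyfun (@xcoord R).
Proof. by exists 'X => u; rewrite !hornerE. Qed.

Lemma polyfun_y : polyfun (@ycoord R).
Proof. by exists 'X%:P => u; rewrite !hornerE. Qed.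

Lemma polyfunD f g : polyfun f -> polyfun g -> polyfun (fun u => f u + g u).
Proof. by move=> [p fp] [q gq]; exists (p + q) => u; rewrite !hornerD fp gq. Qed.

Lemma polyfunM f g : polyfun f -> polyfun g -> polyfun (fun u => f u * g u).
Proof. by move=> [p fp] [q gq]; exists (p * q) => u; rewrite !hornerM fp gq. Qed.

Lemma polyfunN f : polyfun f -> polyfun (fun u => - f u).
Proof. by move=> [p fp]; exists (- p) => u; rewrite !hornerN fp. Qed.

Lemma polyfunB f g : polyfun f -> polyfun g -> polyfun (fun u => f u - g u).
Proof. by move=> pf pg; apply: polyfunD => //; exact: polyfunN. Qed.

End PolynomialFunctions.

(** * Locally Lipschitz functions *)

Section LocallyLipschitz.
Variable R : realType.
Implicit Types (f g : 'cV[R]_2 -> R) (u v : 'cV[R]_2).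

Definition dist1 u v : R := `|xcoord u - xcoord v| + `|ycoord u - ycoord v|.

(** This class contains the polynomials and is closed under the operations that
    build the slope (- b - sqrt delta) / a; it provides both the continuity of
    the slope and the Lipschitz bound in Picard's theorem. *)
Definition locally_lipschitz f u0 := exists r K : R, [/\ 0 < r, 0 <= K &
  forall u v, dist1 u u0 <= r -> dist1 v u0 <= r -> `|f u - f v| <= K * dist1 u v].

Lemma dist1_ge0 u v : 0 <= dist1 u v.
Proof. exact: addr_ge0. Qed.

Lemma dist1_refl u : dist1 u u = 0.
Proof. by rewrite /dist1 !subrr normr0 addr0. Qed.

Lemma locally_lipschitz_cst c u0 : locally_lipschitz (fun=> c) u0.
Proof. by exists 1, 0; split=> // u v _ _; rewrite subrr normr0 mul0r. Qed.

Lemma locally_lipschitz_x u0 : locally_lipschitz (@xcoord R) u0.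
Proof. by exists 1, 1; split=> // u v _ _; rewrite mul1r lerDl. Qed.

Lemma locally_lipschitz_y u0 : locally_lipschitz (@ycoord R) u0.
Proof. by exists 1, 1; split=> // u v _ _; rewrite mul1r lerDr. Qed.

Lemma locally_lipschitzD f g u0 : locally_lipschitz f u0 ->
  locally_lipschitz g u0 -> locally_lipschitz (fun u => f u + g u) u0.
Proof.
move=> [r [K [r0 K0 fK]]] [s [L [s0 L0 gL]]].
exists (Num.min r s), (K + L); split; rewrite ?lt_min ?r0 ?addr_ge0// => u v.
rewrite !le_min => /andP[ur us] /andP[vr vs].
rewrite opprD addrACA (le_trans (ler_normD _ _))// mulrDl.
by rewrite lerD ?fK ?gL.
Qed.

Lemma locally_lipschitzN f u0 : locally_lipschitz f u0 ->
  locally_lipschitz (fun u => - f u) u0.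
Proof.
move=> [r [K [r0 K0 fK]]]; exists r, K; split=> // u v ur vr.
by rewrite -opprD normrN fK.
Qed.

Lemma locally_lipschitz_bounded f u0 : locally_lipschitz f u0 ->
  exists r M : R, [/\ 0 < r, 0 <= M & forall u, dist1 u u0 <= r -> `|f u| <= M].
Proof.
move=> [r [K [r0 K0 fK]]]; exists r, (`|f u0| + K * r); split=> //.
  by rewrite addr_ge0// mulr_ge0// ltW.
move=> u ur; rewrite -[f u](subrK (f u0)) addrC (le_trans (ler_normD _ _))// lerD2l.
rewrite (le_trans (fK _ _ ur _))//; first by rewrite dist1_refl ltW.
by rewrite ler_wpM2l.
Qed.

Lemma locally_lipschitzM f g u0 : locally_lipschitz f u0 ->
  locally_lipschitz g u0 -> locally_lipschitz (fun u => f u * g u) u0.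
Proof.
move=> lf lg.
have [r1 [A [r10 A0 fA]]] := locally_lipschitz_bounded lf.
have [r2 [B [r20 B0 gB]]] := locally_lipschitz_bounded lg.
case: lf lg => [r [K [r0 K0 fK]]] [s [L [s0 L0 gL]]].
exists (Num.min (Num.min r s) (Num.min r1 r2)), (A * L + K * B); split.
- by rewrite !lt_min r0 s0 r10.
- by rewrite addr_ge0// mulr_ge0.
move=> u v.
rewrite !le_min => /andP[/andP[ur us] /andP[u1 u2]] /andP[/andP[vr vs] /andP[v1 v2]].
rewrite (_ : f u * g u - f v * g v = f u * (g u - g v) + (f u - f v) * g v); last by ring.
rewrite (le_trans (ler_normD _ _))// !normrM mulrDl lerD//.
  by rewrite -mulrA ler_pM// ?fA// gL.
by rewrite mulrAC ler_pM// ?gB// fK.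
Qed.

(** Stability of positivity, with the quantitative lower bound needed for
    inverses and square roots. *)
Lemma locally_lipschitz_pos f u0 : locally_lipschitz f u0 -> 0 < f u0 ->
  exists2 r : R, 0 < r & forall u, dist1 u u0 <= r -> f u0 / 2 <= f u.
Proof.
move=> [r [K [r0 K0 fK]]] f0.
exists (Num.min r (f u0 / 2 / (K + 1))).
  by rewrite lt_min r0 !divr_gt0// ltr_wpDl.
move=> u; rewrite le_min ler_pdivlMr ?ltr_wpDl// => /andP[ur uf].
have := fK u u0 ur; rewrite dist1_refl => /(_ (ltW r0)).
rewrite ler_norml => /andP[lo _].
have := dist1_ge0 u u0; move: uf lo; rewrite mulrDr mulr1 [K * _]mulrC.
by move: (_ * K) => D; lra.
Qed.

Lemma locally_lipschitzV f u0 : locally_lipschitz f u0 -> 0 < f u0 ->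
  locally_lipschitz (fun u => (f u)^-1) u0.
Proof.
move=> lf f0; have [r1 r10 fr] := locally_lipschitz_pos lf f0.
have [r [K [r0 K0 fK]]] := lf.
have m0 : 0 < f u0 / 2 by rewrite divr_gt0.
exists (Num.min r r1), (K / (f u0 / 2) ^+ 2); split.
- by rewrite lt_min r0.
- by rewrite divr_ge0// exprn_ge0// ltW.
move=> u v; rewrite !le_min => /andP[ur u1] /andP[vr v1].
have fu := lt_le_trans m0 (fr u u1); have fv := lt_le_trans m0 (fr v v1).
have -> : (f u)^-1 - (f v)^-1 = (f v - f u) / (f u * f v).
  by field; rewrite !gt_eqF.
rewrite normrM distrC mulrAC ler_pM ?fK//.
rewrite ger0_norm ?invr_ge0; last by rewrite ltW// mulr_gt0.
by rewrite lef_pV2 ?posrE ?exprn_gt0 ?mulr_gt0// expr2 ler_pM ?fr ?(ltW m0).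
Qed.

Lemma locally_lipschitz_sqrt f u0 : locally_lipschitz f u0 -> 0 < f u0 ->
  locally_lipschitz (fun u => Num.sqrt (f u)) u0.
Proof.
move=> lf f0; have [r1 r10 fr] := locally_lipschitz_pos lf f0.
have [r [K [r0 K0 fK]]] := lf.
have m0 : 0 < f u0 / 2 by rewrite divr_gt0.
have s0 : 0 < Num.sqrt (f u0 / 2) by rewrite sqrtr_gt0.
exists (Num.min r r1), (K / Num.sqrt (f u0 / 2)); split.
- by rewrite lt_min r0.
- by rewrite divr_ge0// ltW.
move=> u v; rewrite !le_min => /andP[ur u1] /andP[vr v1].
have fu := lt_le_trans m0 (fr u u1); have fv := lt_le_trans m0 (fr v v1).
have su : Num.sqrt (f u0 / 2) <= Num.sqrt (f u) by rewrite ler_sqrt ?fr// ltW.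
have sv := sqrtr_ge0 (f v).
rewrite mulrAC ler_pdivlMr// (le_trans _ (fK u v ur vr))//.
have -> : f u - f v = (Num.sqrt (f u) - Num.sqrt (f v)) * (Num.sqrt (f u) + Num.sqrt (f v)).
  by rewrite -subr_sqr !sqr_sqrtr// ltW.
rewrite normrM ler_wpM2l// ger0_norm; first by lra.
by rewrite addr_ge0// (le_trans (ltW s0)).
Qed.

Lemma polyfun_locally_lipschitz f u0 : polyfun f -> locally_lipschitz f u0.
Proof.
move: f; apply: polyfun_ind.
- by move=> c; exact: locally_lipschitz_cst.
- exact: locally_lipschitz_x.
- exact: locally_lipschitz_y.
- by move=> f g; exact: locally_lipschitzD.
- by move=> f g; exact: locally_lipschitzM.
Qed.

End LocallyLipschitz.

(** * Plane curves *)

Section Curves.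
Variable R : realType.
Implicit Types (w : qdform R) (u v : 'cV[R]_2) (g : 'M[R]_2).

Definition vec2 (x y : R) : 'cV[R]_2 := \col_i (if i == 0 then x else y).

Lemma vec2E x y : (xcoord (vec2 x y) = x) * (ycoord (vec2 x y) = y).
Proof. by rewrite /xcoord /ycoord !mxE. Qed.

Lemma vec2K u : vec2 (xcoord u) (ycoord u) = u.
Proof.
apply/matrixP => i j; rewrite mxE ord1.
by case: i => [[|[|//]] ?] /=; congr (u _ _); apply/val_inj.
Qed.

Lemma is_derive_vec2 (f1 f2 : R -> R) (t d1 d2 : R) :
  is_derive t 1 f1 d1 -> is_derive t 1 f2 d2 ->
  is_derive t 1 (fun s => vec2 (f1 s) (f2 s)) (vec2 d1 d2).
Proof.
move=> df1 df2; apply/is_derive_mxP => i j; rewrite mxE.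
by under eq_fun do rewrite mxE; case: ifP.
Qed.

Lemma continuous_vec2 (f1 f2 : R -> R) (t : R) :
  {for t, continuous f1} -> {for t, continuous f2} ->
  {for t, continuous (fun s => vec2 (f1 s) (f2 s))}.
Proof.
move=> cf1 cf2; apply: continuous_mx => i j.
by rewrite /prop_for /continuous_at mxE; under eq_cvg do rewrite mxE; case: ifP.
Qed.

(** The derivative is known only on [I]; as [I] is open, its continuity at a
    point of [I] is that of [D]. *)
Lemma derive1_on_open (I : set R) (C D : R -> 'cV[R]_2) : open I ->
  (forall t, I t -> is_derive t 1 C (D t)) ->
  (forall t, I t -> {for t, continuous D}) ->
  forall t, I t -> [/\ derivable C t 1, C^`()%classic t = D t &
    {for t, continuous (C^`()%classic)}].
Proof.
move=> oI dC cD t It.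
have CD s : I s -> C^`()%classic s = D s.
  by move=> Is; have := dC s Is => d; rewrite derive1E derive_val.
split; [by have [] := dC t It | exact: CD |].
have nI : nbhs t I by apply: open_nbhs_nbhs; split.
rewrite /prop_for/continuous_at CD//; apply: cvg_trans (cD t It).
apply: near_eq_cvg; near=> s; rewrite CD//; near: s.
exact: nI.
Unshelve. all: by end_near. Qed.

Lemma is_derive_mulmx g (C : R -> 'cV[R]_2) (t : R) (D : 'cV[R]_2) :
  is_derive t 1 C D -> is_derive t 1 (fun s => g *m C s) (g *m D).
Proof.
move=> /is_derive_mxP dC; apply/is_derive_mxP => i j.
rewrite mxE; under eq_fun do rewrite mxE.
have := @is_derive_sum _ _ _ _ (fun k s => g i k *: C s k j) t 1
  (fun k => g i k *: D k j) (fun k => is_deriveZ _ (dC k j)).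
by rewrite fct_sumE.
Qed.

Lemma continuous_mulmx g (C : R -> 'cV[R]_2) (t : R) :
  {for t, continuous C} -> {for t, continuous (fun s => g *m C s)}.
Proof.
move=> cC; apply: continuous_mx => i j.
have cCk k := continuous_comp cC (@coord_continuous _ _ _ k j _).
rewrite /prop_for /continuous_at mxE !big_ord_recl big_ord0 addr0.
under eq_cvg do rewrite mxE !big_ord_recl big_ord0 addr0.
by apply: cvgD; apply: cvgM; [exact: cvg_cst | exact: cCk | exact: cvg_cst | exact: cCk].
Qed.

End Curves.

(** * Two by two matrices *)

Section Matrices2.
Variable R : realType.
Implicit Types (g h : 'M[R]_2) (u v : 'cV[R]_2).

Lemma mx2_eta g : g = mx2 (g 0 0) (g 0 1) (g 1 0) (g 1 1).
Proof.
apply/matrixP => i j; rewrite mxE.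
by case: i j => [[|[|//]] ?] [[|[|//]] ?] /=; congr (g _ _); apply/val_inj.
Qed.

Lemma mx2P (a b c d a' b' c' d' : R) :
  mx2 a b c d = mx2 a' b' c' d' <-> [/\ a = a', b = b', c = c' & d = d'].
Proof.
split=> [/matrixP e|[-> -> -> ->]//].
by have := (e 0 0, e 0 1, e 1 0, e 1 1); rewrite !mxE/=; case=> [[[]]].
Qed.

Lemma mulmx2 (a b c d a' b' c' d' : R) : mx2 a b c d *m mx2 a' b' c' d' =
  mx2 (a * a' + b * c') (a * b' + b * d') (c * a' + d * c') (c * b' + d * d').
Proof.
apply/matrixP => i j; rewrite !mxE !big_ord_recl big_ord0 !mxE/= addr0.
by case: ifP; case: ifP.
Qed.

Lemma mulmx2_vec (a b c d x y : R) :
  mx2 a b c d *m vec2 x y = vec2 (a * x + b * y) (c * x + d * y).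
Proof.
apply/matrixP => i j; rewrite !mxE !big_ord_recl big_ord0 !mxE/= addr0.
by case: ifP.
Qed.

Lemma trmx2 (a b c d : R) : (mx2 a b c d)^T = mx2 a c b d.
Proof. by apply/matrixP => i j; rewrite !mxE; case: ifP; case: ifP. Qed.

Lemma scalemx2 (k a b c d : R) : k *: mx2 a b c d = mx2 (k * a) (k * b) (k * c) (k * d).
Proof. by apply/matrixP => i j; rewrite !mxE; case: ifP; case: ifP. Qed.

Lemma oppmx2 (a b c d : R) : - mx2 a b c d = mx2 (- a) (- b) (- c) (- d).
Proof. by apply/matrixP => i j; rewrite !mxE; case: ifP; case: ifP. Qed.

Lemma mx2_1 : mx2 1 0 0 1 = 1%:M :> 'M[R]_2.
Proof.
by apply/matrixP => i j; rewrite !mxE; case: i j => [[|[|//]] ?] [[|[|//]] ?].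
Qed.

Lemma det_mx2 (a b c d : R) : \det (mx2 a b c d) = a * d - b * c.
Proof.
rewrite (expand_det_row _ ord0) !big_ord_recl big_ord0 /cofactor !det_mx11 !mxE/=.
by ring.
Qed.

Lemma vec2P (x y x' y' : R) : vec2 x y = vec2 x' y' <-> x = x' /\ y = y'.
Proof.
split=> [e|[-> ->]//].
by have := (vec2E x y, vec2E x' y'); rewrite e => -[[-> ->] [-> ->]].
Qed.

Lemma O2_det g : O2 g -> \det g ^+ 2 = 1.
Proof. by move=> gO; rewrite expr2 -{2}det_tr -det_mulmx gO det1. Qed.

Lemma O2_unit g : O2 g -> g \in unitmx.
Proof. by move=> gO; case: (mulmx1_unit gO). Qed.

Lemma O2_trmx g : O2 g -> g^T *m g = 1%:M.
Proof. by move=> gO; apply: mulmx1C. Qed.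

(** Writing J for this rotation by a right angle and B for the matrix of the
    form, the direction of the i-th foliation is the eigenline of J B for the
    eigenvalue (-1)^i sqrt delta. *)
Definition quarter_turn : 'M[R]_2 := mx2 0 1 (-1) 0.

(** The identity g^T J g = det(g) J holds for every g; this is where the
    determinant enters lambda. *)
Lemma O2_quarter_turn g : O2 g -> quarter_turn *m g = \det g *: (g *m quarter_turn).
Proof.
move=> gO; rewrite -[LHS]mul1mx -gO -mulmxA scalemxAr; congr (_ *m _).
rewrite (mx2_eta g) trmx2 /quarter_turn !mulmx2 det_mx2 scalemx2.
by apply/mx2P; split; ring.
Qed.

End Matrices2.

(** * The two foliations and the homomorphism lambda *)

Section Foliations.
Variable R : realType.
Implicit Types (w : qdform R) (u v : 'cV[R]_2) (g : 'M[R]_2).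

Definition form_mx w u : 'M[R]_2 := mx2 (qc w u) (qb w u) (qb w u) (qa w u).

Lemma delta_form_mx w u : delta w u = - \det (form_mx w u).
Proof. by rewrite /delta det_mx2; ring. Qed.

(** As J^2 = -1, the right-hand side says that v is an eigenvector of J B. *)
Lemma tangent_form_mx w i u v : tangent w i u v <->
  form_mx w u *m v = - ((-1) ^+ i * Num.sqrt (delta w u)) *: (quarter_turn R *m v).
Proof.
rewrite /tangent -(vec2K v) !vec2E /form_mx /quarter_turn !mulmx2_vec.
set s := _ * Num.sqrt _; set x := xcoord v; set y := ycoord v.
rewrite (_ : - s *: _ = vec2 (- s * y) (s * x)); last first.
  by apply/matrixP => k l; rewrite !mxE; case: ifP => _; ring.
split=> [[e1 e2]|/vec2P[e1 e2]].
  by apply/vec2P; split; lra.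
by split; lra.
Qed.

(** A quadratic form in two variables is determined by its values at (1, 0),
    (0, 1) and (1, 1). *)
Lemma form_mx_equivariant w g u u' (s : R) :
  (forall v, qdeval w u' (g *m v) = s * qdeval w u v) ->
  g^T *m form_mx w u' *m g = s *: form_mx w u.
Proof.
move=> e.
rewrite /form_mx [in LHS](mx2_eta g) trmx2 !mulmx2 scalemx2.
have ev x y : qdeval w u' (vec2 (g 0 0 * x + g 0 1 * y) (g 1 0 * x + g 1 1 * y)) =
    s * qdeval w u (vec2 x y) by rewrite -mulmx2_vec -mx2_eta e.
have := (ev 1 0, ev 0 1, ev 1 1); rewrite /qdeval !vec2E => -[[e1 e2] e3].
by apply/mx2P; split; lra.
Qed.

Section Moving.
Variables (w : qdform R) (g : 'M[R]_2) (s : R).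
Hypotheses (gO : O2 g) (s1 : s ^+ 2 = 1).
Hypothesis gw : forall u v, qdeval w (g *m u) (g *m v) = s * qdeval w u v.

Let form_mx_move u : form_mx w (g *m u) *m g = s *: (g *m form_mx w u).
Proof.
rewrite scalemxAr -(form_mx_equivariant (gw u)) !mulmxA.
by move: gO; rewrite /O2/= => ->; rewrite mul1mx.
Qed.

Lemma delta_move u : delta w (g *m u) = delta w u.
Proof.
have := congr1 determinant (form_mx_move u).
rewrite detZ !det_mulmx s1 mul1r mulrC => /mulfI e.
by rewrite !delta_form_mx e// -unitfE -unitmxE O2_unit.
Qed.

(** Conjugation by g multiplies the matrix of the form by s and J by det g, hence
    the eigenvalue by their product. *)
Lemma tangent_move i j u v : (-1) ^+ j = s * \det g * (-1) ^+ i ->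
  tangent w i u v -> tangent w j (g *m u) (g *m v).
Proof.
move=> ij /tangent_form_mx e; apply/tangent_form_mx.
rewrite mulmxA form_mx_move -scalemxAl -mulmxA e delta_move ij.
rewrite (mulmxA _ g v) O2_quarter_turn// -scalemxAl -(mulmxA g) -scalemxAr !scalerA.
congr (_ *: _); rewrite -[LHS]mulr1 -(O2_det gO); ring.
Qed.

Lemma solution_curve_move i j (C : set R * (R -> 'cV[R]_2)) :
  (-1) ^+ j = s * \det g * (-1) ^+ i ->
  solution_curve w i C -> solution_curve w j (C.1, fun t => g *m C.2 t).
Proof.
move=> ij [oC iC neC CP].
have dC r : C.1 r -> is_derive r 1 (fun t => g *m C.2 t) (g *m (C.2^`()%classic r)).
  move=> Cr; apply: is_derive_mulmx; have [_ dCr _ _ _] := CP r Cr.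
  by apply: DeriveDef; [exact: dCr | rewrite derive1E].
have cC r : C.1 r -> {for r, continuous (fun t => g *m (C.2^`()%classic t))}.
  by move=> Cr; apply: continuous_mulmx; have [] := CP r Cr.
split; [exact: oC | exact: iC | exact: neC | move=> t Ct].
have [dgC gCE cgC] := derive1_on_open oC dC cC Ct.
have [Om _ _ C'0 tC] := CP t Ct.
split; [by rewrite /Omega/= delta_move | exact: dgC | exact: cgC | |].
- rewrite gCE; apply: contra_neq C'0 => gC0.
  by rewrite -[LHS](mulKmx (O2_unit gO)) gC0 mulmx0.
- by rewrite gCE; exact: tangent_move ij tC.
Qed.

End Moving.

(** The two eigenvalues differ on Omega, so no nonzero velocity is tangent to
    both foliations. *)
Lemma solution_curve_disjoint w C : solution_curve w 1 C -> ~ solution_curve w 2 C.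
Proof.
move=> [_ _ [t Ct] C1] [_ _ _ C2].
have [Om _ _ v0 [t1 t2]] := C1 t Ct; have [_ _ _ _ [t3 t4]] := C2 t Ct.
move: Om v0 t1 t2 t3 t4; rewrite /Omega/=.
set v := C.2^`()%classic t; set u := C.2 t => d0 v0.
have s0 : 0 < Num.sqrt (delta w u) by rewrite sqrtr_gt0.
rewrite expr1 expr2 mulrNN !mul1r mulN1r => t1 t2 t3 t4.
have x0 : xcoord v = 0.
  have : Num.sqrt (delta w u) * xcoord v = 0 by lra.
  by move/eqP; rewrite mulf_eq0 gt_eqF//= => /eqP.
have y0 : ycoord v = 0.
  have : Num.sqrt (delta w u) * ycoord v = 0 by move: t2 t4; rewrite x0; lra.
  by move/eqP; rewrite mulf_eq0 gt_eqF//= => /eqP.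
move/eqP: v0; apply; rewrite -(vec2K v) x0 y0.
by apply/matrixP => i j; rewrite !mxE; case: ifP.
Qed.

(** If a does not vanish at some point of Omega, the equation is there the
    ordinary differential equation dy / dx = (- b - sqrt delta) / a, with a
    locally Lipschitz right-hand side.  If a vanishes on all of Omega, then
    delta = b^2 there and the vertical lines are solutions; the sign of b
    decides to which of the two foliations they belong. *)
Lemma solution_curve_exists w u0 : polyform w -> Omega w u0 ->
  exists2 i, i = 1%N \/ i = 2%N & exists C, solution_curve w i C.
Proof.
move=> [pa pb pc] Om0.
have ld u : locally_lipschitz (delta w) u.
  apply: polyfun_locally_lipschitz; rewrite /delta; under eq_fun do rewrite expr2.
  by apply: polyfunB; apply: polyfunM.
have [[u1 Om1 a1]|a0] := pselect (exists2 u, Omega w u & qa w u != 0).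
  have la : locally_lipschitz (qa w) u1 by exact: polyfun_locally_lipschitz.
  have a2 : 0 < qa w u1 * qa w u1 by rewrite -expr2 exprn_even_gt0.
  have laa := locally_lipschitzM la la.
  have [r2 r20 ap] := locally_lipschitz_pos laa a2.
  have [r1 r10 dp] := locally_lipschitz_pos (ld u1) Om1.
  (* 1 / a is written a / a^2, so that only positive functions are inverted. *)
  pose phi u := (- qb w u - Num.sqrt (delta w u)) * (qa w u * (qa w u * qa w u)^-1).
  have [r [K [r0 K0 phiK]]] : locally_lipschitz phi u1.
    apply: locally_lipschitzM.
      apply: locally_lipschitzD; apply: locally_lipschitzN.
        exact: polyfun_locally_lipschitz.
      exact: locally_lipschitz_sqrt.
    apply: locally_lipschitzM => //.
    exact: (locally_lipschitzV laa).
  pose rho := Num.min r (Num.min r1 r2) / 2.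
  have rho0 : 0 < rho by rewrite divr_gt0// !lt_min r0 r10.
  have box x y : `|x - xcoord u1| <= rho -> `|y - ycoord u1| <= rho ->
      dist1 (vec2 x y) u1 <= Num.min r (Num.min r1 r2).
    by rewrite /dist1 !vec2E /rho => ? ?; lra.
  have [|h [y [g [h0 cg yP]]]] := @picard_local R (fun x y => phi (vec2 x y)) K
      (xcoord u1) (ycoord u1) rho rho0 K0.
    move=> x y x' y' bx by_ bx' by'.
    have := box _ _ bx by_; have := box _ _ bx' by'.
    rewrite !le_min => /andP[b1 _] /andP[b2 _].
    by rewrite (le_trans (phiK _ _ b2 b1))// /dist1 !vec2E.
  exists 1%N; first by left.
  pose I : set R := [set` `]xcoord u1, (xcoord u1 + h)[%R].
  exists (I, fun t => vec2 t (y t)).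
  have oI : open I by exact: interval_open.
  split; [exact: oI | exact: interval_is_interval | | move=> t It].
    by exists (xcoord u1 + h / 2); rewrite /I/= in_itv/=; apply/andP; split; lra.
  have dC s : I s -> is_derive s 1 (fun t => vec2 t (y t)) (vec2 1 (g s)).
    move=> Is; apply: is_derive_vec2.
    by have [] := yP s; move: Is; rewrite /I/= in_itv.
  have cD s : I s -> {for s, continuous (fun s => vec2 1 (g s))}.
    by move=> _; apply: continuous_vec2; [exact: cvg_cst | exact: cg].
  have [dt DE cDt] := derive1_on_open oI dC cD It.
  have [xr yr _ gE] : [/\ `|t - xcoord u1| <= rho, `|y t - ycoord u1| <= rho,
     is_derive t (1 : R) y (g t) & g t = phi (vec2 t (y t))].
    by apply: yP; move: It; rewrite /I/= in_itv.
  have := box _ _ xr yr; rewrite !le_min => /and3P[_ b1 b2].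
  have dpos : 0 < delta w (vec2 t (y t)).
    by apply: lt_le_trans (dp _ b1); rewrite divr_gt0.
  have an0 : qa w (vec2 t (y t)) != 0.
    have := lt_le_trans (divr_gt0 a2 (ltr0n _ 2)) (ap _ b2).
    by rewrite lt0r mulf_eq0 orbb => /andP[].
  split; [exact: dpos | exact: dt | exact: cDt | |].
  - by rewrite DE; apply/eqP => /(congr1 (@xcoord R)); rewrite vec2E /xcoord mxE; lra.
  - rewrite DE /tangent !vec2E gE /phi expr1 mulN1r.
    have := sqr_sqrtr (ltW dpos); rewrite {2}/delta.
    move: an0; move: (qa w _) (qb w _) (qc w _) (Num.sqrt _) => a b c s an0 sE.
    have {}sE : s ^+ 2 = b ^+ 2 - a * c by [].
    split; first by field.
    have -> : (b - s) * ((- b - s) * (a * (a * a)^-1)) = (s ^+ 2 - b ^+ 2) * a^-1.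
      by field.
    by rewrite sE; field.
have {}a0 u : Omega w u -> qa w u = 0.
  by move=> Omu; apply: contrapT => /eqP an0; apply: a0; exists u.
have b0 : 0 < qb w u0 * qb w u0.
  by have := Om0; rewrite /Omega/= /delta a0// mul0r subr0 expr2.
have lb : locally_lipschitz (fun u => qb w u0 * qb w u) u0.
  apply: locally_lipschitzM; first exact: locally_lipschitz_cst.
  exact: polyfun_locally_lipschitz.
have [r2 r20 bp] := locally_lipschitz_pos lb b0.
have [r1 r10 dp] := locally_lipschitz_pos (ld u0) Om0.
pose r := Num.min r1 r2; have r0 : 0 < r by rewrite lt_min r10.
pose I : set R := [set` `](ycoord u0 - r), (ycoord u0 + r)[%R].
have oI : open I by exact: interval_open.
pose i := if 0 < qb w u0 then 1%N else 2%N.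
exists i; first by rewrite /i; case: ifP; [left | right].
exists (I, fun t => vec2 (xcoord u0) t).
split; [exact: oI | exact: interval_is_interval | | move=> t It].
  by exists (ycoord u0); rewrite /I/= in_itv/=; apply/andP; split; lra.
have dC s : I s -> is_derive s 1 (fun t => vec2 (xcoord u0) t) (vec2 0 1).
  by move=> Is; apply: is_derive_vec2.
have cD s : I s -> {for s, continuous (fun=> vec2 0 1 : 'cV[R]_2)}.
  by move=> _; exact: cvg_cst.
have [dt DE cDt] := derive1_on_open oI dC cD It.
have : dist1 (vec2 (xcoord u0) t) u0 <= r.
  rewrite /dist1 !vec2E subrr normr0 add0r ler_norml.
  by move: It; rewrite /I/= in_itv/= => /andP[? ?]; apply/andP; split; lra.
rewrite le_min => /andP[b1 b2].
have dpos : 0 < delta w (vec2 (xcoord u0) t).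
  by apply: lt_le_trans (dp _ b1); rewrite divr_gt0.
have bpos : 0 < qb w u0 * qb w (vec2 (xcoord u0) t).
  by apply: lt_le_trans (bp _ b2); rewrite divr_gt0.
split; [exact: dpos | exact: dt | exact: cDt | |].
  by rewrite DE; apply/eqP => /(congr1 (@ycoord R)); rewrite vec2E /ycoord mxE; lra.
rewrite DE /tangent !vec2E !mulr0 a0// mul0r mulr1; split=> //.
rewrite /delta a0// mul0r subr0 sqrtr_sqr /i.
case: ltP => [b00|b00].
  have bt : 0 < qb w (vec2 (xcoord u0) t) by rewrite -(pmulr_rgt0 _ b00).
  by rewrite gtr0_norm// expr1 mulN1r subrr.
have {}b00 : qb w u0 < 0.
  by rewrite lt_neqAle b00 andbT; apply: contraTneq bpos => ->; rewrite mul0r ltxx.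
have bt : qb w (vec2 (xcoord u0) t) < 0 by rewrite -(nmulr_rgt0 _ b00).
by rewrite ltr0_norm// expr2 mulrNN !mul1r subrr.
Qed.

(** The existence of a solution curve makes the two foliations distinct, so that
    the two alternatives defining lambda exclude each other. *)
Theorem lambda_equivariant (G : set 'M[R]_2) (eta : 'M[R]_2 -> R) w :
  is_group G -> (forall g, G g -> O2 g) -> sign_hom G eta ->
  polyform w -> equivariant G eta w -> Omega w !=set0 ->
  is_lambda G w (fun g => eta g * \det g).
Proof.
move=> [G1 GM GV] GO [eta1 etaM] pw ew [u0 Om0].
pose lam g := eta g * \det g.
have eta_sqr g : G g -> eta g ^+ 2 = 1.
  by move=> /eta1[] ->; rewrite ?sqrrN expr1n.
have lam1 g : G g -> lam g = 1 \/ lam g = -1.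
  move=> Gg; have : lam g ^+ 2 == 1 ^+ 2.
    by rewrite expr1n exprMn eta_sqr// O2_det ?mulr1//; exact: GO.
  by rewrite eqf_sqr => /orP[]/eqP; [left | right].
have lamM g h : G g -> G h -> lam (g *m h) = lam g * lam h.
  by move=> Gg Gh; rewrite /lam etaM// det_mulmx mulrACA.
have lam_1 : lam 1%:M = 1.
  rewrite /lam det1 mulr1; have := etaM _ _ G1 G1; rewrite mulmx1.
  by case: (eta1 _ G1) => -> //; rewrite mulrNN mulr1.
have lamV g : G g -> lam (invmx g) = lam g.
  move=> Gg; have Gi := GV _ Gg.
  have : lam g * lam (invmx g) = 1 by rewrite -lamM// mulmxV// O2_unit//; exact: GO.
  by case: (lam1 _ Gg) => ->; rewrite ?mul1r// mulN1r => <-; rewrite opprK.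
have sub g i j : G g -> (-1) ^+ j = lam g * (-1) ^+ i :> R ->
    forall C, solution_curve w i C -> solution_curve w j (C.1, fun t => g *m C.2 t).
  move=> Gg ij C; apply: (solution_curve_move (GO _ Gg) (eta_sqr _ Gg)) => //.
  by move=> u v; exact: ew.
have move g i j : G g -> (-1) ^+ j = lam g * (-1) ^+ i :> R ->
    move_foliation g (foliation w i) = foliation w j.
  move=> Gg ij; have Gi := GV _ Gg; have ug := O2_unit (GO _ Gg).
  apply/seteqP; split=> [_ [C Ci <-]|C Cj]; first exact: (sub _ _ _ Gg ij).
  have ji : (-1) ^+ i = lam (invmx g) * (-1) ^+ j :> R.
    by rewrite ij mulrA lamV//; case: (lam1 _ Gg) => ->; rewrite ?mulrNN !mul1r.
  exists (C.1, fun t => invmx g *m C.2 t); first exact: (sub _ _ _ Gi ji).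
  by rewrite /=; case: C {Cj} => I C; congr pair; apply/funext => t; rewrite /= mulKVmx.
have F12 : foliation w 1 <> foliation w 2.
  have [i i12 [C Ci]] := solution_curve_exists pw Om0 => e.
  have : foliation w 1 C by case: i12 Ci => ->; rewrite // e.
  move=> C1; have C2 : foliation w 2 C by rewrite -e.
  exact: solution_curve_disjoint C1 C2.
have n1 : (1 : R) <> -1 by move/eqP; rewrite -subr_eq0 opprK; apply/negP; rewrite gt_eqF.
split; first by split.
move=> g Gg; split; split.
- move=> e; split; apply: move => //; rewrite -/(lam g) in e; by rewrite e mul1r.
- move=> [e1 e2]; case: (lam1 g Gg) => // l; exfalso; apply: F12.
  by rewrite -e1; apply: move => //; rewrite l expr1 expr2 mulrNN.
- move=> e; split; apply: move => //; rewrite -/(lam g) in e;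
    by rewrite e ?expr1 ?expr2 ?mulrNN ?mulr1.
- move=> [e1 e2]; case: (lam1 g Gg) => // l; exfalso; apply: F12.
  by rewrite -e1; apply/esym; apply: move => //; rewrite l mul1r.
Qed.

End Foliations.

(** * Rotations, reflections and the groups they generate *)

Section PlaneGroups.
Variable R : realType.
Implicit Types (a b : R[i]) (g h : 'M[R]_2) (u : 'cV[R]_2).

Lemma generated_group (S : set 'M[R]_2) : is_group (generated S).
Proof.
split=> [A [[A1 _ _] _]//|g h Gg Gh A AS|g Gg A AS].
  by have [[_ AM _] _] := AS; apply: AM; [exact: Gg | exact: Gh].
by have [[_ _ AV] _] := AS; apply: AV; exact: Gg.
Qed.

Lemma generated_le (S A : set 'M[R]_2) : is_group A -> S `<=` A -> generated S `<=` A.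
Proof. by move=> gA SA; exact: smallest_sub. Qed.

Lemma sub_generated (S : set 'M[R]_2) : S `<=` generated S.
Proof. by move=> g Sg A [_]; exact. Qed.

(** Multiplication by [a], and [rf a] below is z -> a conj(z), for a unit complex
    number [a]. *)
Definition rot a : 'M[R]_2 := mx2 (complex.Re a) (- complex.Im a) (complex.Im a) (complex.Re a).
Definition rf a : 'M[R]_2 := mx2 (complex.Re a) (complex.Im a) (complex.Im a) (- complex.Re a).

Lemma rotM a b : rot a *m rot b = rot (a * b).
Proof. by case: a b => ? ? [? ?]; rewrite mulmx2; apply/mx2P; split=> /=; ring. Qed.

Lemma rot_rf a b : rot a *m rf b = rf (a * b).
Proof. by case: a b => ? ? [? ?]; rewrite mulmx2; apply/mx2P; split=> /=; ring. Qed.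

Lemma rf_rot a b : rf a *m rot b = rf (a * (conjc b)).
Proof. by case: a b => ? ? [? ?]; rewrite mulmx2; apply/mx2P; split=> /=; ring. Qed.

Lemma rfM a b : rf a *m rf b = rot (a * (conjc b)).
Proof. by case: a b => ? ? [? ?]; rewrite mulmx2; apply/mx2P; split=> /=; ring. Qed.

Lemma rot1 : rot 1 = 1%:M.
Proof. by rewrite -mx2_1; apply/mx2P; split=> //=; rewrite oppr0. Qed.

Lemma rf1 : rf 1 = kappa_x R.
Proof. by []. Qed.

Lemma rfN1 : rf (-1) = kappa_y R.
Proof. by apply/mx2P; split=> //=; rewrite ?oppr0 ?opprK. Qed.

Lemma rotN1 : rot (-1) = - 1%:M.
Proof. by rewrite -mx2_1 oppmx2; apply/mx2P; split=> //=; rewrite ?oppr0. Qed.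

Lemma normsq_complex a : a * (conjc a) = (complex.Re a ^+ 2 + complex.Im a ^+ 2)%:C%C.
Proof. by case: a => x y; apply/eqP; rewrite eq_complex/=; apply/andP; split; apply/eqP; ring. Qed.

Lemma unit_complexP a : a * (conjc a) = 1 <-> complex.Re a ^+ 2 + complex.Im a ^+ 2 = 1.
Proof. by rewrite normsq_complex; split=> [[]|->]. Qed.

Lemma det_rot a : a * (conjc a) = 1 -> \det (rot a) = 1.
Proof. by move=> /unit_complexP a1; rewrite det_mx2; lra. Qed.

Lemma det_rf a : a * (conjc a) = 1 -> \det (rf a) = -1.
Proof. by move=> /unit_complexP a1; rewrite det_mx2; lra. Qed.

Lemma O2_rot a : a * (conjc a) = 1 -> O2 (rot a).
Proof.
move=> /unit_complexP a1; rewrite /O2/= /rot trmx2 mulmx2 -mx2_1.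
by apply/mx2P; split; lra.
Qed.

Lemma O2_rf a : a * (conjc a) = 1 -> O2 (rf a).
Proof.
move=> /unit_complexP a1; rewrite /O2/= /rf trmx2 mulmx2 -mx2_1.
by apply/mx2P; split; lra.
Qed.

Lemma invmx_rot a : a * (conjc a) = 1 -> invmx (rot a) = rot (conjc a).
Proof.
move=> a1; apply: (can_inj (mulKmx (O2_unit (O2_rot a1)))).
by rewrite mulmxV ?O2_unit// ?rotM ?a1 ?rot1//; exact: O2_rot.
Qed.

Lemma invmx_rf a : a * (conjc a) = 1 -> invmx (rf a) = rf a.
Proof.
move=> a1; apply: (can_inj (mulKmx (O2_unit (O2_rf a1)))).
by rewrite mulmxV ?O2_unit// ?rfM ?a1 ?rot1//; exact: O2_rf.
Qed.

(** For a rotation or a reflection, the image of 1, which is its parameter. *)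
Definition mx_col g : R[i] := Complex (g 0 0) (g 1 0).

Lemma mx_col_rot a : mx_col (rot a) = a.
Proof. by case: a => x y; rewrite /mx_col !mxE. Qed.

Lemma mx_col_rf a : mx_col (rf a) = a.
Proof. by case: a => x y; rewrite /mx_col !mxE. Qed.

(** Orthogonal matrices commute with J up to the determinant, and the matrices
    that commute, respectively anticommute, with J are [rot] and [rf]. *)
Lemma O2P g : O2 g -> exists2 a, a * (conjc a) = 1 & g = rot a \/ g = rf a.
Proof.
move=> gO; have gtO := O2_trmx gO; have := O2_quarter_turn gO.
have : \det g = 1 \/ \det g = -1.
  have : \det g ^+ 2 == 1 ^+ 2 by rewrite O2_det// expr1n.
  by rewrite eqf_sqr => /orP[]/eqP; [left | right].
move: gtO; rewrite (mx2_eta g) trmx2 /quarter_turn !mulmx2 -!mx2_1 scalemx2.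
set d := \det _; move: (g 0 0) (g 0 1) (g 1 0) (g 1 1) d => p q r t d.
move=> /mx2P[e _ _ _] d1 /mx2P[e1 e2 e3 e4].
exists (Complex (p) (r)); first by apply/unit_complexP => /=; lra.
by case: d1 e1 e2 e3 e4 => -> *; [left | right]; apply/mx2P; split=> //=; lra.
Qed.

Definition unit_root (n : nat) c a := a * (conjc a) = 1 /\ a ^+ n = c.

Definition circle_group (U V : R[i] -> Prop) : set 'M[R]_2 :=
  [set g | (exists2 a, U a & g = rot a) \/ (exists2 b, V b & g = rf b)].

(** For n > 0, n is the order of the group of rotations; for n = 0 the condition
    a ^+ n = 1 is void and the rotations form the full circle.  As the parameters
    are units, there is no reflection when c = 0. *)
Definition dih n c := circle_group (unit_root n 1) (unit_root n c).

Lemma unit_rootM n c d a b : unit_root n c a -> unit_root n d b ->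
  unit_root n (c * d) (a * b).
Proof.
move=> [a1 ac] [b1 bd]; split; last by rewrite exprMn ac bd.
by rewrite rmorphM/= mulrACA a1 b1 mulr1.
Qed.

Lemma unit_rootJ n c a : unit_root n c a -> unit_root n (conjc c) (conjc a).
Proof. by move=> [a1 ac]; split; [rewrite conjcK mulrC | rewrite -rmorphXn/= ac]. Qed.

Lemma unit_root1 n : unit_root n 1 1.
Proof. by split; rewrite ?conjc1 ?mulr1 ?expr1n. Qed.

Lemma unit_root_norm n c a : unit_root n c a -> c * (conjc c) = 1.
Proof. by move=> [a1 <-]; rewrite rmorphXn/= -exprMn a1 expr1n. Qed.

Lemma dih_group n c : (conjc c) = c -> is_group (dih n c).
Proof.
move=> cJ; split.
- by left; exists 1; [exact: unit_root1 | rewrite rot1].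
- move=> g h [[a Ua ->]|[b Vb ->]] [[a' Ua' ->]|[b' Vb' ->]].
  + by left; exists (a * a'); [rewrite -[1]mulr1; exact: unit_rootM | exact: rotM].
  + by right; exists (a * b'); [rewrite -[c]mul1r; exact: unit_rootM | exact: rot_rf].
  + right; exists (b * (conjc a') ); last exact: rf_rot.
    by rewrite -[c]mulr1 -conjc1; apply: unit_rootM; last exact: unit_rootJ.
  + left; exists (b * (conjc b') ); last exact: rfM.
    by rewrite -(unit_root_norm Vb); apply: unit_rootM; last exact: unit_rootJ.
- move=> g [[a Ua ->]|[b Vb ->]].
    left; exists (conjc a); first by rewrite -conjc1; exact: unit_rootJ.
    by rewrite invmx_rot; case: Ua.
  by right; exists b => //; rewrite invmx_rf; case: Vb.
Qed.

Lemma dih_O2 n c g : dih n c g -> O2 g.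
Proof. by move=> [[a [a1 _] ->]|[b [b1 _] ->]]; [exact: O2_rot | exact: O2_rf]. Qed.

Lemma O2E : @O2 R = dih 0 1.
Proof.
apply/seteqP; split=> [g /O2P[a a1 [->|->]]|g]; last exact: dih_O2.
- by left; exists a; split.
- by right; exists a; split.
Qed.

Lemma SO2E : @SO2 R = dih 0 0.
Proof.
apply/seteqP; split=> [g [/O2P[a a1 [->|->]] gd]|g [[a [a1 _] ->]|[b [_ /eqP]]]].
- by left; exists a; split.
- by move: gd; rewrite det_rf// => /eqP; rewrite -subr_eq0 -opprD oppr_eq0 gt_eqF.
- by split; [exact: O2_rot | exact: det_rot].
- by rewrite expr0 oner_eq0.
Qed.

Definition cis (t : R) : R[i] := Complex (cos t) (sin t).

Lemma rotation_cis t : rotation t = rot (cis t).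
Proof. by []. Qed.

Lemma cis_unit t : cis t * conjc (cis t) = 1.
Proof. by apply/unit_complexP; exact: cos2Dsin2. Qed.

Lemma cisX t k : cis t ^+ k = cis (t *+ k).
Proof.
elim: k => [|k IH]; first by rewrite expr0 mulr0n /cis cos0 sin0.
rewrite exprS IH mulrS /cis cosD sinD; apply/eqP; rewrite eq_complex/= eqxx/=.
by apply/eqP; ring.
Qed.

Definition root_of_unity n := cis (2 * pi / n%:R).

Lemma root_of_unity_neq1 n k : (0 < k < n)%N -> root_of_unity n ^+ k != 1.
Proof.
move=> /andP[k0 kn]; rewrite cisX; set t := _ *+ k.
have n0 : (0 : R) < n%:R by rewrite ltr0n (leq_ltn_trans _ kn).
have t0 : 0 < t / 2.
  by rewrite divr_gt0// pmulrn_lgt0// divr_gt0// mulr_gt0// pi_gt0.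
have tpi : t / 2 < pi.
  have -> : t / 2 = pi * (k%:R / n%:R) by rewrite /t -mulr_natr; field; rewrite gt_eqF.
  by rewrite gtr_pMr ?pi_gt0// ltr_pdivrMr// mul1r ltr_nat.
have s0 : 0 < sin (t / 2) by apply: sin_gt0_pi; rewrite t0.
have tE : t = (t / 2) *+ 2 by rewrite -mulr_natr divfK.
apply/eqP => -[]; rewrite {1}tE cos_mulr2n => c1 _.
have : sin (t / 2) ^+ 2 = 0 by rewrite sin2cos2; lra.
by move/eqP; rewrite sqrf_eq0 gt_eqF.
Qed.

Lemma root_of_unity_prim n : (0 < n)%N -> n.-primitive_root (root_of_unity n).
Proof.
move=> n0; have X1 : root_of_unity n ^+ n = 1.
  rewrite cisX (_ : _ *+ n = pi *+ 2); first by rewrite /cis cos2pi sin2pi.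
  by rewrite -(mulr_natr (_ / _)) divfK ?pnatr_eq0 -?lt0n// mulrC mulr_natr.
apply/andP; split=> //; apply/forallP => i; apply/eqP; rewrite unity_rootE.
have := ltn_ord i; rewrite leq_eqVlt => /predU1P[->|iN]; first by rewrite X1 !eqxx.
by rewrite (ltn_eqF iN); apply/negbTE/root_of_unity_neq1.
Qed.

Lemma root_of_unity_unit n : (0 < n)%N -> unit_root n 1 (root_of_unity n).
Proof. by move=> n0; split; [exact: cis_unit | exact: prim_expr_order (root_of_unity_prim n0)]. Qed.

Lemma unit_root_powP n a : (0 < n)%N -> unit_root n 1 a ->
  exists k, a = root_of_unity n ^+ k.
Proof.
by move=> n0 [_ an]; have [k ->] := prim_rootP (root_of_unity_prim n0) an; exists k.
Qed.

Lemma group_rotX (G : set 'M[R]_2) a k : is_group G -> G (rot a) -> G (rot (a ^+ k)).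
Proof.
move=> [G1 GM _] Ga; elim: k => [|k IH]; first by rewrite expr0 rot1.
by rewrite exprS -rotM; exact: GM.
Qed.

(** The product of two reflections of [dih n c] is one of its rotations, so a
    single reflection generates all of them. *)
Lemma dih_le_generated n c (S : set 'M[R]_2) : (0 < n)%N ->
  generated S (rot (root_of_unity n)) ->
  (forall b, unit_root n c b -> exists2 b', unit_root n c b' & generated S (rf b')) ->
  dih n c `<=` generated S.
Proof.
move=> n0 Sr Sb g; have gS := generated_group S; have [_ GM _] := gS.
have Srot a : unit_root n 1 a -> generated S (rot a).
  by move=> /(unit_root_powP n0)[k ->]; exact: (group_rotX k gS Sr).
move=> [[a Ua ->]|[b Vb ->]]; first exact: Srot.
have [b' Vb' Sb'] := Sb b Vb.
have -> : b = b * (conjc b') * b' by rewrite -mulrA [(conjc b') * _]mulrC; case: Vb' => -> _; rewrite mulr1.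
rewrite -rot_rf; apply: GM => //; apply: Srot.
by rewrite -(unit_root_norm Vb); apply: unit_rootM => //; exact: unit_rootJ.
Qed.

Lemma ZrotE n : (0 < n)%N -> @Zrot R n = dih n 0.
Proof.
move=> n0; have V0 b : ~ unit_root n 0 b.
  by move=> /unit_root_norm/eqP; rewrite mul0r eq_sym oner_eq0.
apply/seteqP; split.
- apply: generated_le; first by apply: dih_group; rewrite conjc0.
  by move=> _ ->; left; exists (root_of_unity n); [exact: root_of_unity_unit|].
- apply: dih_le_generated => //; last by move=> b /V0.
  exact: sub_generated.
Qed.

Lemma DihE n c b : (0 < n)%N -> (conjc c) = c -> unit_root n c b -> Dih n (rf b) = dih n c.
Proof.
move=> n0 cJ Vb; apply/seteqP; split.
- apply: generated_le; first exact: dih_group.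
  move=> _ [->|->]; last by right; exists b.
  by left; exists (root_of_unity n); [exact: root_of_unity_unit|].
- apply: dih_le_generated => //; first by apply: sub_generated; left.
  by move=> _ _; exists b => //; apply: sub_generated; right.
Qed.

Lemma root_of_unity1 : root_of_unity 1 = 1.
Proof. by have := prim_expr_order (root_of_unity_prim (ltn0Sn 0)); rewrite expr1. Qed.

Lemma root_of_unity_half n : (0 < n)%N -> root_of_unity n.*2 ^+ n = -1.
Proof.
move=> n0; rewrite cisX (_ : _ *+ n = pi); first by rewrite /cis cospi sinpi; apply/eqP; rewrite eq_complex/= oppr0 !eqxx.
by rewrite -(mulr_natr (_ / _)) -muln2 natrM; field; rewrite pnatr_eq0 -lt0n.
Qed.

Lemma root_of_unity2 : root_of_unity 2 = -1.
Proof. by have := root_of_unity_half (ltn0Sn 0); rewrite expr1. Qed.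

Lemma unit_rootN1 : unit_root 1 (-1) (-1).
Proof. by split; rewrite ?rmorphN1 ?mulrNN ?mulr1. Qed.

Lemma generated_kappa_x : generated [set kappa_x R] = dih 1 1.
Proof.
rewrite -rf1; apply/seteqP; split.
- apply: generated_le; first by apply: dih_group; rewrite conjc1.
  by move=> _ ->; right; exists 1; first exact: unit_root1.
- apply: dih_le_generated => //.
    by rewrite root_of_unity1 rot1; case: (generated_group [set rf 1]).
  by move=> _ _; exists 1; [exact: unit_root1 | exact: sub_generated].
Qed.

Lemma generated_kappa_y : generated [set kappa_y R] = dih 1 (-1).
Proof.
rewrite -rfN1; apply/seteqP; split.
- apply: generated_le; first by apply: dih_group; rewrite rmorphN1.
  by move=> _ ->; right; exists (-1); first exact: unit_rootN1.
- apply: dih_le_generated => //.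
    by rewrite root_of_unity1 rot1; case: (generated_group [set rf (-1)]).
  by move=> _ _; exists (-1); [exact: unit_rootN1 | exact: sub_generated].
Qed.

Lemma generatedN1 : generated [set - 1%:M] = dih 2 0.
Proof.
by rewrite -ZrotE// /Zrot rotation_cis -/(root_of_unity 2) root_of_unity2 rotN1.
Qed.

Lemma generated_kappa_xy : generated [set kappa_x R; kappa_y R] = dih 2 1.
Proof.
have uN1 : unit_root 2 1 (-1) by split; rewrite ?rmorphN1 ?sqrrN ?expr1n ?mulrNN ?mulr1.
apply/seteqP; split.
- apply: generated_le; first by apply: dih_group; rewrite conjc1.
  move=> _ [->|->]; [rewrite -rf1 | rewrite -rfN1]; right; [exists 1 | exists (-1)] => //.
  exact: unit_root1.
- have [_ GM _] := generated_group [set kappa_x R; kappa_y R].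
  have Gx : generated [set kappa_x R; kappa_y R] (rf 1) by apply: sub_generated; left.
  have Gy : generated [set kappa_x R; kappa_y R] (rf (-1)).
    by rewrite rfN1; apply: sub_generated; right.
  apply: dih_le_generated => //; last by move=> _ _; exists 1 => //; exact: unit_root1.
  by rewrite root_of_unity2 -[-1]mulr1 -{2}conjc1 -rfM; exact: GM.
Qed.

End PlaneGroups.

(** * From forms to the half-trace and the deviator *)

Section FormsAndGroups.
Variable R : realType.
Implicit Types (a b c : R[i]) (g h : 'M[R]_2) (u v : 'cV[R]_2) (w : qdform R).

Lemma rot_neq_rf a b : a * conjc a = 1 -> rot a <> rf b.
Proof.
move=> /unit_complexP a1 /mx2P[e1 e2 e3 e4].
have ra : complex.Re a = 0 by lra.
have ia : complex.Im a = 0 by lra.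
by move: a1; rewrite ra ia expr0n/= addr0 => /eqP; rewrite eq_sym oner_eq0.
Qed.

Lemma circle_group_rot (U V : R[i] -> Prop) a : a * conjc a = 1 ->
  circle_group U V (rot a) <-> U a.
Proof.
move=> a1; split=> [[[a' Ua /(congr1 (@mx_col R))]|[b _ /rot_neq_rf]]|Ua].
- by rewrite !mx_col_rot => ->.
- by move/(_ a1).
- by left; exists a.
Qed.

Lemma circle_group_rf (U V : R[i] -> Prop) b : b * conjc b = 1 ->
  circle_group U V (rf b) <-> V b.
Proof.
move=> b1; split=> [[[a _ e]|[b' Vb /(congr1 (@mx_col R))]]|Vb].
- have ab : a = b by rewrite -(mx_col_rot a) -e mx_col_rf.
  by move/esym: e => /rot_neq_rf; rewrite ab => /(_ b1).
- by rewrite !mx_col_rf => ->.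
- by right; exists b.
Qed.

Lemma eq_circle_group (U V U' V' : R[i] -> Prop) :
  (forall a, U a <-> U' a) -> (forall b, V b <-> V' b) ->
  circle_group U V = circle_group U' V'.
Proof.
move=> UU VV; apply/seteqP; split=> g [[a Ua ->]|[b Vb ->]];
  by [left; exists a => //; apply/UU | right; exists b => //; apply/VV].
Qed.

Lemma unit_root0 n b : ~ unit_root n 0 b.
Proof. by move=> /unit_root_norm/eqP; rewrite mul0r eq_sym oner_eq0. Qed.

Lemma sqrn1 c : c ^+ 2 = 1 -> c = 1 \/ c = -1.
Proof. by move/eqP; rewrite sqrf_eq1 => /orP[]/eqP; [left | right]. Qed.

(** On rotations lambda = eta, and on reflections lambda = - eta. *)
Lemma kernel_lambda n c n' c' (eta : 'M[R]_2 -> R) :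
  sign_hom (dih n c) eta -> Defs.kernel (dih n c) eta = dih n' c' ->
  Defs.kernel (dih n c) (fun g => eta g * \det g) =
  circle_group (unit_root n' 1) (fun b => unit_root n c b /\ ~ unit_root n' c' b).
Proof.
move=> [eta1 _] Keta.
have KE g : (dih n c g /\ eta g = 1) <-> dih n' c' g by rewrite -Keta.
apply/seteqP; split=> [g [[[a Ua ->]|[b Vb ->]]]|g [[a Ua ->]|[b [Vb nVb] ->]]].
- have [a1 _] := Ua; rewrite det_rot// mulr1 => e.
  by apply/(circle_group_rot _ _ a1)/(circle_group_rot _ _ a1)/KE; split=> //; left; exists a.
- have [b1 _] := Vb; rewrite det_rf// mulrN1 => e.
  apply/(circle_group_rf _ _ b1); split=> // /(circle_group_rf (unit_root n' 1) _ b1).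
  by move=> /KE[_ e1]; move: e; rewrite e1 => /eqP; rewrite -subr_eq0 -opprD oppr_eq0 gt_eqF.
- have [a1 _] := Ua.
  have /KE[Ga e] : dih n' c' (rot a) by left; exists a.
  by split=> //; rewrite e det_rot// mulr1.
- have [b1 _] := Vb; have Gb : dih n c (rf b) by right; exists b.
  split=> //; rewrite det_rf// mulrN1.
  have [e|->] := eta1 _ Gb; last by rewrite opprK.
  by exfalso; apply: nVb; apply/(circle_group_rf (unit_root n' 1) _ b1)/KE.
Qed.

Definition zc u : R[i] := Complex (xcoord u) (ycoord u).

(** The decomposition of the quadratic form into its part that is invariant under
    rotations and its traceless part, which rotates twice as fast as the plane. *)
Definition half_trace w u : R := (qa w u + qc w u) / 2.
Definition deviator w u : R[i] := Complex ((qc w u - qa w u) / 2) (qb w u).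

Lemma qdevalE w u v : qdeval w u v =
  half_trace w u * (xcoord v ^+ 2 + ycoord v ^+ 2) + complex.Re (conjc (deviator w u) * zc v ^+ 2).
Proof. by rewrite /qdeval /half_trace expr2 /=; field. Qed.

Lemma zc_rot a u : zc (rot a *m u) = a * zc u.
Proof.
by rewrite -[in LHS](vec2K u) mulmx2_vec /zc !vec2E; case: a => x y;
  apply/eqP; rewrite eq_complex/=; apply/andP; split; apply/eqP; ring.
Qed.

Lemma zc_kappa u : zc (kappa_x R *m u) = conjc (zc u).
Proof.
rewrite -[in LHS](vec2K u) mulmx2_vec /zc !vec2E.
by apply/eqP; rewrite eq_complex/=; apply/andP; split; apply/eqP; ring.
Qed.

Lemma norm_rot a u : a * conjc a = 1 ->
  xcoord (rot a *m u) ^+ 2 + ycoord (rot a *m u) ^+ 2 = xcoord u ^+ 2 + ycoord u ^+ 2.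
Proof.
move=> a1; have nz v : (xcoord v ^+ 2 + ycoord v ^+ 2)%:C%C = zc v * conjc (zc v).
  by rewrite normsq_complex.
by apply: complexI; rewrite !nz zc_rot rmorphM/= mulrACA a1 mul1r.
Qed.

Lemma norm_kappa u : xcoord (kappa_x R *m u) ^+ 2 + ycoord (kappa_x R *m u) ^+ 2 =
  xcoord u ^+ 2 + ycoord u ^+ 2.
Proof. by rewrite -[in LHS](vec2K u) mulmx2_vec !vec2E; ring. Qed.

(** Again the values at (1, 0), (0, 1) and (1, 1) suffice. *)
Lemma trace_deviator_unique (t t' : R) (q q' : R[i]) :
  (forall v, t * (xcoord v ^+ 2 + ycoord v ^+ 2) + complex.Re (q * zc v ^+ 2) =
     t' * (xcoord v ^+ 2 + ycoord v ^+ 2) + complex.Re (q' * zc v ^+ 2)) <->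
  t = t' /\ q = q'.
Proof.
split=> [e|[-> ->]//].
case: q q' e => q1 q2 [q1' q2'] e.
have := (e (vec2 1 0), e (vec2 0 1), e (vec2 1 1)).
rewrite /zc !vec2E expr2/= => -[[e1 e2] e3].
split; first by lra.
by apply/eqP; rewrite eq_complex/=; apply/andP; split; apply/eqP; lra.
Qed.

Lemma conjcD : {morph (@conjc R) : p q / p + q}.
Proof. exact: rmorphD. Qed.

Lemma conjcM : {morph (@conjc R) : p q / p * q}.
Proof. exact: rmorphM. Qed.

Lemma conjcX k : {morph (@conjc R) : p / p ^+ k}.
Proof. exact: rmorphXn. Qed.

Lemma Re_scale (s : R) (q : R[i]) : complex.Re (s%:C%C * q) = s * complex.Re q.
Proof. by case: q => x y /=; rewrite mul0r subr0. Qed.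

Lemma equivariant_rot w a (s : R) u : a * conjc a = 1 ->
  (forall v, qdeval w (rot a *m u) (rot a *m v) = s * qdeval w u v) <->
  half_trace w (rot a *m u) = s * half_trace w u /\ deviator w (rot a *m u) = s%:C%C * a ^+ 2 * deviator w u.
Proof.
move=> a1; rewrite -(_ : conjc (deviator w (rot a *m u)) * a ^+ 2 = s%:C%C * conjc (deviator w u) <->
    deviator w (rot a *m u) = s%:C%C * a ^+ 2 * deviator w u); last first.
  have a2 : a ^+ 2 * conjc (a ^+ 2) = 1 by rewrite rmorphXn -exprMn a1 expr1n.
  move: (a ^+ 2) a2 => A A1.
  split=> [/(congr1 (@conjc R))|->]; rewrite !conjcM ?conjcK conjc_real.
    by move=> e; rewrite mulrAC -e -mulrA [conjc A * _]mulrC A1 mulr1.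
  by rewrite mulrAC -[_ * conjc A * A]mulrA [conjc A * _]mulrC A1 mulr1.
rewrite -trace_deviator_unique; split=> e v; have := e v;
  rewrite !qdevalE norm_rot// zc_rot exprMn [_ * (a ^+ 2 * _)]mulrA -[_%:C%C * _ * _]mulrA Re_scale;
  move: (half_trace w u) (half_trace w (_ *m u)) (xcoord v ^+ 2 + ycoord v ^+ 2) => T T' N; lra.
Qed.

Lemma equivariant_kappa w (s : R) u :
  (forall v, qdeval w (kappa_x R *m u) (kappa_x R *m v) = s * qdeval w u v) <->
  half_trace w (kappa_x R *m u) = s * half_trace w u /\
  deviator w (kappa_x R *m u) = s%:C%C * conjc (deviator w u).
Proof.
have ReJ (q : R[i]) : complex.Re (conjc q) = complex.Re q by case: q.
rewrite -trace_deviator_unique; split=> e v; have := e v;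
  rewrite !qdevalE norm_kappa zc_kappa -conjcX -conjcM ReJ -[_%:C%C * _ * _]mulrA Re_scale;
  move: (half_trace w u) (half_trace w (_ *m u)) (xcoord v ^+ 2 + ycoord v ^+ 2) => T T' N; lra.
Qed.

(** Here a ^+ e is the value of eta on [rot a], and s its value on the
    reflection across the x-axis. *)
Definition symmetric_form n c e (s : R) w :=
  (forall a, unit_root n 1 a -> forall u,
     (half_trace w (rot a *m u))%:C%C = a ^+ e * (half_trace w u)%:C%C /\
     deviator w (rot a *m u) = a ^+ (e + 2) * deviator w u) /\
  (c = 1 -> forall u, half_trace w (kappa_x R *m u) = s * half_trace w u /\
     deviator w (kappa_x R *m u) = s%:C%C * conjc (deviator w u)).

(** The rotations and one reflection generate [dih n c]. *)
Lemma equivariantP n c e s (eta : 'M[R]_2 -> R) w : c = 0 \/ c = 1 ->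
  sign_hom (dih n c) eta ->
  (forall a, unit_root n 1 a -> (eta (rot a))%:C%C = a ^+ e) ->
  (c = 1 -> eta (kappa_x R) = s) ->
  equivariant (dih n c) eta w <-> symmetric_form n c e s w.
Proof.
move=> c01 [_ etaM] eta_rot eta_k.
have Gk : c = 1 -> dih n c (kappa_x R).
  by move=> ->; right; exists 1; [exact: unit_root1 | rewrite rf1].
split=> [ew|[sr sk]].
  split=> [a Ua u|c1 u].
    have [a1 _] := Ua; have Ga : dih n c (rot a) by left; exists a.
    have /(equivariant_rot _ _ _ a1)[-> ->] : forall v, qdeval w (rot a *m u) (rot a *m v) =
      eta (rot a) * qdeval w u v by move=> v; exact: ew.
    by rewrite exprD -eta_rot// rmorphM.
  by apply/equivariant_kappa => v; rewrite -eta_k// -ew//; exact: Gk.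
have er a u v : unit_root n 1 a ->
    qdeval w (rot a *m u) (rot a *m v) = eta (rot a) * qdeval w u v.
  move=> Ua; have [a1 _] := Ua; move: v; apply/(equivariant_rot _ _ _ a1).
  have := sr a Ua u; rewrite exprD -eta_rot// => -[e1 ->]; split=> //.
  by move: e1; rewrite -rmorphM => -[].
move=> g u v [[a Ua ->]|[b Vb ->]]; first exact: er.
have c1 : c = 1 by case: c01 Vb => // -> /unit_root0.
have Ub : unit_root n 1 b by rewrite -c1.
have Gb : dih n c (rot b) by left; exists b.
have -> : rf b = rot b *m kappa_x R by rewrite -rf1 rot_rf mulr1.
rewrite etaM//; last exact: Gk.
rewrite -!mulmxA er// -mulrA; congr (_ * _); rewrite eta_k//.
by move: v; apply/equivariant_kappa; exact: sk.
Qed.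

Lemma equivariant_forms_symmetric n c n' c' e s Klam form : c = 0 \/ c = 1 ->
  (exists eta, sign_hom (dih n c) eta /\ Defs.kernel (dih n c) eta = dih n' c') ->
  (forall eta, sign_hom (dih n c) eta -> Defs.kernel (dih n c) eta = dih n' c' ->
     (forall a, unit_root n 1 a -> (eta (rot a))%:C%C = a ^+ e) /\
     (c = 1 -> eta (kappa_x R) = s)) ->
  circle_group (unit_root n' 1) (fun b => unit_root n c b /\ ~ unit_root n' c' b) = Klam ->
  (forall w, polyform w -> (symmetric_form n c e s w <->
     exists p, (forall i, invpoly (dih n c) (p i)) /\ forall u, form p w u)) ->
  equivariant_forms (dih n c) (dih n' c') Klam form.
Proof.
move=> c01 ex_eta etaP KlamE formP; split=> // eta eta_hom Keta w pw.
have [eta_rot eta_k] := etaP eta eta_hom Keta.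
split; first by rewrite (equivariantP w c01 eta_hom eta_rot eta_k) formP.
move=> ew Om; exists (fun g => eta g * \det g); split; last first.
  by rewrite (kernel_lambda eta_hom Keta).
apply: lambda_equivariant => //; last exact: dih_O2.
by apply: dih_group; case: c01 => ->; rewrite ?conjc0 ?conjc1.
Qed.

(** When eta = 1, lambda is the determinant. *)
Lemma equivariant_forms_trivial n c form : c = 0 \/ c = 1 ->
  (forall w, polyform w -> (symmetric_form n c 0 1 w <->
     exists p, (forall i, invpoly (dih n c) (p i)) /\ forall u, form p w u)) ->
  equivariant_forms (dih n c) (dih n c) (dih n 0) form.
Proof.
move=> c01; apply: equivariant_forms_symmetric => //.
- exists (fun=> 1); split; first by split=> [g _|g h _ _]; [left | rewrite mulr1].
  by apply/seteqP; split=> g // [].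
- move=> eta _ Keta.
  have e1 g : dih n c g -> eta g = 1 by rewrite -Keta => -[].
  split=> [a Ua|c1]; first by rewrite expr0 e1//; left; exists a.
  by apply: e1; right; exists 1; rewrite ?c1 ?rf1//; exact: unit_root1.
- apply: eq_circle_group => // b; split=> [[//]|/unit_root0//].
Qed.

Lemma eta_outside n c n' c' (eta : 'M[R]_2 -> R) g : sign_hom (dih n c) eta ->
  Defs.kernel (dih n c) eta = dih n' c' -> dih n c g -> ~ dih n' c' g -> eta g = -1.
Proof.
move=> [eta1 _] Keta Gg Kg; case: (eta1 g Gg) => // e.
by exfalso; apply: Kg; rewrite -Keta.
Qed.

(** When eta is the determinant, lambda is trivial. *)
Lemma equivariant_forms_det n form :
  (forall w, polyform w -> (symmetric_form n 1 0 (-1) w <->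
     exists p, (forall i, invpoly (dih n 1) (p i)) /\ forall u, form p w u)) ->
  equivariant_forms (dih n 1) (dih n 0) (dih n 1) form.
Proof.
apply: equivariant_forms_symmetric; first by right.
- exists determinant; split; first split.
  + by move=> g [[a [a1 _] ->]|[a [a1 _] ->]]; [left; exact: det_rot | right; exact: det_rf].
  + by move=> g h _ _; exact: det_mulmx.
  apply/seteqP; split=> [g [[[a Ua ->]|[b [b1 _] ->]]]|g [[a Ua ->]|[b /unit_root0//]]].
  + by left; exists a.
  + by rewrite det_rf// => /eqP; rewrite -subr_eq0 -opprD oppr_eq0 gt_eqF.
  + by split; [left; exists a | case: Ua => a1 _; exact: det_rot].
- move=> eta eta_hom Keta; split=> [a Ua|_].
    by have [_ ->] : Defs.kernel (dih n 1) eta (rot a) by rewrite Keta; left; exists a.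
  have k1 : 1 * conjc 1 = 1 :> R[i] by rewrite conjc1 mulr1.
  apply: (eta_outside eta_hom Keta); rewrite -rf1.
    by right; exists 1; first exact: unit_root1.
  by move=> /(circle_group_rf _ _ k1)/unit_root0.
- apply: eq_circle_group => // b; split=> [[//]|Vb]; split=> //; exact: unit_root0.
Qed.

Lemma unit_root_double n a : unit_root n.*2 1 a -> a ^+ n = 1 \/ a ^+ n = -1.
Proof. by move=> [_ a2]; apply: sqrn1; rewrite -exprM muln2. Qed.

Lemma double_unit_root n a c : unit_root n c a -> c ^+ 2 = 1 -> unit_root n.*2 1 a.
Proof. by move=> [a1 ac] c2; split=> //; rewrite -muln2 exprM ac. Qed.

(** When the kernel of eta has index 2 and contains only half of the rotations,
    eta sends the element of parameter a to the sign a ^+ n.  The reflections in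
    the kernel of lambda are then those with b ^+ n = -1; for c = 0 there are
    none, in agreement with - c = 0. *)
Lemma equivariant_forms_half n c form : c = 0 \/ c = 1 ->
  (forall w, polyform w -> (symmetric_form n.*2 c n 1 w <->
     exists p, (forall i, invpoly (dih n.*2 c) (p i)) /\ forall u, form p w u)) ->
  equivariant_forms (dih n.*2 c) (dih n c) (dih n (- c)) form.
Proof.
move=> c01.
have cE b m : unit_root m c b -> c = 1 by case: c01 => // -> /unit_root0.
have n1 : (1 : R[i]) <> -1.
  by move/eqP; rewrite -subr_eq0 opprK -(natrD _ 1 1) pnatr_eq0.
apply: equivariant_forms_symmetric => //.
- exists (fun g => complex.Re (mx_col g ^+ n)).
  have col g : dih n.*2 c g -> mx_col g ^+ n = 1 \/ mx_col g ^+ n = -1.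
    move=> [[a Ua ->]|[b Vb ->]]; first by rewrite mx_col_rot; exact: unit_root_double.
    by rewrite mx_col_rf; apply: unit_root_double; rewrite -(cE _ _ Vb).
  have ReM (a b : R[i]) : (a = 1 \/ a = -1) -> (b = 1 \/ b = -1) ->
      complex.Re (a * conjc b) = complex.Re a * complex.Re b.
    by move=> [->|->] [->|->]; rewrite ?rmorphN1 ?conjc1 ?mulrNN /=; ring.
  have colM g h : dih n.*2 c g -> dih n.*2 c h ->
      mx_col (g *m h) ^+ n = mx_col g ^+ n * mx_col h ^+ n.
    have J1 (b : R[i]) : b ^+ n = 1 \/ b ^+ n = -1 -> conjc b ^+ n = b ^+ n.
      by rewrite -conjcX => -[->|->]; rewrite ?rmorphN1 ?conjc1.
    move=> [[a Ua ->]|[b Vb ->]] Gh; have := col h Gh; case: Gh => [[a' Ua' ->]|[b' Vb' ->]];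
      rewrite ?rotM ?rot_rf ?rf_rot ?rfM !(mx_col_rot, mx_col_rf) exprMn//;
      by move=> /J1 ->.
  split; first split.
  + by move=> g /col[->|->]; [left | right].
  + move=> g h Gg Gh; rewrite colM//.
    by case: (col g Gg) => ->; case: (col h Gh) => -> /=; ring.
  apply/seteqP; split=> g.
  + move=> [Gg]; case: (col g Gg) => [e _|->]; last first.
      by move=> /= /eqP; rewrite -subr_eq0 -opprD oppr_eq0 gt_eqF.
    case: Gg e => [[a [a1 _] ->]|[b Vb ->]]; rewrite ?mx_col_rot ?mx_col_rf => e.
      by left; exists a.
    by right; exists b => //; split; [case: Vb | rewrite e (cE _ _ Vb)].
  + move=> [[a Ua ->]|[b Vb ->]].
      split; last by rewrite mx_col_rot; case: Ua => _ ->.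
      by left; exists a => //; apply: (double_unit_root Ua); rewrite expr1n.
    split; last by rewrite mx_col_rf; have [_ ->] := Vb; rewrite (cE _ _ Vb).
    by right; exists b => //; rewrite {1}(cE _ _ Vb); apply: (double_unit_root Vb); rewrite (cE _ _ Vb) expr1n.
- move=> eta eta_hom Keta; split=> [a Ua|c1].
    have [a1 _] := Ua.
    have Ga : dih n.*2 c (rot a) by left; exists a.
    case: (unit_root_double Ua) => e.
      have [_ ->] : Defs.kernel (dih n.*2 c) eta (rot a) by rewrite Keta; left; exists a.
      by rewrite e.
    rewrite (eta_outside eta_hom Keta Ga) ?e ?rmorphN1//.
    by move=> /(circle_group_rot _ _ a1)[_]; rewrite e => /esym.
  have [] // : Defs.kernel (dih n.*2 c) eta (kappa_x R).
  by rewrite Keta c1; right; exists 1; rewrite ?rf1//; exact: unit_root1.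
- apply: eq_circle_group => // b; split=> [[Vb nVb]|Vb].
    have c1 := cE _ _ Vb; move: Vb nVb; rewrite c1 => Vb nVb; have [b1 _] := Vb.
    by case: (unit_root_double Vb) => e; [exfalso; apply: nVb | split].
  have c1 : c = 1 by case: c01 Vb => // ->; rewrite oppr0 => /unit_root0.
  move: Vb; rewrite c1 => Vb; split.
    by apply: (double_unit_root Vb); rewrite sqrrN expr1n.
  by case: Vb => _ bn [_]; rewrite bn => /esym.
Qed.

End FormsAndGroups.

(** * Complex polynomials in z and its conjugate *)

Section ComplexPolynomials.
Variable R : realType.
Implicit Types (a b c : R[i]) (u : 'cV[R]_2) (F G : 'cV[R]_2 -> R[i]) (f : 'cV[R]_2 -> R).

Definition monomial j k u : R[i] := zc u ^+ j * conjc (zc u) ^+ k.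

(** Polynomials are lists of terms ((c, (j, k))), standing for c z^j conj(z)^k;
    repetitions and zero coefficients do no harm. *)
Definition zsum (s : seq (R[i] * (nat * nat))) u : R[i] :=
  \sum_(t <- s) t.1 * monomial t.2.1 t.2.2 u.

Definition zpoly F := exists s, F = zsum s.

Lemma zpolyD F G : zpoly F -> zpoly G -> zpoly (fun u => F u + G u).
Proof.
by move=> [s ->] [t ->]; exists (s ++ t); apply/funext => u; rewrite /zsum big_cat.
Qed.

Lemma zpolyM F G : zpoly F -> zpoly G -> zpoly (fun u => F u * G u).
Proof.
move=> [s ->] [t ->].
exists [seq (x.1 * y.1, ((x.2.1 + y.2.1)%N, (x.2.2 + y.2.2)%N)) | x <- s, y <- t].
apply/funext => u; rewrite /zsum big_distrlr big_allpairs_dep /=.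
apply: eq_bigr => x _; apply: eq_bigr => y _.
by rewrite /monomial !exprD; ring.
Qed.

Lemma zpoly_cst c : zpoly (fun=> c).
Proof.
exists [:: (c, (0%N, 0%N))]; apply/funext => u.
by rewrite /zsum big_seq1 /monomial/= !expr0 !mulr1.
Qed.

Lemma polyfun_zpoly f : polyfun f -> zpoly (fun u => (f u)%:C%C).
Proof.
move: f; apply: polyfun_ind => [c|||f g Pf Pg|f g Pf Pg].
- exact: zpoly_cst.
- exists [:: (2^-1, (1%N, 0%N)); (2^-1, (0%N, 1%N))]; apply/funext => u.
  rewrite /zsum big_cons big_seq1 /monomial/= !expr0 !expr1 mulr1 mul1r -mulrDr.
  by rewrite addcJ mulrA mulVf ?mul1r ?pnatr_eq0.
- exists [:: ((2 * 'i%C)^-1, (1%N, 0%N)); (- (2 * 'i%C)^-1, (0%N, 1%N))]; apply/funext => u.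
  rewrite /zsum big_cons big_seq1 /monomial/= !expr0 !expr1 mulr1 mul1r mulNr -mulrBr.
  rewrite subcJ mulrAC mulrA mulVf ?mul1r// mulf_neq0// ?pnatr_eq0//.
  by rewrite eq_complex/= oner_eq0 andbF.
- by have := zpolyD Pf Pg; congr zpoly; apply/funext => u; rewrite rmorphD.
- by have := zpolyM Pf Pg; congr zpoly; apply/funext => u; rewrite rmorphM.
Qed.

Definition cpolyfun F :=
  polyfun (fun u => complex.Re (F u)) /\ polyfun (fun u => complex.Im (F u)).

Lemma cpolyfun_zpoly F : cpolyfun F -> zpoly F.
Proof.
move=> [/polyfun_zpoly PR /polyfun_zpoly PI].
have := zpolyD PR (zpolyM (zpoly_cst 'i%C) PI).
by congr zpoly; apply/funext => u; rewrite -complexE.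
Qed.

Lemma cpolyfun_real f : polyfun f -> cpolyfun (fun u => (f u)%:C%C).
Proof. by move=> pf; split=> //; exact: polyfun_cst. Qed.

Lemma cpolyfun_cst c : cpolyfun (fun=> c).
Proof. by split; exact: polyfun_cst. Qed.

Lemma cpolyfun_zc : cpolyfun (@zc R).
Proof. by split; [exact: polyfun_x | exact: polyfun_y]. Qed.

Lemma cpolyfunJ F : cpolyfun F -> cpolyfun (fun u => conjc (F u)).
Proof.
move=> [pR pI]; split.
  by move: pR; congr polyfun; apply/funext => u; case: (F u).
by have := polyfunN pI; congr polyfun; apply/funext => u; case: (F u).
Qed.

Lemma cpolyfunD F G : cpolyfun F -> cpolyfun G -> cpolyfun (fun u => F u + G u).
Proof.
move=> [pR pI] [qR qI]; split.
  by have := polyfunD pR qR; congr polyfun; apply/funext => u; case: (F u) (G u) => ? ? [].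
by have := polyfunD pI qI; congr polyfun; apply/funext => u; case: (F u) (G u) => ? ? [].
Qed.

Lemma cpolyfunM F G : cpolyfun F -> cpolyfun G -> cpolyfun (fun u => F u * G u).
Proof.
move=> [pR pI] [qR qI]; split.
  have := polyfunB (polyfunM pR qR) (polyfunM pI qI).
  by congr polyfun; apply/funext => u; case: (F u) (G u) => ? ? [].
have := polyfunD (polyfunM pR qI) (polyfunM pI qR).
by congr polyfun; apply/funext => u; case: (F u) (G u) => ? ? [].
Qed.

Lemma cpolyfunX F k : cpolyfun F -> cpolyfun (fun u => F u ^+ k).
Proof.
move=> pF; elim: k => [|k IH]; first by under eq_fun do rewrite expr0; exact: cpolyfun_cst.
by under eq_fun do rewrite exprS; exact: cpolyfunM.
Qed.

Lemma monomial_rot a j k u :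
  monomial j k (rot a *m u) = a ^+ j * conjc a ^+ k * monomial j k u.
Proof. by rewrite /monomial zc_rot conjcM !exprMn mulrACA. Qed.

Lemma monomial_kappa j k u : monomial j k (kappa_x R *m u) = conjc (monomial j k u).
Proof. by rewrite /monomial zc_kappa conjcM !conjcX. Qed.

Lemma sum_root_of_unity n (w : R[i]) : w ^+ n = 1 ->
  \sum_(l < n) w ^+ l = if w == 1 then n%:R else 0.
Proof.
move=> wn; case: eqP => [->|/eqP w1].
  by under eq_bigr do rewrite expr1n; rewrite sumr_const card_ord.
have := subrX1 w n; rewrite wn subrr => /esym/eqP.
by rewrite mulf_eq0 subr_eq0 (negbTE w1) => /eqP.
Qed.

(** The function is the average of r^(- e l) F(r^l u) over l < n, and the average
    of a monomial is the monomial itself or 0, according to a geometric sum. *)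
Lemma zsum_isotypic n e s : (0 < n)%N ->
  (forall u, zsum s (rot (root_of_unity R n) *m u) = root_of_unity R n ^+ e * zsum s u) ->
  zsum s = zsum [seq t <- s | t.2.1 == e + t.2.2 %[mod n]].
Proof.
move=> n0; set r := root_of_unity R n => sE; apply/funext => u.
have [r1 rn] := root_of_unity_unit R n0.
have prim := root_of_unity_prim R n0.
have sEl l : zsum s (rot (r ^+ l) *m u) = (r ^+ e) ^+ l * zsum s u.
  elim: l => [|l IH]; first by rewrite !expr0 rot1 mul1mx mul1r.
  by rewrite exprS -rotM -mulmxA sE IH exprS mulrA.
pose w (t : R[i] * (nat * nat)) := r ^+ t.2.1 * conjc r ^+ (e + t.2.2).
have wn t : w t ^+ n = 1.
  by rewrite /w exprMn -!exprM mulnC exprM rn expr1n mul1r mulnC exprM -conjcX rn conjc1 expr1n.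
have w1 t : (w t == 1) = (t.2.1 == e + t.2.2 %[mod n]).
  rewrite -(eq_prim_root_expr prim) /w; apply/eqP/eqP => [e1|->].
    by rewrite -[LHS]mulr1 -[X in _ * X](expr1n _ (e + t.2.2)) -r1 exprMn [r ^+ (e + _) * _]mulrC mulrA e1 mul1r.
  by rewrite -exprMn r1 expr1n.
apply: (@mulfI _ n%:R); first by rewrite pnatr_eq0 -lt0n.
transitivity (\sum_(l < n) conjc (r ^+ e) ^+ l * zsum s (rot (r ^+ l) *m u)).
  under eq_bigr do rewrite sEl mulrA -exprMn [conjc _ * _]mulrC conjcX -exprMn r1 !expr1n mul1r.
  by rewrite sumr_const card_ord mulr_natl.
under eq_bigr do rewrite /zsum mulr_sumr.
rewrite exchange_big /= /zsum big_filter mulr_sumr [RHS]big_mkcond/=.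
apply: eq_bigr => t _.
transitivity ((\sum_(l < n) w t ^+ l) * (t.1 * monomial t.2.1 t.2.2 u)).
  rewrite mulr_suml; apply: eq_bigr => l _; rewrite monomial_rot /w.
  rewrite conjcX conjcX exprD !exprMn -!exprM [(l * t.2.1)%N]mulnC [(l * t.2.2)%N]mulnC.
  by ring.
by rewrite sum_root_of_unity// w1; case: ifP => // _; rewrite mul0r.
Qed.

(** The average of F(u) and conj (F(conj u)) replaces every coefficient by its
    real part. *)
Lemma zsum_real s : (forall u, zsum s (kappa_x R *m u) = conjc (zsum s u)) ->
  zsum s = zsum [seq ((complex.Re t.1)%:C%C, t.2) | t <- s].
Proof.
move=> sE; apply/funext => u; apply: (@mulfI _ 2); first by rewrite pnatr_eq0.
transitivity (zsum s u + conjc (zsum s (kappa_x R *m u))).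
  by rewrite sE conjcK mulr_natl mulr2n.
rewrite /zsum rmorph_sum -big_split big_map mulr_sumr /=; apply: eq_bigr => t _.
by rewrite monomial_kappa conjcM conjcK -mulrDl addcJ [RHS]mulrA.
Qed.

End ComplexPolynomials.

(** * Invariants and modules of equivariants *)

Section Invariants.
Variable R : realType.
Implicit Types (a b c : R[i]) (u : 'cV[R]_2) (F G : 'cV[R]_2 -> R[i]) (f : 'cV[R]_2 -> R).

Lemma invpolyP n c f : c = 0 \/ c = 1 -> invpoly (dih n c) f <->
  [/\ polyfun f, forall a, unit_root n 1 a -> forall u, f (rot a *m u) = f u
    & c = 1 -> forall u, f (kappa_x R *m u) = f u].
Proof.
move=> c01; split=> [[pf fG]|[pf fr fk]].
  split=> // [a Ua u|c1 u]; apply: fG; first by left; exists a.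
  by right; exists 1; [rewrite c1; exact: unit_root1 | rewrite rf1].
split=> // g u [[a Ua ->]|[b Vb ->]]; first exact: fr.
have c1 : c = 1 by case: c01 Vb => // -> /unit_root0.
have Ub : unit_root n 1 b by rewrite -c1.
by rewrite -[b]mulr1 -rot_rf rf1 -mulmxA fr// fk.
Qed.

Definition cinvariant n F :=
  cpolyfun F /\ forall a, unit_root n 1 a -> forall u, F (rot a *m u) = F u.

Lemma cinvariantD n F G : cinvariant n F -> cinvariant n G ->
  cinvariant n (fun u => F u + G u).
Proof.
move=> [pF iF] [pG iG]; split; first exact: cpolyfunD.
by move=> a Ua u; rewrite iF// iG.
Qed.

Lemma cinvariantM n F G : cinvariant n F -> cinvariant n G ->
  cinvariant n (fun u => F u * G u).
Proof.
move=> [pF iF] [pG iG]; split; first exact: cpolyfunM.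
by move=> a Ua u; rewrite iF// iG.
Qed.

Lemma cinvariant_cst n c : cinvariant n (fun=> c).
Proof. by split; first exact: cpolyfun_cst. Qed.

Lemma cinvariantX n F k : cinvariant n F -> cinvariant n (fun u => F u ^+ k).
Proof.
move=> [pF iF]; split; first exact: cpolyfunX.
by move=> a Ua u; rewrite iF.
Qed.

Lemma cinvariantJ n F : cinvariant n F -> cinvariant n (fun u => conjc (F u)).
Proof.
move=> [pF iF]; split; first exact: cpolyfunJ.
by move=> a Ua u; rewrite iF.
Qed.

Lemma cinvariant_zcX n : cinvariant n (fun u => zc u ^+ n).
Proof.
split; first by apply: cpolyfunX; exact: cpolyfun_zc.
by move=> a [_ an] u; rewrite zc_rot exprMn an mul1r.
Qed.

Lemma cinvariant_norm n : cinvariant n (fun u => zc u * conjc (zc u)).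
Proof.
split; first by apply: cpolyfunM; [|apply: cpolyfunJ]; exact: cpolyfun_zc.
by move=> a [a1 _] u; rewrite zc_rot conjcM mulrACA a1 mul1r.
Qed.

Lemma cinvariant_Re n F : cinvariant n F -> invpoly (dih n 0) (fun u => complex.Re (F u)).
Proof.
move=> [[pR pI] iF]; apply/invpolyP; first by left.
split=> // [a Ua u|/esym/eqP]; first by rewrite iF.
by rewrite oner_eq0.
Qed.

Lemma cinvariant_Im n F : cinvariant n F -> invpoly (dih n 0) (fun u => complex.Im (F u)).
Proof.
move=> [[pR pI] iF]; apply/invpolyP; first by left.
split=> // [a Ua u|/esym/eqP]; first by rewrite iF.
by rewrite oner_eq0.
Qed.

(** A monomial with j = e + k modulo n contains either z^e or conj(z)^(n - e),
    the rest being a product of powers of |z|^2 and of z^n or its conjugate. *)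
Lemma mod_split n e j k : (0 < n)%N -> (e <= n)%N -> j = e + k %[mod n] ->
  (exists m, j = (e + k + n * m)%N) \/ (exists m, k = (j + n * m + (n - e))%N).
Proof.
move=> n0 en jk; case: (leqP (e + k) j) => [le|lt].
  move/eqP: jk; rewrite eqn_mod_dvd// => /dvdnP[m jm].
  by left; exists m; rewrite mulnC -jm subnKC.
move/esym/eqP: jk; rewrite eqn_mod_dvd ?(ltnW lt)// => /dvdnP[m jm].
have : (e + k = j + m * n)%N by rewrite -jm subnKC// ltnW.
case: m {jm} => [|m] jm; first by move: lt; rewrite jm; lia.
by right; exists m; move: jm; rewrite mulSn mulnC; lia.
Qed.

Definition cyclic_form n e F := exists g h, [/\ cinvariant n g, cinvariant n h &
  forall u, F u = zc u ^+ e * g u + conjc (zc u) ^+ (n - e) * h u].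

Lemma cyclic_formD n e F G : cyclic_form n e F -> cyclic_form n e G ->
  cyclic_form n e (fun u => F u + G u).
Proof.
move=> [g [h [ig ih FE]]] [g' [h' [ig' ih' GE]]].
exists (fun u => g u + g' u), (fun u => h u + h' u); split; [exact: cinvariantD | exact: cinvariantD |].
by move=> u; rewrite FE GE; ring.
Qed.

Lemma cyclic_form_monomial n e c j k : (0 < n)%N -> (e <= n)%N ->
  j = e + k %[mod n] -> cyclic_form n e (fun u => c * monomial j k u).
Proof.
move=> n0 en /(mod_split n0 en)[[m ->]|[m ->]].
  exists (fun u => c * ((zc u * conjc (zc u)) ^+ k * (zc u ^+ n) ^+ m)), (fun=> 0).
  split; [|exact: cinvariant_cst|].
    apply: cinvariantM; first exact: cinvariant_cst.
    apply: cinvariantM; apply: cinvariantX; [exact: cinvariant_norm | exact: cinvariant_zcX].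
  move=> u; rewrite /monomial !exprD exprM exprMn.
  move: (zc u ^+ e) (zc u ^+ k) (conjc (zc u) ^+ k) (_ ^+ m) (conjc (zc u) ^+ _) => *; ring.
exists (fun=> 0), (fun u => c * ((zc u * conjc (zc u)) ^+ j * conjc (zc u ^+ n) ^+ m)).
split; [exact: cinvariant_cst | |].
  apply: cinvariantM; first exact: cinvariant_cst.
  apply: cinvariantM; apply: cinvariantX; first exact: cinvariant_norm.
  by apply: cinvariantJ; exact: cinvariant_zcX.
move=> u; rewrite /monomial !exprD exprM exprMn conjcX.
move: (zc u ^+ e) (zc u ^+ j) (conjc (zc u) ^+ j) (_ ^+ m) (conjc (zc u) ^+ (n - e)) => *; ring.
Qed.

(** Only the monomials z^j zbar^k with j = e + k modulo n survive averaging
    over the rotations. *)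
Lemma cyclic_module n e F : (0 < n)%N -> (e <= n)%N -> cpolyfun F ->
  (forall a, unit_root n 1 a -> forall u, F (rot a *m u) = a ^+ e * F u) ->
  cyclic_form n e F.
Proof.
move=> n0 en /cpolyfun_zpoly[s ->] sE.
rewrite (zsum_isotypic n0 (sE _ (root_of_unity_unit R n0))).
elim: s {sE} => [|t s IH] /=.
  exists (fun=> 0), (fun=> 0); split; [exact: cinvariant_cst | exact: cinvariant_cst |].
  by move=> u; rewrite /zsum big_nil !mulr0 addr0.
case: ifP => // /eqP te.
have := cyclic_formD (cyclic_form_monomial t.1 n0 en te) IH.
by congr cyclic_form; apply/funext => u; rewrite /zsum big_cons.
Qed.

(** Average over the rotations of an order n larger than all exponents, so that
    the congruence j = e + k modulo n becomes an equality. *)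
Lemma circle_module e F : cpolyfun F ->
  (forall a, unit_root 0 1 a -> forall u, F (rot a *m u) = a ^+ e * F u) ->
  exists g, [/\ cinvariant 0 g, forall u, g (kappa_x R *m u) = g u
    & forall u, F u = zc u ^+ e * g u].
Proof.
move=> /cpolyfun_zpoly[s ->] sE.
pose n := (e + \sum_(t <- s) (t.2.1 + t.2.2)).+1.
rewrite (@zsum_isotypic _ n e s) //; last first.
  by move=> u; apply: sE; split=> //; exact: cis_unit.
have : forall t, t \in s -> (t.2.1 < n)%N /\ (e + t.2.2 < n)%N.
  move=> t ts; have : (t.2.1 + t.2.2 <= \sum_(t <- s) (t.2.1 + t.2.2))%N.
    by rewrite (big_rem t)//= leq_addr.
  rewrite /n; lia.
move: n => n; elim: s {sE} => [|t s IH] sn /=.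
  exists (fun=> 0); split=> // [|u]; first exact: cinvariant_cst.
  by rewrite /zsum big_nil mulr0.
have [|g [ig kg gE]] := IH; first by move=> t' ts; apply: sn; rewrite inE ts orbT.
case: ifP => [|_]; last by exists g.
have [tn1 tn2] := sn t (mem_head _ _); rewrite !modn_small// => /eqP te.
exists (fun u => t.1 * (zc u * conjc (zc u)) ^+ t.2.2 + g u); split.
- apply: cinvariantD; last exact: ig.
  apply: cinvariantM; first exact: cinvariant_cst.
  by apply: cinvariantX; exact: cinvariant_norm.
- by move=> u; rewrite kg zc_kappa conjcK [conjc _ * _]mulrC.
- move=> u; rewrite /zsum big_cons -/(zsum _ _) gE /monomial te exprD exprMn.
  by move: (zc u ^+ e) (zc u ^+ _) (conjc (zc u) ^+ _) => *; ring.
Qed.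

Definition dihedral_form n e F := exists g h,
  [/\ invpoly (dih n 1) g, invpoly (dih n 1) h &
  forall u, F u = zc u ^+ e * (g u)%:C%C + conjc (zc u) ^+ (n - e) * (h u)%:C%C].

Lemma invpoly_cst (G : set 'M[R]_2) (r : R) : invpoly G (fun=> r).
Proof. by split; first exact: polyfun_cst. Qed.

Lemma invpolyD (G : set 'M[R]_2) f g : invpoly G f -> invpoly G g -> invpoly G (fun u => f u + g u).
Proof.
move=> [pf fG] [pg gG]; split; first exact: polyfunD.
by move=> k u Gk; rewrite fG// gG.
Qed.

Lemma invpolyM (G : set 'M[R]_2) f g : invpoly G f -> invpoly G g -> invpoly G (fun u => f u * g u).
Proof.
move=> [pf fG] [pg gG]; split; first exact: polyfunM.
by move=> k u Gk; rewrite fG// gG.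
Qed.

Lemma invpolyX (G : set 'M[R]_2) f k : invpoly G f -> invpoly G (fun u => f u ^+ k).
Proof.
move=> fG; elim: k => [|k IH]; first by under eq_fun do rewrite expr0; exact: invpoly_cst.
by under eq_fun do rewrite exprS; exact: invpolyM.
Qed.

Lemma dihedral_form0 n e : dihedral_form n e (fun=> 0).
Proof.
exists (fun=> 0), (fun=> 0); split; [exact: invpoly_cst | exact: invpoly_cst |].
by move=> u; rewrite !mulr0 addr0.
Qed.

Lemma dihedral_formD n e F G : dihedral_form n e F -> dihedral_form n e G ->
  dihedral_form n e (fun u => F u + G u).
Proof.
move=> [g [h [ig ih FE]]] [g' [h' [ig' ih' GE]]].
exists (fun u => g u + g' u), (fun u => h u + h' u); split; [exact: invpolyD | exact: invpolyD |].
by move=> u; rewrite FE GE !rmorphD/=; ring.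
Qed.

Lemma dihedral_form_scale n e f F : invpoly (dih n 1) f -> dihedral_form n e F ->
  dihedral_form n e (fun u => (f u)%:C%C * F u).
Proof.
move=> iff [g [h [ig ih FE]]].
exists (fun u => f u * g u), (fun u => f u * h u); split; [exact: invpolyM | exact: invpolyM |].
by move=> u; rewrite FE !rmorphM/=; ring.
Qed.

Definition sqnorm u : R := xcoord u ^+ 2 + ycoord u ^+ 2.

Lemma sqnormE u : (sqnorm u)%:C%C = zc u * conjc (zc u).
Proof. by rewrite normsq_complex. Qed.

Lemma invpoly_sqnorm n : invpoly (dih n 1) sqnorm.
Proof.
apply/invpolyP; [by right | split].
- rewrite /sqnorm; under eq_fun do rewrite !expr2.
  by apply: polyfunD; apply: polyfunM; [exact: polyfun_x | exact: polyfun_x | exact: polyfun_y | exact: polyfun_y].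
- by move=> a [a1 _] u; exact: norm_rot.
- by move=> _ u; exact: norm_kappa.
Qed.

Lemma invpoly_ReX n : invpoly (dih n 1) (fun u => complex.Re (zc u ^+ n)).
Proof.
have [[pR _] iR] := cinvariant_zcX n.
apply/invpolyP; [by right | split; [exact: pR | move=> a Ua u | move=> _ u]].
- by rewrite iR.
- by rewrite zc_kappa -conjcX; case: (_ ^+ n).
Qed.

(** The number X = z^n and its conjugate are the roots of a quadratic polynomial
    whose coefficients 2 Re(X) and |X|^2 are real invariants, which reduces a
    power of X by one.  For the first power, conj(X) z^e = |z|^(2e) conj(z)^(n - e)
    and X conj(z)^(n - e) = |z|^(2(n - e)) z^e exchange the two generators. *)
Lemma dihedral_form_power n e m : (e <= n)%N ->
  dihedral_form n e (fun u => zc u ^+ e * (zc u ^+ n) ^+ m) /\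
  dihedral_form n e (fun u => conjc (zc u) ^+ (n - e) * (conjc (zc u) ^+ n) ^+ m).
Proof.
move=> en.
pose tr u := 2 * complex.Re (zc u ^+ n).
have itr : invpoly (dih n 1) tr by apply: invpolyM; [exact: invpoly_cst | exact: invpoly_ReX].
have trE u : (tr u)%:C%C = zc u ^+ n + conjc (zc u) ^+ n.
  by rewrite -conjcX addcJ /tr rmorphM /= rmorph_nat.
have inorm k : invpoly (dih n 1) (fun u => sqnorm u ^+ k).
  by apply: invpolyX; exact: invpoly_sqnorm.
have normE k u : (sqnorm u ^+ k)%:C%C = zc u ^+ k * conjc (zc u) ^+ k.
  by rewrite rmorphXn /= sqnormE exprMn.
have gen1 : dihedral_form n e (fun u => zc u ^+ e).
  exists (fun=> 1), (fun=> 0); split; [exact: invpoly_cst | exact: invpoly_cst |].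
  by move=> u; rewrite mulr0 addr0 mulr1.
have gen2 : dihedral_form n e (fun u => conjc (zc u) ^+ (n - e)).
  exists (fun=> 0), (fun=> 1); split; [exact: invpoly_cst | exact: invpoly_cst |].
  by move=> u; rewrite mulr0 add0r mulr1.
have neg1 : invpoly (dih n 1) (fun _ : 'cV[R]_2 => -1 : R) by exact: invpoly_cst.
have splitn (w : R[i]) : w ^+ n = w ^+ e * w ^+ (n - e) by rewrite -exprD subnKC.
have rec F G : dihedral_form n e F -> dihedral_form n e G ->
    dihedral_form n e (fun u => (tr u)%:C%C * F u - (sqnorm u ^+ n)%:C%C * G u).
  move=> dF dG; have := dihedral_formD (dihedral_form_scale itr dF)
    (dihedral_form_scale neg1 (dihedral_form_scale (inorm n) dG)).
  by congr dihedral_form; apply/funext => u; rewrite rmorphN1 mulN1r.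
have two (P : nat -> Prop) : P 0 -> P 1 -> (forall k, P k -> P k.+1 -> P k.+2) -> P m.
  move=> P0 P1 PS; suff : P m /\ P m.+1 by case.
  by elim: m => [|k [Pk PSk]]; split=> //; exact: PS.
split.
- apply: (two (fun m => dihedral_form n e (fun u => zc u ^+ e * (zc u ^+ n) ^+ m))).
  + by under eq_fun do rewrite expr0 mulr1.
  + have := dihedral_formD (dihedral_form_scale itr gen1)
      (dihedral_form_scale neg1 (dihedral_form_scale (inorm e) gen2)).
    congr dihedral_form; apply/funext => u.
    rewrite expr1 trE normE rmorphN1 !splitn.
    by move: (zc u ^+ e) (zc u ^+ (n - e)) (conjc (zc u) ^+ e) (conjc (zc u) ^+ _) => *; ring.
  + move=> k dk dSk; have := rec _ _ dSk dk; congr dihedral_form; apply/funext => u.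
    by rewrite trE normE !exprS; ring.
- apply: (two (fun m => dihedral_form n e (fun u => conjc (zc u) ^+ (n - e) * (conjc (zc u) ^+ n) ^+ m))).
  + by under eq_fun do rewrite expr0 mulr1.
  + have := dihedral_formD (dihedral_form_scale itr gen2)
      (dihedral_form_scale neg1 (dihedral_form_scale (inorm (n - e)%N) gen1)).
    congr dihedral_form; apply/funext => u.
    rewrite expr1 trE normE rmorphN1 !splitn.
    by move: (zc u ^+ e) (zc u ^+ (n - e)) (conjc (zc u) ^+ e) (conjc (zc u) ^+ _) => *; ring.
  + move=> k dk dSk; have := rec _ _ dSk dk; congr dihedral_form; apply/funext => u.
    by rewrite trE normE !exprS; ring.
Qed.

Lemma dihedral_form_monomial n e (r : R) j k : (0 < n)%N -> (e <= n)%N ->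
  j = e + k %[mod n] -> dihedral_form n e (fun u => r%:C%C * monomial j k u).
Proof.
move=> n0 en /(mod_split n0 en)[[m ->]|[m ->]]; have [d1 d2] := dihedral_form_power m en.
  have := dihedral_form_scale (invpolyM (invpoly_cst _ r) (invpolyX k (invpoly_sqnorm n))) d1.
  congr dihedral_form; apply/funext => u.
  rewrite rmorphM /= rmorphXn /= sqnormE /monomial !exprD exprM exprMn.
  move: (zc u ^+ e) (zc u ^+ k) (conjc (zc u) ^+ k) (_ ^+ m) => *; ring.
have := dihedral_form_scale (invpolyM (invpoly_cst _ r) (invpolyX j (invpoly_sqnorm n))) d2.
congr dihedral_form; apply/funext => u.
rewrite rmorphM /= rmorphXn /= sqnormE /monomial !exprD exprM exprMn.
move: (zc u ^+ j) (conjc (zc u) ^+ j) (_ ^+ m) (conjc (zc u) ^+ (n - e)) => *; ring.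
Qed.

Lemma dihedral_module n e F : (0 < n)%N -> (e <= n)%N -> cpolyfun F ->
  (forall a, unit_root n 1 a -> forall u, F (rot a *m u) = a ^+ e * F u) ->
  (forall u, F (kappa_x R *m u) = conjc (F u)) -> dihedral_form n e F.
Proof.
move=> n0 en /cpolyfun_zpoly[s ->] sE sk.
have sI := zsum_isotypic n0 (sE _ (root_of_unity_unit R n0)).
rewrite sI in sk *; rewrite (zsum_real sk).
elim: s {sE sk sI} => [|t s IH] /=.
  have := dihedral_form0 n e; congr dihedral_form; apply/funext => u.
  by rewrite /zsum big_nil.
case: ifP => // /eqP te /=.
have := dihedral_formD (dihedral_form_monomial (complex.Re t.1) n0 en te) IH.
by congr dihedral_form; apply/funext => u; rewrite /zsum big_cons.
Qed.

End Invariants.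

(** * Equivariant half-traces and deviators; the circle groups *)

Section Lists.
Variable R : realType.
Implicit Types (a b c : R[i]) (u : 'cV[R]_2) (w : qdform R) (F : 'cV[R]_2 -> R[i]).

Lemma conjcN : {morph (@conjc R) : p / - p}.
Proof. exact: rmorphN. Qed.

Definition rot_equivariant n e F :=
  forall a, unit_root n 1 a -> forall u, F (rot a *m u) = a ^+ e * F u.

(** Hence z^e and conj(z)^(n - e) transform in the same way. *)
Lemma unit_root_conjX n e a : (e <= n)%N -> unit_root n 1 a ->
  conjc a ^+ (n - e) = a ^+ e.
Proof.
move=> en [a1 an].
have e1 : conjc a ^+ (n - e) * conjc a ^+ e = 1.
  by rewrite -exprD subnK// -conjcX an conjc1.
by rewrite -[LHS]mulr1 -[X in _ * X](expr1n _ e) -a1 exprMn [a ^+ e * _]mulrC mulrA e1 mul1r.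
Qed.

Lemma cyclic_formP n e F : (0 < n)%N -> (e <= n)%N -> cpolyfun F ->
  rot_equivariant n e F <-> cyclic_form n e F.
Proof.
move=> n0 en pF; split; first exact: cyclic_module.
move=> [g [h [[_ ig] [_ ih] FE]]] a Ua u.
rewrite !FE ig// ih// zc_rot conjcM !exprMn (unit_root_conjX en Ua).
by rewrite mulrDr !mulrA.
Qed.

Lemma dihedral_formP n e F : (0 < n)%N -> (e <= n)%N -> cpolyfun F ->
  (rot_equivariant n e F /\ forall u, F (kappa_x R *m u) = conjc (F u)) <->
  dihedral_form n e F.
Proof.
move=> n0 en pF; split; first by case; exact: dihedral_module.
move=> [g [h [/invpolyP ig /invpolyP ih FE]]].
have [_ gr gk] := ig (or_intror erefl); have [_ hr hk] := ih (or_intror erefl).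
split=> [a Ua u|u]; rewrite !FE.
  rewrite gr// hr// zc_rot conjcM !exprMn (unit_root_conjX en Ua).
  by rewrite mulrDr !mulrA.
by rewrite gk// hk// zc_kappa conjcD !conjcM !conjcX !conjc_real.
Qed.

Lemma qdform_coefficients w u (t : R) (q : R[i]) :
  [/\ qa w u = t - complex.Re q, qb w u = complex.Im q & qc w u = t + complex.Re q] <->
  half_trace w u = t /\ deviator w u = q.
Proof.
rewrite /half_trace /deviator; split=> [[-> -> ->]|[<- <-]] /=.
  split; first by field.
  by apply/eqP; rewrite eq_complex/=; apply/andP; split; apply/eqP; field.
by split=> //; field.
Qed.

Lemma polyfun_half_trace w : polyform w -> polyfun (half_trace w).
Proof. by move=> [pa pb pc]; apply: polyfunM; [exact: polyfunD | exact: polyfun_cst]. Qed.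

Lemma cpolyfun_deviator w : polyform w -> cpolyfun (deviator w).
Proof.
move=> [pa pb pc]; split=> //=.
by apply: polyfunM; [exact: polyfunB | exact: polyfun_cst].
Qed.

Lemma symmetric_formP n c e (s : R) w : symmetric_form n c e s w <->
  [/\ rot_equivariant n e (fun u => (half_trace w u)%:C%C), rot_equivariant n (e + 2) (deviator w),
    c = 1 -> forall u, half_trace w (kappa_x R *m u) = s * half_trace w u &
    c = 1 -> forall u, deviator w (kappa_x R *m u) = s%:C%C * conjc (deviator w u)].
Proof.
split=> [[rE kE]|[r1 r2 k1 k2]].
  by split=> [a Ua u|a Ua u|c1 u|c1 u]; [case: (rE a Ua u) | case: (rE a Ua u) | case: (kE c1 u) | case: (kE c1 u)].
by split=> [a Ua u|c1 u]; split; [exact: r1 | exact: r2 | exact: k1 | exact: k2].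
Qed.

Lemma rot_equivariant0 n (f : 'cV[R]_2 -> R) :
  rot_equivariant n 0 (fun u => (f u)%:C%C) <->
  forall a, unit_root n 1 a -> forall u, f (rot a *m u) = f u.
Proof.
split=> fE a Ua u; last by rewrite fE// mul1r.
by have := fE a Ua u; rewrite mul1r => -[].
Qed.

Lemma zcX m u : zc u ^+ m = Complex (reZ m u) (imZ m u).
Proof. by rewrite /reZ /imZ -/(zc u); case: (_ ^+ m). Qed.

Lemma conjc_zcX m u : conjc (zc u) ^+ m = Complex (reZ m u) (- imZ m u).
Proof. by rewrite -conjcX zcX. Qed.

Lemma zc2 u : zc u ^+ 2 =
  Complex (xcoord u ^+ 2 - ycoord u ^+ 2) (2 * xcoord u * ycoord u).
Proof.
rewrite expr2; apply/eqP; rewrite eq_complex/=.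
by apply/andP; split; apply/eqP; ring.
Qed.

Lemma zcS (g : R) (q : R[i]) :
  q * g%:C%C = Complex (complex.Re q * g) (complex.Im q * g).
Proof.
by case: q => x y; apply/eqP; rewrite eq_complex/=; apply/andP; split; apply/eqP; ring.
Qed.

Lemma invpoly_zero (G : set 'M[R]_2) : invpoly G (fun _ : 'cV[R]_2 => 0 : R).
Proof. exact: invpoly_cst. Qed.

Lemma cinvariant_complex n (f g : 'cV[R]_2 -> R) : invpoly (dih n 0) f ->
  invpoly (dih n 0) g -> cinvariant n (fun u => Complex (f u) (g u)).
Proof.
move=> [pf fG] [pg gG]; split=> // a Ua u.
by rewrite fG ?gG//; left; exists a.
Qed.

Lemma invpoly0_rot n (f : 'cV[R]_2 -> R) : invpoly (dih n 0) f ->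
  forall a, unit_root n 1 a -> forall u, f (rot a *m u) = f u.
Proof. by move=> /invpolyP[]//; left. Qed.

Lemma invpoly0I n (f : 'cV[R]_2 -> R) : polyfun f ->
  (forall a, unit_root n 1 a -> forall u, f (rot a *m u) = f u) -> invpoly (dih n 0) f.
Proof.
move=> pf fr; apply/invpolyP; [by left | split=> // /esym/eqP].
by rewrite oner_eq0.
Qed.

(** Packs up to six functions as the sequence p that the lists quantify over. *)
Definition family (p1 p2 p3 p4 p5 p6 : 'cV[R]_2 -> R) (i : nat) : 'cV[R]_2 -> R :=
  match i with
  | 1 => p1 | 2 => p2 | 3 => p3 | 4 => p4 | 5 => p5 | 6 => p6 | _ => fun=> 0%R
  end%N.

Lemma invpoly_family (G : set 'M[R]_2) p1 p2 p3 p4 p5 p6 :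
  invpoly G p1 -> invpoly G p2 -> invpoly G p3 -> invpoly G p4 ->
  invpoly G p5 -> invpoly G p6 -> forall i, invpoly G (family p1 p2 p3 p4 p5 p6 i).
Proof.
by move=> ? ? ? ? ? ? [|[|[|[|[|[|[|i]]]]]]]; rewrite /family; try by []; exact: invpoly_zero.
Qed.

Lemma SO2_forms : equivariant_forms (@SO2 R) (@SO2 R) (@SO2 R)
  (fun p w u => let x := xcoord u in let y := ycoord u in
    let p1 := p 1%N u in let p2 := p 2%N u in let p3 := p 3%N u in
    [/\ qa w u = p1 + (y ^+ 2 - x ^+ 2) * p2 + 2 * x * y * p3,
        qb w u = 2 * x * y * p2 + (x ^+ 2 - y ^+ 2) * p3
      & qc w u = p1 + (x ^+ 2 - y ^+ 2) * p2 - 2 * x * y * p3]).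
Proof.
rewrite SO2E; apply: equivariant_forms_trivial; [by left | move=> w pw].
have shape (p1 p2 p3 : R) u : [/\ qa w u = p1 + (ycoord u ^+ 2 - xcoord u ^+ 2) * p2 + 2 * xcoord u * ycoord u * p3,
        qb w u = 2 * xcoord u * ycoord u * p2 + (xcoord u ^+ 2 - ycoord u ^+ 2) * p3
      & qc w u = p1 + (xcoord u ^+ 2 - ycoord u ^+ 2) * p2 - 2 * xcoord u * ycoord u * p3] <->
    half_trace w u = p1 /\ deviator w u = zc u ^+ 2 * Complex p2 p3.
  rewrite -qdform_coefficients zc2 /=.
  by split=> -[-> -> ->]; split; ring.
rewrite symmetric_formP; split=> [[rT rQ _ _]|[p [ip pE]]].
  have [g [[pg ig] _ QE]] := circle_module (cpolyfun_deviator pw) rQ.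
  exists (family (half_trace w) (fun u => complex.Re (g u)) (fun u => complex.Im (g u)) (fun=> 0) (fun=> 0) (fun=> 0)).
  split=> [|u].
    apply: invpoly_family; try exact: invpoly_zero.
    - by apply: invpoly0I; [exact: polyfun_half_trace | apply/rot_equivariant0].
    - exact: cinvariant_Re.
    - exact: cinvariant_Im.
  by apply/shape; split=> //; rewrite QE /=; case: (g u).
have TE u : half_trace w u = p 1%N u by have /shape[] := pE u.
have QE u : deviator w u = zc u ^+ 2 * Complex (p 2%N u) (p 3%N u) by have /shape[] := pE u.
have [_ cI] := cinvariant_complex (ip 2%N) (ip 3%N).
split=> [||/esym/eqP|/esym/eqP]; rewrite ?oner_eq0//.
- by apply/rot_equivariant0 => a Ua u; rewrite !TE (invpoly0_rot (ip 1%N)).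
- by move=> a Ua u; rewrite !QE cI// zc_rot exprMn mulrA.
Qed.

(** Comparing with the equivariance of F under the reflection yields the real or
    imaginary part of g as the multiplier. *)
Lemma circle_reflection_part g F u :
  (forall u, g (kappa_x R *m u) = g u) -> (forall u, F u = zc u ^+ 2 * g u) ->
  conjc (F (kappa_x R *m u)) = zc u ^+ 2 * conjc (g u).
Proof. by move=> gk FE; rewrite FE gk zc_kappa conjcM conjcX conjcK. Qed.

Lemma O2_forms : equivariant_forms (@O2 R) (@O2 R) (@SO2 R)
  (fun p w u => let x := xcoord u in let y := ycoord u in
    let p1 := p 1%N u in let p2 := p 2%N u in
    [/\ qa w u = p1 + (y ^+ 2 - x ^+ 2) * p2,
        qb w u = 2 * x * y * p2
      & qc w u = p1 + (x ^+ 2 - y ^+ 2) * p2]).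
Proof.
rewrite SO2E O2E; apply: equivariant_forms_trivial; [by right | move=> w pw].
have shape (p1 p2 : R) u : [/\ qa w u = p1 + (ycoord u ^+ 2 - xcoord u ^+ 2) * p2,
        qb w u = 2 * xcoord u * ycoord u * p2
      & qc w u = p1 + (xcoord u ^+ 2 - ycoord u ^+ 2) * p2] <->
    half_trace w u = p1 /\ deviator w u = zc u ^+ 2 * p2%:C%C.
  rewrite -qdform_coefficients zcS zc2 /=.
  by split=> -[-> -> ->]; split; ring.
rewrite symmetric_formP; split=> [[rT rQ /(_ erefl) kT /(_ erefl) kQ]|[p [ip pE]]].
  have [g [[[pg _] ig] gk QE]] := circle_module (cpolyfun_deviator pw) rQ.
  exists (family (half_trace w) (fun u => complex.Re (g u)) (fun=> 0) (fun=> 0) (fun=> 0) (fun=> 0)).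
  split=> [|u].
    apply: invpoly_family; try exact: invpoly_zero.
    - apply/invpolyP; [by right | split; [exact: polyfun_half_trace | exact/rot_equivariant0 |]].
      by move=> _ u; rewrite kT mul1r.
    - apply/invpolyP; [by right | split=> [|a Ua u|_ u]; [exact: pg | by rewrite ig | by rewrite gk]].
  apply/shape; split=> //=; apply: (@mulfI _ 2); first by rewrite pnatr_eq0.
  have := circle_reflection_part u gk QE.
  rewrite kQ mul1r conjcK => Q2.
  by rewrite mulr_natl mulr2n [in LHS]QE -[X in _ + X = _]QE Q2 -mulrDr addcJ; ring.
have TE u : half_trace w u = p 1%N u by have /shape[] := pE u.
have QE u : deviator w u = zc u ^+ 2 * (p 2%N u)%:C%C by have /shape[] := pE u.
have /invpolyP[|_ r1 /(_ erefl) k1] := ip 1%N; first by right.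
have /invpolyP[|_ r2 /(_ erefl) k2] := ip 2%N; first by right.
split=> [|a Ua u|_ u|_ u].
- by apply/rot_equivariant0 => a Ua u; rewrite !TE r1.
- by rewrite !QE r2// zc_rot exprMn mulrA.
- by rewrite !TE k1 mul1r.
- by rewrite !QE k2 zc_kappa mul1r conjcM conjcX conjc_real.
Qed.

(** The half-trace is a polynomial in |z|^2, hence even under the reflection; as
    eta = -1 there, it vanishes. *)
Lemma O2_det_forms : equivariant_forms (@O2 R) (@SO2 R) (@O2 R)
  (fun p w u => let x := xcoord u in let y := ycoord u in
    let p1 := p 1%N u in
    [/\ qa w u = 2 * x * y * p1,
        qb w u = (x ^+ 2 - y ^+ 2) * p1
      & qc w u = - (2 * x * y * p1)]).
Proof.
rewrite SO2E O2E; apply: equivariant_forms_det => w pw.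
have shape (p1 : R) u : [/\ qa w u = 2 * xcoord u * ycoord u * p1,
        qb w u = (xcoord u ^+ 2 - ycoord u ^+ 2) * p1
      & qc w u = - (2 * xcoord u * ycoord u * p1)] <->
    half_trace w u = 0 /\ deviator w u = 'i%C * (zc u ^+ 2 * p1%:C%C).
  rewrite -qdform_coefficients zcS zc2 /=.
  by split=> -[-> -> ->]; split; ring.
rewrite symmetric_formP; split=> [[rT rQ /(_ erefl) kT /(_ erefl) kQ]|[p [ip pE]]].
  have [g [[[_ pg] ig] gk QE]] := circle_module (cpolyfun_deviator pw) rQ.
  have [t [_ tk TE]] := circle_module (cpolyfun_real (polyfun_half_trace pw)) rT.
  exists (family (fun u => complex.Im (g u)) (fun=> 0) (fun=> 0) (fun=> 0) (fun=> 0) (fun=> 0)).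
  split=> [|u].
    apply: invpoly_family; try exact: invpoly_zero.
    by apply/invpolyP; [by right | split=> [|a Ua u|_ u]; [exact: pg | rewrite ig | rewrite gk]].
  apply/shape; split=> /=.
    have : (half_trace w (kappa_x R *m u))%:C%C = (half_trace w u)%:C%C by rewrite !TE tk !expr0.
    by move/complexI; rewrite kT; lra.
  apply: (@mulfI _ 2); first by rewrite pnatr_eq0.
  have := circle_reflection_part u gk QE.
  rewrite kQ rmorphN1 mulN1r conjcN conjcK => Q2.
  rewrite mulr_natl mulr2n [in LHS]QE -[X in _ + X = _]QE -[deviator w u]opprK Q2 -mulrBr subcJ.
  by ring.
have TE u : half_trace w u = 0 by have /shape[] := pE u.
have QE u : deviator w u = 'i%C * (zc u ^+ 2 * (p 1%N u)%:C%C) by have /shape[] := pE u.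
have /invpolyP[|_ r1 /(_ erefl) k1] := ip 1%N; first by right.
have iJ : conjc ('i%C : R[i]) = - 'i%C by apply/eqP; rewrite eq_complex/= oppr0 !eqxx.
split=> [|a Ua u|_ u|_ u].
- by apply/rot_equivariant0 => a Ua u; rewrite !TE.
- by rewrite !QE r1// zc_rot exprMn; ring.
- by rewrite !TE mulr0.
- by rewrite !QE k1 zc_kappa 2!conjcM conjcX conjc_real iJ rmorphN1; ring.
Qed.

End Lists.

(** * Cyclic and dihedral groups *)

Section FiniteLists.
Variable R : realType.
Implicit Types (a b c : R[i]) (u : 'cV[R]_2) (w : qdform R) (F : 'cV[R]_2 -> R[i]).

Lemma Zrot_forms n : (3 <= n)%N ->
  equivariant_forms (@Zrot R n) (@Zrot R n) (@Zrot R n)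
    (fun p w u => let x := xcoord u in let y := ycoord u in
      let p1 := p 1%N u in let p2 := p 2%N u in let p3 := p 3%N u in
      let p4 := p 4%N u in let p5 := p 5%N u in
      let A1 := reZ (n - 2) u in
      let A2 := imZ (n - 2) u in
      [/\ qa w u = p1 + (y ^+ 2 - x ^+ 2) * p2 + 2 * x * y * p3 - A1 * p4 - A2 * p5,
          qb w u = 2 * x * y * p2 + (x ^+ 2 - y ^+ 2) * p3 + A1 * p5 - A2 * p4
        & qc w u = p1 + (x ^+ 2 - y ^+ 2) * p2 - 2 * x * y * p3 + A1 * p4 + A2 * p5]).
Proof.
move=> n3; have n0 : (0 < n)%N by exact: leq_trans n3.
have n2 : (0 + 2 <= n)%N by exact: leq_trans n3.
rewrite ZrotE//; apply: equivariant_forms_trivial; [by left | move=> w pw].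
have shape (p1 p2 p3 p4 p5 : R) u (x := xcoord u) (y := ycoord u)
    (A1 := reZ (n - 2) u) (A2 := imZ (n - 2) u) :
  [/\ qa w u = p1 + (y ^+ 2 - x ^+ 2) * p2 + 2 * x * y * p3 - A1 * p4 - A2 * p5,
          qb w u = 2 * x * y * p2 + (x ^+ 2 - y ^+ 2) * p3 + A1 * p5 - A2 * p4
        & qc w u = p1 + (x ^+ 2 - y ^+ 2) * p2 - 2 * x * y * p3 + A1 * p4 + A2 * p5] <->
    half_trace w u = p1 /\ deviator w u = zc u ^+ (0 + 2) * Complex p2 p3
      + conjc (zc u) ^+ (n - (0 + 2)) * Complex p4 p5.
  rewrite -qdform_coefficients zc2 conjc_zcX /=.
  by split=> -[-> -> ->]; split; rewrite /x /y /A1 /A2; ring.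
have pQ := cpolyfun_deviator pw.
rewrite symmetric_formP; split=> [[rT /(cyclic_formP n0 n2 pQ)[g [h [ig ih QE]]] _ _]|[p [ip pE]]].
  exists (family (half_trace w) (fun u => complex.Re (g u)) (fun u => complex.Im (g u))
    (fun u => complex.Re (h u)) (fun u => complex.Im (h u)) (fun=> 0)).
  split=> [|u].
    apply: invpoly_family; try exact: invpoly_zero.
    - by apply: invpoly0I; [exact: polyfun_half_trace | apply/rot_equivariant0].
    - exact: cinvariant_Re.
    - exact: cinvariant_Im.
    - exact: cinvariant_Re.
    - exact: cinvariant_Im.
  by apply/shape; split=> //; rewrite QE /=; case: (g u) => ? ?; case: (h u).
have TE u : half_trace w u = p 1%N u by have /shape[] := pE u.
split=> [||/esym/eqP|/esym/eqP]; rewrite ?oner_eq0//.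
- by apply/rot_equivariant0 => a Ua u; rewrite !TE (invpoly0_rot (ip 1%N)).
- apply/(cyclic_formP n0 n2 pQ).
  exists (fun u => Complex (p 2%N u) (p 3%N u)), (fun u => Complex (p 4%N u) (p 5%N u)).
  split; [exact: cinvariant_complex | exact: cinvariant_complex |].
  by move=> u; have /shape[] := pE u.
Qed.

Lemma Zrot_half_forms n : (4 <= n)%N -> ~~ odd n ->
  equivariant_forms (@Zrot R n) (@Zrot R n./2) (@Zrot R n./2)
    (fun p w u => let x := xcoord u in let y := ycoord u in
      let p1 := p 1%N u in let p2 := p 2%N u in let p3 := p 3%N u in
      let p4 := p 4%N u in let p5 := p 5%N u in let p6 := p 6%N u in
      let A3 := reZ (n./2 - 2) u in
      let A4 := imZ (n./2 - 2) u in
      let A5 := reZ n./2 u in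
      let A6 := imZ n./2 u in
      let A7 := reZ (n./2 + 2) u in
      let A8 := imZ (n./2 + 2) u in
      [/\ qa w u = - A3 * p1 - A4 * p2 + A5 * p3 - A7 * p4 + A8 * p5 + A6 * p6,
          qb w u = - A4 * p1 + A3 * p2 + A8 * p4 + A7 * p5
        & qc w u = A3 * p1 + A4 * p2 + A5 * p3 + A7 * p4 - A8 * p5 + A6 * p6]).
Proof.
move=> n4 /even_halfK nE; rewrite -{1}nE; set N := n./2.
have N2 : (2 <= N)%N by rewrite /N; lia.
have N0 : (0 < N)%N by exact: leq_trans N2.
have N20 : (0 < N.*2)%N by rewrite double_gt0.
have e1 : (N <= N.*2)%N by rewrite -addnn leq_addr.
have e2 : (N + 2 <= N.*2)%N by rewrite -addnn leq_add2l.
have d1 : (N.*2 - N = N)%N by rewrite -addnn addnK.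
have d2 : (N.*2 - (N + 2) = N - 2)%N by rewrite -addnn subnDl.
rewrite !ZrotE// -[X in equivariant_forms _ _ (dih _ X)]oppr0.
apply: equivariant_forms_half; [by left | move=> w pw].
have shape (p1 p2 p3 p4 p5 p6 : R) u
    (A3 := reZ (N - 2) u) (A4 := imZ (N - 2) u) (A5 := reZ N u)
    (A6 := imZ N u) (A7 := reZ (N + 2) u) (A8 := imZ (N + 2) u) :
  [/\ qa w u = - A3 * p1 - A4 * p2 + A5 * p3 - A7 * p4 + A8 * p5 + A6 * p6,
          qb w u = - A4 * p1 + A3 * p2 + A8 * p4 + A7 * p5
        & qc w u = A3 * p1 + A4 * p2 + A5 * p3 + A7 * p4 - A8 * p5 + A6 * p6] <->
    half_trace w u = A5 * p3 + A6 * p6 /\ deviator w u = zc u ^+ (N + 2) * Complex p4 p5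
      + conjc (zc u) ^+ (N.*2 - (N + 2)) * Complex p1 p2.
  rewrite -qdform_coefficients d2 conjc_zcX zcX /=.
  by split=> -[-> -> ->]; split; rewrite /A3 /A4 /A5 /A6 /A7 /A8; ring.
have pQ := cpolyfun_deviator pw; have pT := cpolyfun_real (polyfun_half_trace pw).
rewrite symmetric_formP; split=> [[/(cyclic_formP N20 e1 pT)[g [h [ig ih TE]]]
    /(cyclic_formP N20 e2 pQ)[g' [h' [ig' ih' QE]]] _ _]|[p [ip pE]]].
  exists (family (fun u => complex.Re (h' u)) (fun u => complex.Im (h' u))
    (fun u => complex.Re (g u + h u))
    (fun u => complex.Re (g' u)) (fun u => complex.Im (g' u))
    (fun u => complex.Im (conjc (g u) + h u))).
  split=> [|u].
    apply: invpoly_family.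
    - exact: cinvariant_Re.
    - exact: cinvariant_Im.
    - by apply: cinvariant_Re; exact: cinvariantD.
    - exact: cinvariant_Re.
    - exact: cinvariant_Im.
    - by apply: cinvariant_Im; apply: cinvariantD => //; exact: cinvariantJ.
  apply/shape; split=> /=; last by rewrite QE; case: (g' u) => ? ?; case: (h' u).
  have /(congr1 (@complex.Re R))/= -> := TE u.
  by rewrite d1 conjc_zcX zcX; case: (g u) => ? ?; case: (h u) => ? ? /=; ring.
split=> [||/esym/eqP|/esym/eqP]; rewrite ?oner_eq0//.
- apply/(cyclic_formP N20 e1 pT).
  exists (fun u => Complex (p 3%N u / 2) (- p 6%N u / 2)),
    (fun u => Complex (p 3%N u / 2) (p 6%N u / 2)).
  have half (f : 'cV[R]_2 -> R) (r : R) : invpoly (dih N.*2 0) f -> invpoly (dih N.*2 0) (fun u => f u * r).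
    by move=> fI; apply: invpolyM => //; exact: invpoly_cst.
  split.
  + apply: cinvariant_complex; first exact: half.
    by under eq_fun do rewrite mulNr -mulrN; exact: half.
  + by apply: cinvariant_complex; exact: half.
  + move=> u; have /shape[-> _] := pE u; rewrite d1 conjc_zcX zcX.
    by apply/eqP; rewrite eq_complex/=; apply/andP; split; apply/eqP; field.
- apply/(cyclic_formP N20 e2 pQ).
  exists (fun u => Complex (p 4%N u) (p 5%N u)), (fun u => Complex (p 1%N u) (p 2%N u)).
  split; [exact: cinvariant_complex | exact: cinvariant_complex |].
  by move=> u; have /shape[] := pE u.
Qed.

Lemma Dih_forms n : (3 <= n)%N ->
  equivariant_forms (Dih n (kappa_x R)) (Dih n (kappa_x R)) (@Zrot R n)
    (fun p w u => let x := xcoord u in let y := ycoord u in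
      let p1 := p 1%N u in let p2 := p 2%N u in let p3 := p 3%N u in
      let A1 := reZ (n - 2) u in
      let A2 := imZ (n - 2) u in
      [/\ qa w u = p1 + (y ^+ 2 - x ^+ 2) * p2 - A1 * p3,
          qb w u = 2 * x * y * p2 - A2 * p3
        & qc w u = p1 + (x ^+ 2 - y ^+ 2) * p2 + A1 * p3]).
Proof.
move=> n3; have n0 : (0 < n)%N by exact: leq_trans n3.
have n2 : (0 + 2 <= n)%N by exact: leq_trans n3.
rewrite ZrotE// -rf1 (DihE n0 (conjc1 _) (unit_root1 _ n)).
apply: equivariant_forms_trivial; [by right | move=> w pw].
have shape (p1 p2 p3 : R) u (x := xcoord u) (y := ycoord u)
    (A1 := reZ (n - 2) u) (A2 := imZ (n - 2) u) :
  [/\ qa w u = p1 + (y ^+ 2 - x ^+ 2) * p2 - A1 * p3,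
          qb w u = 2 * x * y * p2 - A2 * p3
        & qc w u = p1 + (x ^+ 2 - y ^+ 2) * p2 + A1 * p3] <->
    half_trace w u = p1 /\ deviator w u = zc u ^+ (0 + 2) * p2%:C%C
      + conjc (zc u) ^+ (n - (0 + 2)) * p3%:C%C.
  rewrite -qdform_coefficients !zcS zc2 conjc_zcX /=.
  by split=> -[-> -> ->]; split; rewrite /x /y /A1 /A2; ring.
have pQ := cpolyfun_deviator pw.
rewrite symmetric_formP; split=> [[rT rQ /(_ erefl) kT /(_ erefl) kQ]|[p [ip pE]]].
  have [g [h [ig ih QE]]] : dihedral_form n (0 + 2) (deviator w).
    by apply/(dihedral_formP n0 n2 pQ); split=> // u; rewrite kQ mul1r.
  exists (family (half_trace w) g h (fun=> 0) (fun=> 0) (fun=> 0)).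
  split=> [|u]; last by apply/shape; split=> //; rewrite QE.
  apply: invpoly_family; try exact: invpoly_zero; try by [].
  apply/invpolyP; [by right | split; [exact: polyfun_half_trace | exact/rot_equivariant0 |]].
  by move=> _ u; rewrite kT mul1r.
have TE u : half_trace w u = p 1%N u by have /shape[] := pE u.
have /invpolyP[|_ r1 /(_ erefl) k1] := ip 1%N; first by right.
have /(dihedral_formP n0 n2 pQ)[rQ kQ] : dihedral_form n (0 + 2) (deviator w).
  by exists (p 2%N), (p 3%N); split=> // u; have /shape[] := pE u.
split=> // [|_ u|_ u].
- by apply/rot_equivariant0 => a Ua u; rewrite !TE r1.
- by rewrite !TE k1 mul1r.
- by rewrite kQ mul1r.
Qed.

Lemma conjcI : conjc ('i%C : R[i]) = - 'i%C.
Proof. by apply/eqP; rewrite eq_complex/= oppr0 !eqxx. Qed.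

Lemma mulIi (q : R[i]) : 'i%C * (- 'i%C * q) = q.
Proof. by rewrite mulrA mulrN -expr2 sqr_i opprK mul1r. Qed.

(** Multiplication by -i turns F(conj u) = - conj (F(u)) into the rule
    F(conj u) = conj (F(u)) of the preceding case. *)
Lemma Dih_det_forms n : (3 <= n)%N ->
  equivariant_forms (Dih n (kappa_x R)) (@Zrot R n) (Dih n (kappa_x R))
    (fun p w u => let x := xcoord u in let y := ycoord u in
      let p1 := p 1%N u in let p2 := p 2%N u in let p3 := p 3%N u in
      let A1 := reZ (n - 2) u in
      let A2 := imZ (n - 2) u in
      let A9 := imZ n u in
      [/\ qa w u = 2 * x * y * p1 - A2 * p2 + A9 * p3,
          qb w u = (x ^+ 2 - y ^+ 2) * p1 + A1 * p2
        & qc w u = - (2 * x * y * p1) + A2 * p2 + A9 * p3]).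
Proof.
move=> n3; have n0 : (0 < n)%N by exact: leq_trans n3.
have n2 : (0 + 2 <= n)%N by exact: leq_trans n3.
rewrite ZrotE// -rf1 (DihE n0 (conjc1 _) (unit_root1 _ n)).
apply: equivariant_forms_det => w pw.
have shape (p1 p2 p3 : R) u (x := xcoord u) (y := ycoord u)
    (A1 := reZ (n - 2) u) (A2 := imZ (n - 2) u) (A9 := imZ n u) :
  [/\ qa w u = 2 * x * y * p1 - A2 * p2 + A9 * p3,
          qb w u = (x ^+ 2 - y ^+ 2) * p1 + A1 * p2
        & qc w u = - (2 * x * y * p1) + A2 * p2 + A9 * p3] <->
    half_trace w u = A9 * p3 /\ deviator w u = 'i%C * (zc u ^+ (0 + 2) * p1%:C%C
      + conjc (zc u) ^+ (n - (0 + 2)) * p2%:C%C).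
  rewrite -qdform_coefficients !zcS zc2 conjc_zcX /=.
  by split=> -[-> -> ->]; split; rewrite /x /y /A1 /A2 /A9; ring.
have pQ : cpolyfun (fun u => - 'i%C * deviator w u).
  by apply: cpolyfunM; [exact: cpolyfun_cst | exact: cpolyfun_deviator].
have pT : cpolyfun (fun u => - 'i%C * (half_trace w u)%:C%C).
  by apply: cpolyfunM; [exact: cpolyfun_cst | apply: cpolyfun_real; exact: polyfun_half_trace].
rewrite symmetric_formP; split=> [[rT rQ /(_ erefl) kT /(_ erefl) kQ]|[p [ip pE]]].
  have [g [h [ig ih QE]]] : dihedral_form n (0 + 2) (fun u => - 'i%C * deviator w u).
    apply/(dihedral_formP n0 n2 pQ); split=> [a Ua u|u].
      by rewrite rQ// mulrCA.
    by rewrite kQ conjcM conjcN conjcI rmorphN1; ring.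
  have [g' [h' [_ ih' TE]]] : dihedral_form n 0 (fun u => - 'i%C * (half_trace w u)%:C%C).
    apply/(dihedral_formP n0 (leq0n n) pT); split=> [a Ua u|u].
      by rewrite rT// mulrCA.
    by rewrite kT conjcM conjcN conjcI rmorphM rmorphN1 conjc_real; ring.
  exists (family g h h' (fun=> 0) (fun=> 0) (fun=> 0)).
  split=> [|u].
    by apply: invpoly_family; try exact: invpoly_zero; try by [].
  apply/shape; split=> /=; last by rewrite -QE mulIi.
  have /(congr1 (@complex.Im R)) := TE u.
  rewrite expr0 mul1r subn0 conjc_zcX zcS /=.
  by lra.
have /invpolyP[|_ r3 /(_ erefl) k3] := ip 3%N; first by right.
have TE u : half_trace w u = imZ n u * p 3%N u by have /shape[] := pE u.
have imE u : imZ n u = complex.Im (zc u ^+ n) by [].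
have /(dihedral_formP n0 n2 pQ)[rQ kQ] : dihedral_form n (0 + 2) (fun u => - 'i%C * deviator w u).
  exists (p 1%N), (p 2%N); split=> // u; have /shape[_ ->] := pE u.
  by rewrite mulNr -mulrN -mulNr mulIi.
split=> // [|a Ua u|_ u|_ u].
- apply/rot_equivariant0 => a Ua u.
  by rewrite !TE r3// !imE zc_rot exprMn; case: Ua => _ ->; rewrite mul1r.
- by rewrite -[LHS]mulIi rQ// mulrCA mulIi.
- by rewrite !TE k3 !imE zc_kappa -conjcX; case: (_ ^+ n) => ? ? /=; ring.
- rewrite -[LHS]mulIi kQ conjcM conjcN conjcI rmorphN1 opprK mulrA -expr2 sqr_i.
  by [].
Qed.

(** The reflections in the kernel of lambda have parameters b with b ^+ (n/2) = -1.
    One of them is -1 when n/2 is odd; the root of unity of order n always is. *)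
Lemma Dih_half_forms n : (4 <= n)%N -> ~~ odd n ->
  equivariant_forms (Dih n (kappa_x R)) (Dih n./2 (kappa_x R))
    (if odd n./2 then Dih n./2 (kappa_y R)
     else Dih n./2 (rotation (2 * pi / n%:R) *m kappa_x R))
    (fun p w u => let x := xcoord u in let y := ycoord u in
      let p1 := p 1%N u in let p2 := p 2%N u in let p3 := p 3%N u in
      let A3 := reZ (n./2 - 2) u in
      let A4 := imZ (n./2 - 2) u in
      let A5 := reZ n./2 u in
      let A7 := reZ (n./2 + 2) u in
      let A8 := imZ (n./2 + 2) u in
      [/\ qa w u = - A3 * p1 + A5 * p2 - A7 * p3,
          qb w u = - A4 * p1 + A8 * p3
        & qc w u = A3 * p1 + A5 * p2 + A7 * p3]).
Proof.
move=> n4 /even_halfK nE.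
have N2 : (2 <= n./2)%N by lia.
have N0 : (0 < n./2)%N by exact: leq_trans N2.
have N1J : conjc (-1 : R[i]) = -1 by exact: rmorphN1.
have -> : (if odd n./2 then Dih n./2 (kappa_y R)
     else Dih n./2 (rotation (2 * pi / n%:R) *m kappa_x R)) = dih n./2 (-1).
  case: ifP => [oN|_].
    rewrite -rfN1 (DihE N0 N1J)//; split; first by rewrite N1J mulrNN mulr1.
    by rewrite -signr_odd oN.
  rewrite rotation_cis -/(root_of_unity R n) -rf1 rot_rf mulr1 (DihE N0 N1J)//.
  split; first exact: cis_unit.
  by rewrite -[in root_of_unity _ _]nE root_of_unity_half.
rewrite -{1}nE; move: (n./2) N2 N0 => {n n4 nE}N N2 N0.
have N20 : (0 < N.*2)%N by rewrite double_gt0.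
have e1 : (N <= N.*2)%N by rewrite -addnn leq_addr.
have e2 : (N + 2 <= N.*2)%N by rewrite -addnn leq_add2l.
have d1 : (N.*2 - N = N)%N by rewrite -addnn addnK.
have d2 : (N.*2 - (N + 2) = N - 2)%N by rewrite -addnn subnDl.
rewrite -rf1 (DihE N0 (conjc1 _) (unit_root1 _ N)) (DihE N20 (conjc1 _) (unit_root1 _ N.*2)).
apply: equivariant_forms_half; [by right | move=> w pw].
have shape (p1 p2 p3 : R) u
    (A3 := reZ (N - 2) u) (A4 := imZ (N - 2) u) (A5 := reZ N u)
    (A7 := reZ (N + 2) u) (A8 := imZ (N + 2) u) :
  [/\ qa w u = - A3 * p1 + A5 * p2 - A7 * p3,
          qb w u = - A4 * p1 + A8 * p3
        & qc w u = A3 * p1 + A5 * p2 + A7 * p3] <->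
    half_trace w u = A5 * p2 /\ deviator w u = zc u ^+ (N + 2) * p3%:C%C
      + conjc (zc u) ^+ (N.*2 - (N + 2)) * p1%:C%C.
  rewrite -qdform_coefficients !zcS d2 conjc_zcX zcX /=.
  by split=> -[-> -> ->]; split; rewrite /A3 /A4 /A5 /A7 /A8; ring.
have pQ := cpolyfun_deviator pw; have pT := cpolyfun_real (polyfun_half_trace pw).
rewrite symmetric_formP; split=> [[rT rQ /(_ erefl) kT /(_ erefl) kQ]|[p [ip pE]]].
  have [g [h [ig ih QE]]] : dihedral_form N.*2 (N + 2) (deviator w).
    by apply/(dihedral_formP N20 e2 pQ); split=> // u; rewrite kQ mul1r.
  have [g' [h' [ig' ih' TE]]] : dihedral_form N.*2 N (fun u => (half_trace w u)%:C%C).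
    by apply/(dihedral_formP N20 e1 pT); split=> // u; rewrite kT mul1r conjc_real.
  exists (family h (fun u => g' u + h' u) g (fun=> 0) (fun=> 0) (fun=> 0)).
  split=> [|u].
    by apply: invpoly_family; try exact: invpoly_zero; try exact: invpolyD.
  apply/shape; split=> /=; last by rewrite QE.
  have /(congr1 (@complex.Re R))/= -> := TE u.
  by rewrite d1 conjc_zcX zcX /=; ring.
have TE u : half_trace w u = reZ N u * p 2%N u by have /shape[] := pE u.
have /(dihedral_formP N20 e2 pQ)[rQ kQ] : dihedral_form N.*2 (N + 2) (deviator w).
  by exists (p 3%N), (p 1%N); split=> // u; have /shape[] := pE u.
have /(dihedral_formP N20 e1 pT)[rT kT] : dihedral_form N.*2 N (fun u => (half_trace w u)%:C%C).
  have half : invpoly (dih N.*2 1) (fun u => p 2%N u * 2^-1).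
    by apply: invpolyM => //; exact: invpoly_cst.
  exists (fun u => p 2%N u * 2^-1), (fun u => p 2%N u * 2^-1); split=> // u.
  rewrite TE d1 !zcS conjc_zcX zcX.
  by apply/eqP; rewrite eq_complex/=; apply/andP; split; apply/eqP; field.
split=> // _ u; last by rewrite kQ mul1r.
by have := kT u; rewrite conjc_real mul1r => /complexI.
Qed.

End FiniteLists.

(** * Groups of order two and four *)

Section SmallLists.
Variable R : realType.
Implicit Types (a b c : R[i]) (u : 'cV[R]_2) (w : qdform R) (f g : 'cV[R]_2 -> R).

Lemma coords_kappa u : (xcoord (kappa_x R *m u) = xcoord u) *
  (ycoord (kappa_x R *m u) = - ycoord u).
Proof.
suff : kappa_x R *m u = vec2 (xcoord u) (- ycoord u) by move=> ->; rewrite !vec2E.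
by rewrite -{1}(vec2K u) mulmx2_vec; apply/vec2P; split; ring.
Qed.

Lemma coordsN u : (xcoord (- u) = - xcoord u) * (ycoord (- u) = - ycoord u).
Proof. by rewrite /xcoord /ycoord !mxE. Qed.

Lemma unit_root1P a : unit_root 1 1 a -> a = 1.
Proof. by move=> [_]; rewrite expr1. Qed.

Lemma rotN1_vec u : rot (-1 : R[i]) *m u = - u.
Proof. by rewrite rotN1 mulNmx mul1mx. Qed.

Lemma invpoly_dih1 f : invpoly (dih 1 1) f <->
  polyfun f /\ forall u, f (kappa_x R *m u) = f u.
Proof.
split=> [/invpolyP[|pf _ /(_ erefl)]//|[pf fk]]; first by right.
apply/invpolyP; [by right | split=> // a /unit_root1P-> u].
by rewrite rot1 mul1mx.
Qed.

Lemma unit_rootN1_2 : unit_root 2 1 (-1 : R[i]).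
Proof. by split; rewrite ?rmorphN1 ?mulrNN ?mulr1 ?sqrrN ?expr1n. Qed.

Lemma invpoly_dih2 f : invpoly (dih 2 1) f <->
  [/\ polyfun f, forall u, f (kappa_x R *m u) = f u & forall u, f (- u) = f u].
Proof.
split=> [/invpolyP[|pf fr /(_ erefl) fk]|[pf fk fN]]; first by right.
  by split=> // u; rewrite -rotN1_vec fr//; exact: unit_rootN1_2.
apply/invpolyP; [by right | split=> // a [_ /sqrn1[->|->]] u].
  by rewrite rot1 mul1mx.
by rewrite rotN1_vec.
Qed.

(** The functions of this shape are closed under products because x^2 and y^2 are
    invariant. *)
Lemma polyfun_parity f : polyfun f -> exists f00 f10 f01 f11,
  [/\ invpoly (dih 2 1) f00, invpoly (dih 2 1) f10, invpoly (dih 2 1) f01,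
      invpoly (dih 2 1) f11 &
  forall u, f u = f00 u + xcoord u * f10 u + ycoord u * f01 u + xcoord u * ycoord u * f11 u].
Proof.
have i0 (r : R) : invpoly (dih 2 1) (fun _ : 'cV[R]_2 => r) by exact: invpoly_cst.
have ixx : invpoly (dih 2 1) (fun u : 'cV[R]_2 => xcoord u * xcoord u).
  apply/invpoly_dih2; split=> [|u|u]; rewrite ?coords_kappa ?coordsN ?mulrNN//.
  by apply: polyfunM; exact: polyfun_x.
have iyy : invpoly (dih 2 1) (fun u : 'cV[R]_2 => ycoord u * ycoord u).
  apply/invpoly_dih2; split=> [|u|u]; rewrite ?coords_kappa ?coordsN ?mulrNN//.
  by apply: polyfunM; exact: polyfun_y.
move: f; apply: polyfun_ind => [r|||f g|f g].
- exists (fun=> r), (fun=> 0), (fun=> 0), (fun=> 0); split; [exact: i0 | exact: i0 | exact: i0 | exact: i0 |].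
  by move=> u; ring.
- exists (fun=> 0), (fun=> 1), (fun=> 0), (fun=> 0); split; [exact: i0 | exact: i0 | exact: i0 | exact: i0 |].
  by move=> u; ring.
- exists (fun=> 0), (fun=> 0), (fun=> 1), (fun=> 0); split; [exact: i0 | exact: i0 | exact: i0 | exact: i0 |].
  by move=> u; ring.
- move=> [f00 [f10 [f01 [f11 [i00 i10 i01 i11 fE]]]]] [g00 [g10 [g01 [g11 [j00 j10 j01 j11 gE]]]]].
  exists (fun u => f00 u + g00 u), (fun u => f10 u + g10 u), (fun u => f01 u + g01 u), (fun u => f11 u + g11 u).
  split; [exact: invpolyD | exact: invpolyD | exact: invpolyD | exact: invpolyD |].
  by move=> u; rewrite fE gE; ring.
- move=> [f00 [f10 [f01 [f11 [i00 i10 i01 i11 fE]]]]] [g00 [g10 [g01 [g11 [j00 j10 j01 j11 gE]]]]].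
  have [X iX XE] : exists2 X, invpoly (dih 2 1) X & forall u, X u = xcoord u * xcoord u.
    by eexists; [exact: ixx|].
  have [Y iY YE] : exists2 Y, invpoly (dih 2 1) Y & forall u, Y u = ycoord u * ycoord u.
    by eexists; [exact: iyy|].
  exists (fun u => (f00 u * g00 u + X u * (f10 u * g10 u)) + (Y u * (f01 u * g01 u) + X u * (Y u * (f11 u * g11 u)))),
    (fun u => (f00 u * g10 u + f10 u * g00 u) + (Y u * (f01 u * g11 u) + Y u * (f11 u * g01 u))),
    (fun u => (f00 u * g01 u + f01 u * g00 u) + (X u * (f10 u * g11 u) + X u * (f11 u * g10 u))),
    (fun u => (f00 u * g11 u + f11 u * g00 u) + (f10 u * g01 u + f01 u * g10 u)).
  by split; last (move=> u; rewrite fE gE !XE !YE; ring);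
    do ?[apply: invpolyD | apply: invpolyM].
Qed.

Lemma invpoly_dih12 f : invpoly (dih 2 1) f -> invpoly (dih 1 1) f.
Proof. by move=> /invpoly_dih2[pf fk _]; apply/invpoly_dih1. Qed.

(** The values at the images of u under the group are linear equations in the four
    components at u, and leave only those with the right parity. *)
Lemma polyfun_odd_y f : polyfun f -> (forall u, f (kappa_x R *m u) = - f u) ->
  exists2 g, invpoly (dih 1 1) g & forall u, f u = ycoord u * g u.
Proof.
move=> /polyfun_parity[f00 [f10 [f01 [f11 [i00 i10 i01 i11 fE]]]]] fk.
have /invpoly_dih2[_ k00 _] := i00; have /invpoly_dih2[_ k10 _] := i10.
have /invpoly_dih2[_ k01 _] := i01; have /invpoly_dih2[_ k11 _] := i11.
exists (fun u => f01 u + xcoord u * f11 u).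
  apply: invpolyD; first exact: invpoly_dih12.
  apply: invpolyM; last exact: invpoly_dih12.
  by apply/invpoly_dih1; split=> [|u]; [exact: polyfun_x | rewrite coords_kappa].
move=> u; have := fk u; rewrite !fE !coords_kappa k00 k10 k01 k11.
by rewrite !(mulrN, mulNr); lra.
Qed.

Lemma polyfun_odd_x f : polyfun f -> (forall u, f (kappa_x R *m u) = f u) ->
  (forall u, f (- u) = - f u) ->
  exists2 g, invpoly (dih 2 1) g & forall u, f u = xcoord u * g u.
Proof.
move=> /polyfun_parity[f00 [f10 [f01 [f11 [i00 i10 i01 i11 fE]]]]] fk fN.
have /invpoly_dih2[_ k00 n00] := i00; have /invpoly_dih2[_ k10 n10] := i10.
have /invpoly_dih2[_ k01 n01] := i01; have /invpoly_dih2[_ k11 n11] := i11.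
exists f10 => // u; have := fk u; have := fk (- u); have := fN u.
rewrite !fE !coords_kappa !coordsN !(k00, k10, k01, k11, n00, n10, n01, n11).
by rewrite !(mulrN, mulNr); lra.
Qed.

Lemma polyfun_even_x_odd_y f : polyfun f -> (forall u, f (kappa_x R *m u) = - f u) ->
  (forall u, f (- u) = - f u) ->
  exists2 g, invpoly (dih 2 1) g & forall u, f u = ycoord u * g u.
Proof.
move=> /polyfun_parity[f00 [f10 [f01 [f11 [i00 i10 i01 i11 fE]]]]] fk fN.
have /invpoly_dih2[_ k00 n00] := i00; have /invpoly_dih2[_ k10 n10] := i10.
have /invpoly_dih2[_ k01 n01] := i01; have /invpoly_dih2[_ k11 n11] := i11.
exists f01 => // u; have := fk u; have := fk (- u); have := fN u.
rewrite !fE !coords_kappa !coordsN !(k00, k10, k01, k11, n00, n10, n01, n11).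
by rewrite !(mulrN, mulNr); lra.
Qed.

Lemma polyfun_odd_xy f : polyfun f -> (forall u, f (kappa_x R *m u) = - f u) ->
  (forall u, f (- u) = f u) ->
  exists2 g, invpoly (dih 2 1) g & forall u, f u = xcoord u * ycoord u * g u.
Proof.
move=> /polyfun_parity[f00 [f10 [f01 [f11 [i00 i10 i01 i11 fE]]]]] fk fN.
have /invpoly_dih2[_ k00 n00] := i00; have /invpoly_dih2[_ k10 n10] := i10.
have /invpoly_dih2[_ k01 n01] := i01; have /invpoly_dih2[_ k11 n11] := i11.
exists f11 => // u; have := fk u; have := fk (- u); have := fN u.
rewrite !fE !coords_kappa !coordsN !(k00, k10, k01, k11, n00, n10, n01, n11).
by rewrite !(mulrN, mulNr); lra.
Qed.

Lemma symmetric_kappa (s : R) w u :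
  (half_trace w (kappa_x R *m u) = s * half_trace w u /\
   deviator w (kappa_x R *m u) = s%:C%C * conjc (deviator w u)) <->
  [/\ qa w (kappa_x R *m u) = s * qa w u, qb w (kappa_x R *m u) = - s * qb w u
    & qc w (kappa_x R *m u) = s * qc w u].
Proof.
rewrite -qdform_coefficients /half_trace /deviator /=.
by split=> -[-> -> ->]; split; field.
Qed.

Lemma symmetric_neg (s : R) w u :
  (half_trace w (- u) = s * half_trace w u /\ deviator w (- u) = s%:C%C * deviator w u) <->
  [/\ qa w (- u) = s * qa w u, qb w (- u) = s * qb w u & qc w (- u) = s * qc w u].
Proof.
rewrite -qdform_coefficients /half_trace /deviator /=.
by split=> -[-> -> ->]; split; field.
Qed.

Lemma symmetric_form_dih1 (s : R) w : symmetric_form 1 1 0 s w <-> forall u,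
  [/\ qa w (kappa_x R *m u) = s * qa w u, qb w (kappa_x R *m u) = - s * qb w u
    & qc w (kappa_x R *m u) = s * qc w u].
Proof.
split=> [[_ /(_ erefl) kE] u|kE]; first exact/symmetric_kappa.
split=> [a /unit_root1P-> u|_ u]; last exact/symmetric_kappa.
by rewrite rot1 mul1mx !expr1n !mul1r.
Qed.

Lemma symmetric_form_dih2 e (s : R) w : symmetric_form 2 1 e s w <-> forall u,
  [/\ qa w (kappa_x R *m u) = s * qa w u, qb w (kappa_x R *m u) = - s * qb w u
    & qc w (kappa_x R *m u) = s * qc w u] /\
  [/\ qa w (- u) = (-1) ^+ e * qa w u, qb w (- u) = (-1) ^+ e * qb w u
    & qc w (- u) = (-1) ^+ e * qc w u].
Proof.
have signC k : (-1) ^+ k = ((-1) ^+ k)%:C%C :> R[i] by rewrite rmorphXn rmorphN1.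
split=> [[rE /(_ erefl) kE] u|sE].
  split; first exact/symmetric_kappa.
  apply/symmetric_neg; have [] := rE (-1) unit_rootN1_2 u; rewrite rotN1_vec.
  by rewrite exprD sqrrN expr1n mulr1 signC -rmorphM => /complexI.
split=> [a [_ /sqrn1[->|->]] u|_ u]; last by apply/symmetric_kappa; case: (sE u).
  by rewrite rot1 mul1mx !expr1n !mul1r.
have [_ /symmetric_neg[TE QE]] := sE u.
by rewrite rotN1_vec exprD sqrrN expr1n mulr1 signC -rmorphM TE.
Qed.

Lemma Z2_forms : equivariant_forms (generated [set kappa_x R]) (generated [set kappa_x R]) [set 1%:M]
  (fun p w u => let x := xcoord u in let y := ycoord u in
    let p1 := p 1%N u in let p2 := p 2%N u in let p3 := p 3%N u in
    [/\ qa w u = p1, qb w u = y * p2 & qc w u = p3]).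
Proof.
have -> : [set 1%:M] = dih 1 0 :> set 'M[R]_2.
  apply/seteqP; split=> g; first by move=> ->; left; exists 1; [exact: unit_root1 | rewrite rot1].
  by move=> [[a /unit_root1P-> ->]|[b /unit_root0]//]; rewrite rot1.
rewrite generated_kappa_x; apply: equivariant_forms_trivial; first by right.
move=> w [pa pb pc]; rewrite symmetric_form_dih1; split=> [kE|[p [ip pE]] u].
  have [|g ig gE] := polyfun_odd_y pb; first by move=> u; have [_ -> _] := kE u; rewrite mulN1r.
  exists (family (qa w) g (qc w) (fun=> 0) (fun=> 0) (fun=> 0)).
  split=> [|u]; last by split=> //=; exact: gE.
  apply: invpoly_family; try exact: invpoly_zero; try by [].
    by apply/invpoly_dih1; split=> // u; have [-> _ _] := kE u; rewrite mul1r.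
  by apply/invpoly_dih1; split=> // u; have [_ _ ->] := kE u; rewrite mul1r.
have /invpoly_dih1[_ k1] := ip 1%N; have /invpoly_dih1[_ k2] := ip 2%N.
have /invpoly_dih1[_ k3] := ip 3%N.
have [-> -> ->] := pE u; have [-> -> ->] := pE (kappa_x R *m u).
by rewrite k1 k2 k3 coords_kappa; split; ring.
Qed.

Lemma Z2_det_forms : equivariant_forms (generated [set kappa_x R]) [set 1%:M] (generated [set kappa_x R])
  (fun p w u => let x := xcoord u in let y := ycoord u in
    let p1 := p 1%N u in let p2 := p 2%N u in let p3 := p 3%N u in
    [/\ qa w u = y * p1, qb w u = p2 & qc w u = y * p3]).
Proof.
have -> : [set 1%:M] = dih 1 0 :> set 'M[R]_2.
  apply/seteqP; split=> g; first by move=> ->; left; exists 1; [exact: unit_root1 | rewrite rot1].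
  by move=> [[a /unit_root1P-> ->]|[b /unit_root0]//]; rewrite rot1.
rewrite generated_kappa_x; apply: equivariant_forms_det.
move=> w [pa pb pc]; rewrite symmetric_form_dih1; split=> [kE|[p [ip pE]] u].
  have [|g ig gE] := polyfun_odd_y pa; first by move=> u; have [-> _ _] := kE u; rewrite mulN1r.
  have [|h ih hE] := polyfun_odd_y pc; first by move=> u; have [_ _ ->] := kE u; rewrite mulN1r.
  exists (family g (qb w) h (fun=> 0) (fun=> 0) (fun=> 0)).
  split=> [|u]; last by split.
  apply: invpoly_family; try exact: invpoly_zero; try by [].
  by apply/invpoly_dih1; split=> // u; have [_ -> _] := kE u; rewrite opprK mul1r.
have /invpoly_dih1[_ k1] := ip 1%N; have /invpoly_dih1[_ k2] := ip 2%N.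
have /invpoly_dih1[_ k3] := ip 3%N.
have [-> -> ->] := pE u; have [-> -> ->] := pE (kappa_x R *m u).
by rewrite k1 k2 k3 coords_kappa; split; ring.
Qed.

Lemma Z2Z2_forms : equivariant_forms (generated [set kappa_x R; kappa_y R])
  (generated [set kappa_x R; kappa_y R]) (generated [set - 1%:M])
  (fun p w u => let x := xcoord u in let y := ycoord u in
    let p1 := p 1%N u in let p2 := p 2%N u in let p3 := p 3%N u in
    [/\ qa w u = p1, qb w u = x * y * p2 & qc w u = p3]).
Proof.
rewrite generated_kappa_xy generatedN1; apply: equivariant_forms_trivial; first by right.
move=> w [pa pb pc]; rewrite symmetric_form_dih2; split=> [sE|[p [ip pE]] u].
  have kE u := (sE u).1; have nE u := (sE u).2.
  have [||g ig gE] := polyfun_odd_xy pb.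
  - by move=> u; have [_ -> _] := kE u; rewrite mulN1r.
  - by move=> u; have [_ -> _] := nE u; rewrite mul1r.
  exists (family (qa w) g (qc w) (fun=> 0) (fun=> 0) (fun=> 0)).
  split=> [|u]; last by split=> //=; exact: gE.
  apply: invpoly_family; try exact: invpoly_zero; try by [].
    by apply/invpoly_dih2; split=> // u; [have [-> _ _] := kE u | have [-> _ _] := nE u]; rewrite mul1r.
  by apply/invpoly_dih2; split=> // u; [have [_ _ ->] := kE u | have [_ _ ->] := nE u]; rewrite mul1r.
have /invpoly_dih2[_ k1 n1] := ip 1%N; have /invpoly_dih2[_ k2 n2] := ip 2%N.
have /invpoly_dih2[_ k3 n3] := ip 3%N.
have [-> -> ->] := pE u; have [-> -> ->] := pE (kappa_x R *m u); have [-> -> ->] := pE (- u).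
by rewrite k1 k2 k3 n1 n2 n3 !coords_kappa !coordsN; split; split; ring.
Qed.

Lemma Z2Z2_det_forms : equivariant_forms (generated [set kappa_x R; kappa_y R])
  (generated [set - 1%:M]) (generated [set kappa_x R; kappa_y R])
  (fun p w u => let x := xcoord u in let y := ycoord u in
    let p1 := p 1%N u in let p2 := p 2%N u in let p3 := p 3%N u in
    [/\ qa w u = x * y * p1, qb w u = p2 & qc w u = x * y * p3]).
Proof.
rewrite generated_kappa_xy generatedN1; apply: equivariant_forms_det.
move=> w [pa pb pc]; rewrite symmetric_form_dih2; split=> [sE|[p [ip pE]] u].
  have kE u := (sE u).1; have nE u := (sE u).2.
  have [||g ig gE] := polyfun_odd_xy pa.
  - by move=> u; have [-> _ _] := kE u; rewrite mulN1r.
  - by move=> u; have [-> _ _] := nE u; rewrite mul1r.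
  have [||h ih hE] := polyfun_odd_xy pc.
  - by move=> u; have [_ _ ->] := kE u; rewrite mulN1r.
  - by move=> u; have [_ _ ->] := nE u; rewrite mul1r.
  exists (family g (qb w) h (fun=> 0) (fun=> 0) (fun=> 0)).
  split=> [|u]; last by split.
  apply: invpoly_family; try exact: invpoly_zero; try by [].
  by apply/invpoly_dih2; split=> // u; [have [_ -> _] := kE u | have [_ -> _] := nE u]; rewrite ?opprK mul1r.
have /invpoly_dih2[_ k1 n1] := ip 1%N; have /invpoly_dih2[_ k2 n2] := ip 2%N.
have /invpoly_dih2[_ k3 n3] := ip 3%N.
have [-> -> ->] := pE u; have [-> -> ->] := pE (kappa_x R *m u); have [-> -> ->] := pE (- u).
by rewrite k1 k2 k3 n1 n2 n3 !coords_kappa !coordsN; split; split; ring.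
Qed.

Lemma Z2Z2_half_forms : equivariant_forms (generated [set kappa_x R; kappa_y R])
  (generated [set kappa_x R]) (generated [set kappa_y R])
  (fun p w u => let x := xcoord u in let y := ycoord u in
    let p1 := p 1%N u in let p2 := p 2%N u in let p3 := p 3%N u in
    [/\ qa w u = x * p1, qb w u = y * p2 & qc w u = x * p3]).
Proof.
rewrite generated_kappa_xy generated_kappa_x generated_kappa_y.
apply: (@equivariant_forms_half _ 1); first by right.
move=> w [pa pb pc]; rewrite symmetric_form_dih2; split=> [sE|[p [ip pE]] u].
  have kE u := (sE u).1; have nE u := (sE u).2.
  have [||g1 ig1 gE1] := polyfun_odd_x pa.
  - by move=> u; have [-> _ _] := kE u; rewrite mul1r.
  - by move=> u; have [-> _ _] := nE u; rewrite mulN1r.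
  have [||g2 ig2 gE2] := polyfun_even_x_odd_y pb.
  - by move=> u; have [_ -> _] := kE u; rewrite mulN1r.
  - by move=> u; have [_ -> _] := nE u; rewrite mulN1r.
  have [||g3 ig3 gE3] := polyfun_odd_x pc.
  - by move=> u; have [_ _ ->] := kE u; rewrite mul1r.
  - by move=> u; have [_ _ ->] := nE u; rewrite mulN1r.
  exists (family g1 g2 g3 (fun=> 0) (fun=> 0) (fun=> 0)).
  split=> [|u]; last by split=> /=.
  by apply: invpoly_family; try exact: invpoly_zero; try by [].
have /invpoly_dih2[_ k1 n1] := ip 1%N; have /invpoly_dih2[_ k2 n2] := ip 2%N.
have /invpoly_dih2[_ k3 n3] := ip 3%N.
have [-> -> ->] := pE u; have [-> -> ->] := pE (kappa_x R *m u); have [-> -> ->] := pE (- u).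
by rewrite k1 k2 k3 n1 n2 n3 !coords_kappa !coordsN expr1; split; split; ring.
Qed.

End SmallLists.

(** * The list *)

Theorem mainTheorem3 (R : realType) :
  (equivariant_forms (@SO2 R) (@SO2 R) (@SO2 R)
      (fun p w u => let x := xcoord u in let y := ycoord u in
        let p1 := p 1%N u in let p2 := p 2%N u in let p3 := p 3%N u in
        [/\ qa w u = p1 + (y ^+ 2 - x ^+ 2) * p2 + 2 * x * y * p3,
            qb w u = 2 * x * y * p2 + (x ^+ 2 - y ^+ 2) * p3
          & qc w u = p1 + (x ^+ 2 - y ^+ 2) * p2 - 2 * x * y * p3])) /\
  (equivariant_forms (@O2 R) (@O2 R) (@SO2 R)
      (fun p w u => let x := xcoord u in let y := ycoord u in
        let p1 := p 1%N u in let p2 := p 2%N u in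
        [/\ qa w u = p1 + (y ^+ 2 - x ^+ 2) * p2,
            qb w u = 2 * x * y * p2
          & qc w u = p1 + (x ^+ 2 - y ^+ 2) * p2])) /\
  (equivariant_forms (@O2 R) (@SO2 R) (@O2 R)
      (fun p w u => let x := xcoord u in let y := ycoord u in
        let p1 := p 1%N u in
        [/\ qa w u = 2 * x * y * p1,
            qb w u = (x ^+ 2 - y ^+ 2) * p1
          & qc w u = - (2 * x * y * p1)])) /\
  (forall n : nat, (3 <= n)%N ->
    equivariant_forms (@Zrot R n) (@Zrot R n) (@Zrot R n)
      (fun p w u => let x := xcoord u in let y := ycoord u in
        let p1 := p 1%N u in let p2 := p 2%N u in let p3 := p 3%N u in
        let p4 := p 4%N u in let p5 := p 5%N u in
        let A1 := reZ (n - 2) u in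
        let A2 := imZ (n - 2) u in
        [/\ qa w u = p1 + (y ^+ 2 - x ^+ 2) * p2 + 2 * x * y * p3 - A1 * p4 - A2 * p5,
            qb w u = 2 * x * y * p2 + (x ^+ 2 - y ^+ 2) * p3 + A1 * p5 - A2 * p4
          & qc w u = p1 + (x ^+ 2 - y ^+ 2) * p2 - 2 * x * y * p3 + A1 * p4 + A2 * p5])) /\
  (forall n : nat, (4 <= n)%N -> ~~ odd n ->
    equivariant_forms (@Zrot R n) (@Zrot R n./2) (@Zrot R n./2)
      (fun p w u => let x := xcoord u in let y := ycoord u in
        let p1 := p 1%N u in let p2 := p 2%N u in let p3 := p 3%N u in
        let p4 := p 4%N u in let p5 := p 5%N u in let p6 := p 6%N u in
        let A3 := reZ (n./2 - 2) u in
        let A4 := imZ (n./2 - 2) u in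
        let A5 := reZ n./2 u in
        let A6 := imZ n./2 u in
        let A7 := reZ (n./2 + 2) u in
        let A8 := imZ (n./2 + 2) u in
        [/\ qa w u = - A3 * p1 - A4 * p2 + A5 * p3 - A7 * p4 + A8 * p5 + A6 * p6,
            qb w u = - A4 * p1 + A3 * p2 + A8 * p4 + A7 * p5
          & qc w u = A3 * p1 + A4 * p2 + A5 * p3 + A7 * p4 - A8 * p5 + A6 * p6])) /\
  (forall n : nat, (3 <= n)%N ->
    equivariant_forms (Dih n (kappa_x R)) (Dih n (kappa_x R)) (@Zrot R n)
      (fun p w u => let x := xcoord u in let y := ycoord u in
        let p1 := p 1%N u in let p2 := p 2%N u in let p3 := p 3%N u in
        let A1 := reZ (n - 2) u in
        let A2 := imZ (n - 2) u in
        [/\ qa w u = p1 + (y ^+ 2 - x ^+ 2) * p2 - A1 * p3,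
            qb w u = 2 * x * y * p2 - A2 * p3
          & qc w u = p1 + (x ^+ 2 - y ^+ 2) * p2 + A1 * p3])) /\
  (forall n : nat, (3 <= n)%N ->
    equivariant_forms (Dih n (kappa_x R)) (@Zrot R n) (Dih n (kappa_x R))
      (fun p w u => let x := xcoord u in let y := ycoord u in
        let p1 := p 1%N u in let p2 := p 2%N u in let p3 := p 3%N u in
        let A1 := reZ (n - 2) u in
        let A2 := imZ (n - 2) u in
        let A9 := imZ n u in
        [/\ qa w u = 2 * x * y * p1 - A2 * p2 + A9 * p3,
            qb w u = (x ^+ 2 - y ^+ 2) * p1 + A1 * p2
          & qc w u = - (2 * x * y * p1) + A2 * p2 + A9 * p3])) /\
  (forall n : nat, (4 <= n)%N -> ~~ odd n ->
    equivariant_forms (Dih n (kappa_x R)) (Dih n./2 (kappa_x R)) (if odd n./2 then Dih n./2 (kappa_y R)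
         else Dih n./2 (rotation (2 * pi / n%:R) *m kappa_x R))
      (fun p w u => let x := xcoord u in let y := ycoord u in
        let p1 := p 1%N u in let p2 := p 2%N u in let p3 := p 3%N u in
        let A3 := reZ (n./2 - 2) u in
        let A4 := imZ (n./2 - 2) u in
        let A5 := reZ n./2 u in
        let A7 := reZ (n./2 + 2) u in
        let A8 := imZ (n./2 + 2) u in
        [/\ qa w u = - A3 * p1 + A5 * p2 - A7 * p3,
            qb w u = - A4 * p1 + A8 * p3
          & qc w u = A3 * p1 + A5 * p2 + A7 * p3])) /\
  (equivariant_forms (generated [set kappa_x R]) (generated [set kappa_x R]) [set 1%:M]
      (fun p w u => let x := xcoord u in let y := ycoord u in
        let p1 := p 1%N u in let p2 := p 2%N u in let p3 := p 3%N u in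
        [/\ qa w u = p1,
            qb w u = y * p2
          & qc w u = p3])) /\
  (equivariant_forms (generated [set kappa_x R]) [set 1%:M] (generated [set kappa_x R])
      (fun p w u => let x := xcoord u in let y := ycoord u in
        let p1 := p 1%N u in let p2 := p 2%N u in let p3 := p 3%N u in
        [/\ qa w u = y * p1,
            qb w u = p2
          & qc w u = y * p3])) /\
  (equivariant_forms (generated [set kappa_x R; kappa_y R]) (generated [set kappa_x R; kappa_y R]) (generated [set - 1%:M])
      (fun p w u => let x := xcoord u in let y := ycoord u in
        let p1 := p 1%N u in let p2 := p 2%N u in let p3 := p 3%N u in
        [/\ qa w u = p1,
            qb w u = x * y * p2
          & qc w u = p3])) /\
  (equivariant_forms (generated [set kappa_x R; kappa_y R]) (generated [set - 1%:M]) (generated [set kappa_x R; kappa_y R])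
      (fun p w u => let x := xcoord u in let y := ycoord u in
        let p1 := p 1%N u in let p2 := p 2%N u in let p3 := p 3%N u in
        [/\ qa w u = x * y * p1,
            qb w u = p2
          & qc w u = x * y * p3])) /\
  (equivariant_forms (generated [set kappa_x R; kappa_y R]) (generated [set kappa_x R]) (generated [set kappa_y R])
      (fun p w u => let x := xcoord u in let y := ycoord u in
        let p1 := p 1%N u in let p2 := p 2%N u in let p3 := p 3%N u in
        [/\ qa w u = x * p1,
            qb w u = y * p2
          & qc w u = x * p3])).
Proof.
split; first exact: SO2_forms.
split; first exact: O2_forms.
split; first exact: O2_det_forms.
split; first exact: Zrot_forms.
split; first exact: Zrot_half_forms.
split; first exact: Dih_forms.
split; first exact: Dih_det_forms.
split; first exact: Dih_half_forms.
split; first exact: Z2_forms.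
split; first exact: Z2_det_forms.
split; first exact: Z2Z2_forms.
split; first exact: Z2Z2_det_forms.
exact: Z2Z2_half_forms.
Qed.
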